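(* Let $n\ge 1$. For each $c>0$ the inclusion $\mathcal R^c_n\hookrightarrow\mathcal R_n$ is a homotopy equivalence. The same is true for the inclusions of subspaces $\mathcal{UR}^c_n\hookrightarrow\mathcal{UR}_n$, $\mathcal{VR}^c_n\hookrightarrow\mathcal{VR}_n$, $\mathcal W^c_n\hookrightarrow\mathcal W_n$, and $\mathcal{UW}^c_n\hookrightarrow\mathcal{UW}_n$.
   Context: A ring is a Euclidean (round) circle in $\mathbb R^3$. $\mathcal R_n$ is the space of unordered configurations of $n$ disjoint, pairwise unlinked (unoriented) rings in $\mathbb R^3$, topologized by the centers, radii and planes of the rings (a $6n$-manifold). Subspaces: $\mathcal{UR}_n$ consists of configurations of rings lying in planes parallel to the $yz$-plane; $\mathcal{VR}_n$ of configurations of rings lying in vertical planes (planes parallel to the $z$-axis); $\mathcal W_n$ of configurations of rings each of which lies in a vertical plane and is cut into two equal halves by the $xy$-plane (such rings are identified with their upper halves, called wickets); $\mathcal{UW}_n=\mathcal W_n\cap\mathcal{UR}_n$. Complexity: for a configuration $C\in\mathcal R_n$ consisting of circles $C_1,\dots,C_n$ of radii $r_1,\dots,r_n$, let $B_i$ be the closed ball with the same center as $C_i$ and radius $2r_i$. The complexity of $C$ is the maximum of the ratios $r_i/r_j\le 1$ over pairs of distinct circles $C_i,C_j$ with $B_i\cap B_j\ne\emptyset$; it is $0$ if no two of the $B_i$ intersect. For $c>0$, $\mathcal R^c_n\subset\mathcal R_n$ is the (open) subspace of configurations of complexity less than $c$, and $\mathcal{UR}^c_n$, $\mathcal{VR}^c_n$,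 $\mathcal W^c_n$, $\mathcal{UW}^c_n$ are the intersections of $\mathcal R^c_n$ with $\mathcal{UR}_n$, $\mathcal{VR}_n$, $\mathcal W_n$, $\mathcal{UW}_n$. *)

(* Defs.v *)
From HB Require Import structures.
From mathcomp Require Import all_boot all_order all_algebra fingroup perm.
From mathcomp Require Import all_classical all_reals all_analysis.
From mathcomp Require Import generic_quotient.

Set Implicit Arguments.
Unset Strict Implicit.
Unset Printing Implicit Defensive.

Import Order.TTheory GRing.Theory Num.Theory.
Import numFieldNormedType.Exports.

Local Open Scope classical_set_scope.
Local Open Scope quotient_scope.
Local Open Scope ring_scope.

Definition homotopic (R : realType) (X Y : topologicalType) (f g : X -> Y) :=
  exists H : R * X -> Y,
    [/\ {within `[0, 1] `*` setT, continuous H},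
        forall x, H (0, x) = f x & forall x, H (1, x) = g x].

Definition homotopy_equivalence (R : realType) (X Y : topologicalType)
    (f : X -> Y) :=
  continuous f /\
  exists g : Y -> X,
    [/\ continuous g, homotopic R (g \o f) id & homotopic R (f \o g) id].

Definition inclusion (T : Type) (A B : set T) (AB : A `<=` B)
    (x : set_type A) : set_type B :=
  exist _ (set_val x) (mem_set (AB _ (set_valP x))).

Section Rings.
Context {R : realType}.

Definition dot m (u v : 'rV[R]_m) : R := \sum_(i < m) u 0 i * v 0 i.

(* The library norm on row vectors is the sup norm. *)
Definition enorm m (u : 'rV[R]_m) : R := Num.sqrt (dot u u).

Definition eball m (c : 'rV[R]_m) (r : R) : set 'rV[R]_m :=
  [set p | enorm (p - c) <= r].

Definition esphere m (c : 'rV[R]_m) (r : R) : set 'rV[R]_m :=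
  [set p | enorm (p - c) = r].

(* A ring with an orientation of its plane: center, radius, unit normal. *)
Definition ring_data : Type := ('rV[R]_3 * R * 'rV[R]_3)%type.

Definition center (x : ring_data) : 'rV[R]_3 := x.1.1.
Definition radius (x : ring_data) : R := x.1.2.
Definition normal (x : ring_data) : 'rV[R]_3 := x.2.

Definition circle (x : ring_data) : set 'rV[R]_3 :=
  [set p | esphere (center x) (radius x) p /\ dot (p - center x) (normal x) = 0].

Definition parallel (x : ring_data) (u : 'rV[R]_3) : Prop :=
  dot u (normal x) = 0.

Definition same_ring (x y : ring_data) : Prop :=
  [/\ center x = center y, radius x = radius y &
      normal x = normal y \/ normal x = - normal y].

Definition bounds_disk (C D : set 'rV[R]_3) : Prop :=
  exists f : 'rV[R]_2 -> 'rV[R]_3,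
    [/\ {within eball 0 1, continuous f},
        {in eball 0 1 &, injective f},
        f @` eball 0 1 = D & f @` esphere 0 1 = C].

(* The two-component link with components C and C' is trivial: its components
   bound disjoint embedded disks. *)
Definition unlinked (C C' : set 'rV[R]_3) : Prop :=
  exists D D', [/\ bounds_disk C D, bounds_disk C' D' & D `&` D' = set0].

Section Configurations.
Variable n : nat.

Definition is_labelled_conf : set (prod_topology (fun _ : 'I_n => ring_data)) :=
  [set x | (forall i, 0 < radius (x i) /\ enorm (normal (x i)) = 1) /\
     (forall i j, i != j -> circle (x i) `&` circle (x j) = set0 /\
                            unlinked (circle (x i)) (circle (x j)))].

Definition labelled_conf : Type := set_type is_labelled_conf.
HB.instance Definition _ := Topological.on labelled_conf.

Definition ring_at (x : labelled_conf) (i : 'I_n) : ring_data := set_val x i.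

Definition same_conf (x y : labelled_conf) : bool :=
  `[< exists s : 'S_n, forall i, same_ring (ring_at x i) (ring_at y (s i)) >].

Lemma same_ring_sym (x y : ring_data) : same_ring x y -> same_ring y x.
Proof.
move=> [cxy rxy nxy]; split=> //; case: nxy => ->; first by left.
by right; rewrite opprK.
Qed.

Lemma same_ring_trans (y x z : ring_data) :
  same_ring x y -> same_ring y z -> same_ring x z.
Proof.
move=> [cxy rxy nxy] [cyz ryz nyz]; split; rewrite ?cxy ?rxy //.
by case: nxy nyz => -> [] ->; rewrite ?opprK; by [left|right].
Qed.

Lemma same_conf_refl : reflexive same_conf.
Proof.
by move=> x; apply/asboolP; exists 1%g => i; rewrite perm1; split=> //; left.
Qed.

Lemma same_conf_sym : symmetric same_conf.
Proof.
suff H x y : same_conf x y -> same_conf y x by move=> x y; apply/idP/idP; exact: H.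
move=> /asboolP[s xy]; apply/asboolP; exists s^-1%g => i.
by apply: same_ring_sym; rewrite -{2}(permKV s i); exact: xy.
Qed.

Lemma same_conf_trans : transitive same_conf.
Proof.
move=> y x z /asboolP[s xy] /asboolP[t yz]; apply/asboolP; exists (s * t)%g => i.
by rewrite permM; exact: same_ring_trans (xy i) (yz (s i)).
Qed.

Canonical same_conf_equiv :=
  EquivRel same_conf same_conf_refl same_conf_sym same_conf_trans.

(* Unordered configurations of unoriented rings; the topology is the quotient
   of that of the centers, radii and unit normals. *)
Definition ring_conf : Type := quotient_topology {eq_quot same_conf_equiv}.
HB.instance Definition _ := Topological.on ring_conf.
HB.instance Definition _ := Quotient.on ring_conf.

(* A labelling, with orientations, of the rings of a configuration. The notions
   below do not depend on this choice: see complexity_pi and rings_in_pi. *)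
Definition rings (C : ring_conf) : 'I_n -> ring_data := ring_at (repr C).

Definition complexity_of (x : 'I_n -> ring_data) : R :=
  \big[Num.max/0]_(i < n) \big[Num.max/0]_(j < n |
      [&& i != j, radius (x i) <= radius (x j) &
       `[< eball (center (x i)) (2 * radius (x i)) `&`
           eball (center (x j)) (2 * radius (x j)) !=set0 >]])
    (radius (x i) / radius (x j)).

Definition complexity (C : ring_conf) : R := complexity_of (rings C).

Definition rings_in (P : ring_data -> Prop) : set ring_conf :=
  [set C | forall i, P (rings C i)].

Definition conf_lt (c : R) : set ring_conf := [set C | complexity C < c].

(* Coordinates 0, 1, 2 are x, y, z. *)
Definition UR : set ring_conf :=
  rings_in (fun x => parallel x (delta_mx 0 1) /\ parallel x (delta_mx 0 2)).

Definition VR : set ring_conf := rings_in (fun x => parallel x (delta_mx 0 2)).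

(* A circle in a vertical plane is halved by the xy-plane exactly when its
   center lies in the xy-plane. *)
Definition W : set ring_conf :=
  rings_in (fun x => parallel x (delta_mx 0 2) /\ center x 0 2 = 0).

Definition UW : set ring_conf := W `&` UR.

Lemma repr_piP (x : labelled_conf) : exists s : 'S_n, forall i,
  same_ring (rings (\pi_ring_conf x) i) (ring_at x (s i)).
Proof.
apply/asboolP; rewrite -[X in is_true X]/(same_conf_equiv _ _).
by apply/eqmodP; exact: reprK.
Qed.

Lemma complexity_pi (x : labelled_conf) :
  complexity (\pi_ring_conf x) = complexity_of (ring_at x).
Proof.
have [s sx] := repr_piP x; rewrite /complexity /complexity_of.
rewrite [RHS](reindex_inj (@perm_inj _ s)); apply: eq_bigr => i _.
rewrite [RHS](reindex_inj (@perm_inj _ s)); apply: eq_big => [j|j _].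
  by have [-> -> _] := sx i; have [-> -> _] := sx j; rewrite (inj_eq perm_inj).
by have [_ -> _] := sx i; have [_ -> _] := sx j.
Qed.

Lemma rings_in_pi (P : ring_data -> Prop) (x : labelled_conf) :
  (forall y z, same_ring y z -> P y -> P z) ->
  rings_in P (\pi_ring_conf x) <-> forall i, P (ring_at x i).
Proof.
move=> PP; have [s sx] := repr_piP x; split=> Px i.
  by rewrite -(permKV s i); apply: PP (sx _) (Px _).
exact: PP (same_ring_sym (sx i)) (Px (s i)).
Qed.

Lemma dotuN m (u v : 'rV[R]_m) : dot u (- v) = - dot u v.
Proof. by rewrite /dot -sumrN; apply: eq_bigr => i _; rewrite mxE mulrN. Qed.

Lemma same_ring_parallel (x y : ring_data) (u : 'rV[R]_3) :
  same_ring x y -> parallel x u -> parallel y u.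
Proof.
move=> [_ _ [|]] nxy; rewrite /parallel nxy // dotuN => /eqP.
by rewrite oppr_eq0 => /eqP.
Qed.

Lemma same_ring_circle (x y : ring_data) :
  same_ring x y -> circle x = circle y.
Proof.
move=> [cxy rxy [|]] nxy; rewrite /circle cxy rxy nxy //.
apply/seteqP; split=> p [sp pn]; split=> //; last by rewrite dotuN pn oppr0.
by apply/eqP; rewrite -oppr_eq0 -dotuN; apply/eqP.
Qed.

End Configurations.
End Rings.

Arguments ring_data : clear implicits.
Arguments labelled_conf : clear implicits.
Arguments ring_conf : clear implicits.
Arguments UR : clear implicits.
Arguments VR : clear implicits.
Arguments W : clear implicits.
Arguments UW : clear implicits.
Arguments conf_lt : clear implicits.

(* Main.v *)
From Pilot Require Import Defs.
From mathcomp Require Import all_boot all_order all_algebra fingroup perm.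
From mathcomp Require Import generic_quotient.
From mathcomp Require Import all_classical all_reals all_analysis.
From mathcomp Require Import ring lra.
Set Implicit Arguments.
Unset Strict Implicit.
Unset Printing Implicit Defensive.
Import Order.TTheory GRing.Theory Num.Theory.
Import numFieldNormedType.Exports.
Import Pilot.Defs.
Local Open Scope classical_set_scope.
Local Open Scope ring_scope.

(* Two rings with disjoint circles are unlinked exactly when the hemispheres over them in the
   half space R^3 x R_+ are disjoint, that is, when no point q in both planes has the same
   power [|q - c|^2 - r^2 <= 0] with respect to both. If two rings keep their centers and their
   squared radii decrease at the same speed (the horizontal slices of the hemispheres), they stay
   unlinked. Let every ring shrink in this way, with a speed cut off when all the other rings are
   far away, or much larger, at the scale N of its radius; such a ring behaves like a point and is
   carried along by the similarities that shrink the larger rings near it. Explicit Euler steps of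
   this motion preserve unlinkedness, small complexity, the planes of the rings, and the
   xy-plane.
   If the orbit of a configuration never became such that all pairs are nearly out of contact,
   then the sum of the squared radii would force some rings to shrink to a common point. A discrete
   Gronwall estimate shows that such a cluster has, at late times, a diameter comparable to its
   radii, so that two rings finally follow the exact hemisphere flow and shrink to the same point:
   their hemispheres would have met all along. Hence every orbit reaches small complexity; stopping
   it there continuously gives a homotopy, equivariant under relabelling. *)

(** A flow would have to be integrated and stopped at a time that varies continuously; with explicit
    steps the homotopy is, near each configuration, a finite composition of continuous maps. Strides
    are bounded by the smallest squared radius, so that no ring dies and the orbit can always be
    continued. The price: if contact never ceased, the strides would be summable and the orbit would
    converge without stopping, so that the contradiction has to be found in a limit where some radii
    vanish. There a cluster must be shown to close up as fast as its radii. Larger rings that keep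
    shrinking move their circles at a rate unrelated to these radii; therefore small rings are
    carried along by weighted averages of the similarities of larger ones, which leaves only errors
    that telescope to radii of the cluster. Rings in contact 1 must not move at all, for the
    hemisphere argument needs fixed centers: hence the factor [1 - activity], and the dichotomy
    between active pairs and pairs so far apart, in terms of one of the radii, that moving only
    costs the passage from [N] to [N - 1]. *)

Section Euclid.
Context {R : realType} {m : nat}.
Implicit Types (u v w : 'rV[R]_m) (a b : R).

Lemma dotC u v : dot u v = dot v u.
Proof. by apply: eq_bigr => i _; rewrite mulrC. Qed.

Lemma dotDl u v w : dot (u + v) w = dot u w + dot v w.
Proof. by rewrite /dot -big_split; apply: eq_bigr => i _; rewrite mxE mulrDl. Qed.

Lemma dotDr u v w : dot w (u + v) = dot w u + dot w v.
Proof. by rewrite ![dot w _]dotC dotDl. Qed.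

Lemma dotZl a u v : dot (a *: u) v = a * dot u v.
Proof. by rewrite /dot mulr_sumr; apply: eq_bigr => i _; rewrite mxE mulrA. Qed.

Lemma dotZr a u v : dot u (a *: v) = a * dot u v.
Proof. by rewrite dotC dotZl dotC. Qed.

Lemma dotNr u v : dot u (- v) = - dot u v.
Proof. exact: dotuN. Qed.

Lemma dotNl u v : dot (- u) v = - dot u v.
Proof. by rewrite dotC dotNr dotC. Qed.

Lemma dotBl u v w : dot (u - v) w = dot u w - dot v w.
Proof. by rewrite dotDl dotNl. Qed.

Lemma dotBr u v w : dot w (u - v) = dot w u - dot w v.
Proof. by rewrite dotDr dotNr. Qed.

Lemma dot0l u : dot 0 u = 0.
Proof. by rewrite /dot big1 // => i _; rewrite mxE mul0r. Qed.

Lemma dot0r u : dot u 0 = 0.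
Proof. by rewrite dotC dot0l. Qed.

Definition dotE := (dotDl, dotDr, dotBl, dotBr, dotNl, dotNr, dotZl, dotZr,
  dot0l, dot0r).

Lemma dot_ge0 u : 0 <= dot u u.
Proof. by apply: sumr_ge0 => i _; rewrite -expr2 sqr_ge0. Qed.

Lemma dot_eq0 u : (dot u u == 0) = (u == 0).
Proof.
apply/idP/eqP => [|->]; last by rewrite dot0l.
rewrite psumr_eq0 => [/allP u0|i _]; last by rewrite -expr2 sqr_ge0.
apply/rowP => i; rewrite mxE; apply/eqP.
by have := u0 i (mem_index_enum i); rewrite /= mulf_eq0 orbb.
Qed.

Lemma enorm_ge0 u : 0 <= enorm u.
Proof. exact: sqrtr_ge0. Qed.

Lemma enorm_sqr u : enorm u ^+ 2 = dot u u.
Proof. by rewrite sqr_sqrtr // dot_ge0. Qed.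

Lemma enorm_le u a : 0 <= a -> (enorm u <= a) = (dot u u <= a ^+ 2).
Proof. by move=> a0; rewrite -enorm_sqr ler_sqr ?nnegrE ?enorm_ge0. Qed.

Lemma enorm_eq u a : 0 <= a -> enorm u = a <-> dot u u = a ^+ 2.
Proof.
move=> a0; rewrite -enorm_sqr; split=> [->//|/eqP].
by rewrite eqrXn2 ?enorm_ge0 // => /eqP.
Qed.

Lemma enorm0 : enorm (0 : 'rV[R]_m) = 0.
Proof. by rewrite /enorm dot0l sqrtr0. Qed.

Lemma enorm_eq0 u : (enorm u == 0) = (u == 0).
Proof. by rewrite -dot_eq0 -enorm_sqr sqrf_eq0. Qed.

Lemma enormZ a u : enorm (a *: u) = `|a| * enorm u.
Proof. by rewrite /enorm dotZl dotZr mulrA -expr2 sqrtrM ?sqr_ge0 // sqrtr_sqr. Qed.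

Lemma enormN u : enorm (- u) = enorm u.
Proof. by rewrite -scaleN1r enormZ normrN1 mul1r. Qed.

Lemma enormB u v : enorm (u - v) = enorm (v - u).
Proof. by rewrite -enormN opprB. Qed.

Lemma dot_le_enorm u v : `|dot u v| <= enorm u * enorm v.
Proof.
suff: dot u v ^+ 2 <= dot u u * dot v v.
  rewrite -!enorm_sqr -exprMn => le_sq.
  by rewrite -ler_sqr ?nnegrE ?mulr_ge0 ?enorm_ge0 // real_normK ?num_real.
have [->|v0] := eqVneq v 0; first by rewrite !dotE; lra.
have vv : 0 < dot v v by rewrite lt_def dot_eq0 v0 dot_ge0.
have := dot_ge0 (dot v v *: u - dot u v *: v).
rewrite !dotE (dotC v u) => h.
have {}h : 0 <= dot v v * (dot u u * dot v v - dot u v ^+ 2) by lra.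
by rewrite -subr_ge0; rewrite pmulr_rge0 in h.
Qed.

Lemma enormD u v : enorm (u + v) <= enorm u + enorm v.
Proof.
rewrite enorm_le ?addr_ge0 ?enorm_ge0 // !dotE (dotC v u).
have := dot_le_enorm u v; rewrite ler_norml => /andP[_].
have := enorm_sqr u; have := enorm_sqr v.
move: (enorm u) (enorm v) => a b; lra.
Qed.

Lemma enorm_triangle u v w : enorm (u - w) <= enorm (u - v) + enorm (v - w).
Proof. by have := enormD (u - v) (v - w); rewrite addrA subrK. Qed.

Lemma enorm_dist u v : `|enorm u - enorm v| <= enorm (u - v).
Proof.
have := enormD (u - v) v; have := enormD (v - u) u.
by rewrite !subrK (enormB v u) ler_norml => h1 h2; apply/andP; split; lra.
Qed.

Lemma enorm_sum (I : Type) (s : seq I) (P : pred I) (F : I -> 'rV[R]_m) :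
  enorm (\sum_(i <- s | P i) F i) <= \sum_(i <- s | P i) enorm (F i).
Proof.
elim/big_rec2: _ => [|i x y _ le_yx]; first by rewrite enorm0.
by apply: le_trans (enormD _ _) _; rewrite lerD2l.
Qed.

Lemma coord_le_enorm u i : `|u 0 i| <= enorm u.
Proof.
rewrite -ler_sqr ?nnegrE ?enorm_ge0 // enorm_sqr real_normK ?num_real //.
rewrite /dot (bigD1 i) //= -expr2 lerDl.
by apply: sumr_ge0 => j _; rewrite -expr2 sqr_ge0.
Qed.

Lemma enorm_le_sum u : enorm u <= \sum_i `|u 0 i|.
Proof.
rewrite [in leLHS](row_sum_delta u).
apply: le_trans (enorm_sum _ _ _) _; apply: ler_sum => i _.
rewrite enormZ -[leRHS]mulr1 ler_wpM2l //.
rewrite enorm_le // expr1n /dot (bigD1 i) //= big1 ?addr0 => [|j ji]; rewrite !mxE ?eqxx ?mulr1 //.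
by rewrite (negbTE ji) andbF mul0r.
Qed.

Lemma continuous_coord (i : 'I_m) : continuous (fun u : 'rV[R]_m => u 0 i).
Proof. exact: coord_continuous. Qed.

Lemma cvg_dot (T : Type) (F : set_system T) {FF : Filter F} (f g : T -> 'rV[R]_m) u v :
  f @ F --> u -> g @ F --> v -> (fun x => dot (f x) (g x)) @ F --> dot u v.
Proof.
move=> fu gv; apply: cvg_big => [|i _]; first exact: add_continuous.
have hf : (fun x => f x 0 i) @ F --> u 0 i.
  exact: (cvg_comp _ _ fu (@continuous_coord i u)).
have hg : (fun x => g x 0 i) @ F --> v 0 i.
  exact: (cvg_comp _ _ gv (@continuous_coord i v)).
exact: cvgM hf hg.
Qed.

Lemma cvg_enorm (T : Type) (F : set_system T) {FF : Filter F} (f : T -> 'rV[R]_m) u :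
  f @ F --> u -> (fun x => enorm (f x)) @ F --> enorm u.
Proof.
move=> fu; apply: (cvg_comp _ _ (cvg_dot fu fu)); exact: sqrt_continuous.
Qed.

End Euclid.

(** * Limits of maxima and minima, the clamp function *)

Section RealLimits.
Context {R : realType} {T : Type} {F : set_system T} {FF : Filter F}.
Implicit Types (f g : T -> R) (a b : R).

Lemma cvg_maxr f g a b : f @ F --> a -> g @ F --> b ->
  (fun x => Num.max (f x) (g x)) @ F --> Num.max a b.
Proof.
move=> fa gb; under eq_fun do rewrite maxr_absE; rewrite maxr_absE.
by apply: cvgMl; apply: cvgD; [exact: cvgD|apply: cvg_norm; exact: cvgB].
Qed.

Lemma cvg_minr f g a b : f @ F --> a -> g @ F --> b ->
  (fun x => Num.min (f x) (g x)) @ F --> Num.min a b.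
Proof.
move=> fa gb; under eq_fun do rewrite minr_absE; rewrite minr_absE.
by apply: cvgMl; apply: cvgB; [exact: cvgD|apply: cvg_norm; exact: cvgB].
Qed.

End RealLimits.

Section Clamp.
Context {R : realType}.
Implicit Types (s : R).

Definition clamp s : R := Num.max 0 (Num.min 1 s).

Lemma clamp_itv s : 0 <= clamp s <= 1.
Proof. by rewrite /clamp le_max lexx ge_max ler01 ge_min lexx. Qed.

Lemma clamp_le0 s : s <= 0 -> clamp s = 0.
Proof. by move=> s0; rewrite /clamp max_l // ge_min s0 orbT. Qed.

Lemma clamp_ge1 s : 1 <= s -> clamp s = 1.
Proof. by move=> s1; rewrite /clamp min_l // max_r. Qed.

Lemma clamp_continuous : continuous clamp.
Proof.
move=> s; apply: cvg_maxr; first exact: cvg_cst.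
by apply: cvg_minr; [exact: cvg_cst|exact: cvg_id].
Qed.

End Clamp.

Lemma within_continuous_comp_into (T U V : topologicalType) (A : set T) (B : set U) (h : T -> U)
    (f : U -> V) : continuous h -> (forall x, A x -> B (h x)) ->
  {within B, continuous f} -> {within A, continuous (f \o h)}.
Proof.
move=> hc AB /subspace_continuousP fc; apply/subspace_continuousP => x Ax.
apply: cvg_comp; last exact: fc (AB _ Ax).
move=> C; rewrite /within /= => /hc; rewrite /nbhs /= => hC.
by apply: filterS hC => y /= + Ay; apply; exact: AB.
Qed.

Lemma continuous_comp_into (T U V : topologicalType) (A : set U) (h : T -> U)
    (f : U -> V) : continuous h -> (forall x, A (h x)) ->
  {within A, continuous f} -> continuous (f \o h).
Proof.
move=> hc hA fc; have := within_continuous_comp_into (A := setT) hc (fun x _ => hA x) fc => w.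
exact: (continuous_subspace_setT _).2 w.
Qed.

Lemma cvg_pairP (T : Type) (U V : topologicalType) (F : set_system T) {FF : Filter F}
    (f : T -> U) (g : T -> V) (x : U) (y : V) :
  f @ F --> x -> g @ F --> y -> (fun z => (f z, g z)) @ F --> (x, y).
Proof. by move=> fx gy; exact: cvg_pair fx gy. Qed.

(** * Angles of plane loops that extend over the disc *)

Section Lifting.
Context {R : realType}.
Implicit Types (a b t x : R).

(** The angle from [a] to [b] is the [atan] of cross product over dot product as long as it is
    acute; [l] absorbs the lengths. *)
Lemma atan_rotation (a1 a2 b1 b2 : R) : let d := a1 * b1 + a2 * b2 in
  let t := atan ((a1 * b2 - a2 * b1) / d) in 0 < d ->
  exists2 l, 0 < l & b1 = l * (a1 * cos t - a2 * sin t) /\ b2 = l * (a1 * sin t + a2 * cos t).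
Proof.
move=> d t d0.
have c0 : 0 < cos t by rewrite cos_atan invr_gt0 sqrtr_gt0 ltr_pwDl ?sqr_ge0.
have st : sin t = (a1 * b2 - a2 * b1) / d * cos t.
  by rewrite -[X in X * _](atanK) /tan -/t divfK // gt_eqF.
have a0 : 0 < a1 ^+ 2 + a2 ^+ 2.
  rewrite lt_def addr_ge0 ?sqr_ge0 // andbT; apply: contraTneq d0.
  move/eqP; rewrite paddr_eq0 ?sqr_ge0 // !sqrf_eq0 => /andP[/eqP a10 /eqP a20].
  by rewrite /d a10 a20 !mul0r addr0 ltxx.
exists (d / (cos t * (a1 ^+ 2 + a2 ^+ 2))); first by rewrite divr_gt0 ?mulr_gt0.
rewrite st; move: (cos t) c0 => c c0 {t st}.
by split; rewrite /d; field; rewrite -/d !gt_eqF.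
Qed.

Lemma rotationD (a1 a2 l m s t : R) :
  let b1 := l * (a1 * cos s - a2 * sin s) in let b2 := l * (a1 * sin s + a2 * cos s) in
  m * (b1 * cos t - b2 * sin t) = m * l * (a1 * cos (s + t) - a2 * sin (s + t)) /\
  m * (b1 * sin t + b2 * cos t) = m * l * (a1 * sin (s + t) + a2 * cos (s + t)).
Proof. by move=> b1 b2; rewrite cosD sinD /b1 /b2; split; ring. Qed.

Variables (G1 G2 : R * R -> R).
Hypotheses (G1c : continuous G1) (G2c : continuous G2).
Hypothesis G_neq0 : forall z, 0 < G1 z ^+ 2 + G2 z ^+ 2.
Hypothesis G_base : forall x, G1 (0, x) = G1 (0, 0) /\ G2 (0, x) = G2 (0, 0).

Let dotG z z' := G1 z * G1 z' + G2 z * G2 z'.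
Let crossG z z' := G1 z * G2 z' - G2 z * G1 z'.

(** A nonzero vector has positive dot product with itself, hence with its neighbours; compactness of
    the rectangle makes one step length work everywhere. *)
Lemma uniform_acute b : exists N : nat, forall s x e,
  0 <= s <= 1 -> 0 <= x <= b -> 0 <= e <= N.+1%:R^-1 -> 0 < dotG (s, x) (s + e, x).
Proof.
have cK : compact (`[0, 1] `*` `[0, b] : set (R * R)).
  by apply: compact_setX; exact: segment_compact.
have /compact_near_coveringP /(_ _ \oo
    (fun N z => forall e, 0 <= e <= N.+1%:R^-1 -> 0 < dotG z (z.1 + e, z.2))) := cK.
case=> [[s x] _|N _ /(_ N (leqnn N)) HN]; last first.
  by exists N => s x e s01 x0b e0; apply: (HN (s, x)) => //; split; rewrite /= in_itv.
have lim : (fun w : (R * R) * R => dotG w.1 (w.1.1 + w.2, w.1.2)) @ ((s, x), 0) -->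
    dotG (s, x) (s, x).
  have c1 : (fun w : (R * R) * R => w.1) @ ((s, x), 0) --> (s, x) by exact: cvg_fst.
  have c2 : (fun w : (R * R) * R => (w.1.1 + w.2, w.1.2)) @ ((s, x), 0) --> (s, x).
    apply: cvg_pairP => /=.
      rewrite -[X in _ --> X]addr0.
      apply: cvgD; last exact: cvg_snd.
      by apply: cvg_comp c1 _; exact: cvg_fst.
    by apply: cvg_comp c1 _; exact: cvg_snd.
  have g1 := cvg_comp _ _ c1 (@G1c (s, x)); have g1' := cvg_comp _ _ c2 (@G1c (s, x)).
  have g2 := cvg_comp _ _ c1 (@G2c (s, x)); have g2' := cvg_comp _ _ c2 (@G2c (s, x)).
  exact: cvgD (cvgM g1 g1') (cvgM g2 g2').
have pos : 0 < dotG (s, x) (s, x) by rewrite /dotG -!expr2 G_neq0.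
have [[A E] /= [nA [e /= e0 nE]] AE] := lim _ (open_nbhs_nbhs (conj (@open_gt _ 0) pos)).
have nN : \forall N \near \oo, (N.+1%:R^-1 : R) < e by exact: near_infty_natSinv_lt (PosNum e0).
exists (A, [set N : nat | (N.+1%:R^-1 : R) < e]) => //=.
move=> [z N] /= [Az Ne] t /andP[t0 te]; apply: (AE (z, t)); split=> //=.
by apply: nE; rewrite /ball /= sub0r normrN ger0_norm // (le_lt_trans te).
Qed.

(** The angle at s = 1 is the sum of the small turns along the segment from s = 0, so that it
    depends only on [G1] and [G2] on that segment. The second conclusion thus makes the angle
    periodic for a loop that extends over the disc. *)
Lemma angle_lift b : 0 <= b -> exists th : R -> R,
  [/\ {within `[0, b], continuous th},
      forall x y, (forall s, G1 (s, x) = G1 (s, y) /\ G2 (s, x) = G2 (s, y)) -> th x = th y &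
      forall x, 0 <= x <= b -> exists2 l, 0 < l &
        G1 (1, x) = l * (G1 (0, 0) * cos (th x) - G2 (0, 0) * sin (th x)) /\
        G2 (1, x) = l * (G1 (0, 0) * sin (th x) + G2 (0, 0) * cos (th x))].
Proof.
move=> b0; have [N HN] := uniform_acute b.
pose q k : R := k%:R / N.+1%:R.
pose st k x := atan (crossG (q k, x) (q k.+1, x) / dotG (q k, x) (q k.+1, x)).
have qS k : q k.+1 = q k + N.+1%:R^-1 by rewrite /q -natr1 mulrDl mul1r.
have acute k x : (k < N.+1)%N -> 0 <= x <= b -> 0 < dotG (q k, x) (q k.+1, x).
  move=> kN xb; rewrite qS; apply: HN => //; last by rewrite invr_ge0 ler0n lexx.
  by rewrite divr_ge0 //= ler_pdivrMr ?ltr0n // mul1r ler_nat ltnW.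
exists (fun x => \sum_(k < N.+1) st k x); split.
- apply: continuous_in_subspaceT => x; rewrite inE /= in_itv /= => xb.
  apply: cvg_big => [|k _]; first exact: add_continuous.
  have pc (s : R) : (fun y => (s, y)) @ x --> (s, x) by apply: cvg_pairP; [exact: cvg_cst|exact: cvg_id].
  have c1 s : (fun y => G1 (s, y)) @ x --> G1 (s, x) by exact: cvg_comp (pc s) (@G1c (s, x)).
  have c2 s : (fun y => G2 (s, y)) @ x --> G2 (s, x) by exact: cvg_comp (pc s) (@G2c (s, x)).
  have d_ne0 : dotG (q k, x) (q k.+1, x) != 0 by rewrite gt_eqF // acute.
  have cr : (fun y => crossG (q k, y) (q k.+1, y)) @ x --> crossG (q k, x) (q k.+1, x).
    exact: cvgB (cvgM (c1 _) (c2 _)) (cvgM (c2 _) (c1 _)).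
  have dt : (fun y => dotG (q k, y) (q k.+1, y)) @ x --> dotG (q k, x) (q k.+1, x).
    exact: cvgD (cvgM (c1 _) (c1 _)) (cvgM (c2 _) (c2 _)).
  exact: cvg_comp _ _ (cvgM cr (cvgV d_ne0 dt)) (@continuous_atan _ _).
- by move=> x y xy; apply: eq_bigr => k _; rewrite /st /crossG /dotG !(xy _).1 !(xy _).2.
- move=> x xb.
  suff H k : (k <= N.+1)%N -> exists2 l, 0 < l &
      G1 (q k, x) = l * (G1 (0, 0) * cos (\sum_(i < k) st i x) -
                         G2 (0, 0) * sin (\sum_(i < k) st i x)) /\
      G2 (q k, x) = l * (G1 (0, 0) * sin (\sum_(i < k) st i x) +
                         G2 (0, 0) * cos (\sum_(i < k) st i x)).
    by have := H N.+1 (leqnn _); rewrite {1 2}/q divff.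
  elim: k => [_|k IH kN].
    exists 1 => //; rewrite big_ord0 cos0 sin0 /q mul0r.
    by have [-> ->] := G_base x; split; ring.
  have [l l0 [e1 e2]] := IH (ltnW kN).
  have [m m0 []] := atan_rotation (acute _ _ kN xb).
  rewrite -/(crossG (q k, x) (q k.+1, x)) -/(dotG (q k, x) (q k.+1, x)) -/(st k x) => -> ->.
  exists (m * l); first exact: mulr_gt0.
  rewrite big_ord_recr /= e1 e2.
  by have [<- <-] := rotationD (G1 (0, 0)) (G2 (0, 0)) l m (\sum_(i < k) st i x) (st k x).
Qed.
End Lifting.

Section Disc.
Context {R : realType}.

Let e (x : R) : 'rV[R]_2 := cos x *: delta_mx 0 0 + sin x *: delta_mx 0 1.

Lemma dot_delta m (i j : 'I_m) : dot (delta_mx 0 i : 'rV[R]_m) (delta_mx 0 j) = (i == j)%:R.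
Proof.
rewrite /dot (bigD1 i) //= big1 ?addr0 => [|k ki]; rewrite !mxE ?eqxx /= ?mul1r //.
by rewrite (negbTE ki) mul0r.
Qed.

Lemma enorm_e x : enorm (e x) = 1.
Proof.
apply/enorm_eq => //; rewrite /e !dotE !dot_delta /= !mulr1 !mulr0 addr0 add0r -!expr2.
by rewrite cos2Dsin2 expr1n.
Qed.

(** A one-dimensional Borsuk-Ulam argument: the boundary loop extends over the disc, so its angle is
    a periodic function, and such a function agrees at some pair of antipodal points. These would
    have the same direction. *)
Lemma disc_winding (F G : 'rV[R]_2 -> R) :
  {within eball 0 1, continuous F} -> {within eball 0 1, continuous G} ->
  (forall u, eball 0 1 u -> 0 < F u ^+ 2 + G u ^+ 2) ->
  (forall u v l, esphere 0 1 u -> esphere 0 1 v -> 0 < l ->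
     F u = l * F v -> G u = l * G v -> u = v) -> False.
Proof.
move=> Fc Gc FG0 inj.
(* Polar coordinates; clamping the radius makes [F \o h] and [G \o h] continuous on the whole plane,
   as [angle_lift] requires. *)
pose h (z : R * R) : 'rV[R]_2 := clamp z.1 *: e z.2.
have hc : continuous h.
  have clc : continuous (fun z : R * R => clamp z.1).
    move=> z; have z1 : (fun z : R * R => z.1) @ z --> z.1 by exact: cvg_fst.
    exact: (cvg_comp _ _ z1 (@clamp_continuous R z.1)).
  have ec : continuous (fun z : R * R => e z.2).
    move=> [s z]; apply: cvgD; apply: cvgZr_tmp.
      exact: (cvg_comp snd cos cvg_snd (@continuous_cos R z)).
    exact: (cvg_comp snd sin cvg_snd (@continuous_sin R z)).
  by move=> z; apply: cvgZ; [exact: clc|exact: ec].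
have hb z : eball 0 1 (h z).
  by rewrite /eball /= subr0 enormZ enorm_e mulr1 ger0_norm; have := clamp_itv z.1; lra.
have h1 x : h (1, x) = e x by rewrite /h /= clamp_ge1 ?scale1r.
have h0 x : h (0, x) = 0 by rewrite /h /= clamp_le0 // scale0r.
have [z|x||th [thc th_eq thP]] :=
  angle_lift (@continuous_comp_into _ _ _ _ _ F hc hb Fc) (@continuous_comp_into _ _ _ _ _ G hc hb Gc) _ _
  (b := 2 * pi).
- exact: FG0.
- by rewrite /= !h0.
- by rewrite mulr_ge0 // pi_ge0.
have pi0 := @pi_ge0 R.
have thpi : th (2 * pi) = th 0.
  by apply: th_eq => s; rewrite /= /h /e /= mulr2n mulrDl !mul1r cos2pi sin2pi cos0 sin0.
have [x x0pi] : exists2 x, x \in `[0, pi] & th x - th (x + pi) = 0.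
  have c1 : {within `[0, pi], continuous th}.
    by apply: continuous_subspaceW thc => x /=; rewrite !in_itv /= => /andP[? ?]; lra.
  have c2 : {within `[0, pi], continuous (fun x => th (x + pi))}.
    apply: within_continuous_comp_into thc => [x|x /=]; last by rewrite !in_itv /= => /andP[? ?]; lra.
    by apply: cvgD; [exact: cvg_id|exact: cvg_cst].
  apply: IVT => //; first by move=> x; apply: cvgB; [exact: c1|exact: c2].
  rewrite add0r -mulr2n -mulr_natl thpi ge_min le_max.
  by case: (lerP 0 (th 0 - th pi)) => ?; apply/andP; split; apply/orP; lra.
move=> /subr0_eq eqx; move: x0pi; rewrite in_itv /= => /andP[x0 xpi].
have [|l l0 [F1 G1]] := thP x; first by lra.
have [|m m0 [F2 G2]] := thP (x + pi); first by lra.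
have ex : e (x + pi) = - e x by rewrite /e cosDpi sinDpi !scaleNr opprD.
have /eqP : e x = e (x + pi).
  apply: (inj _ _ (l / m)); rewrite ?divr_gt0 // /esphere /= ?subr0 ?enorm_e //.
    by move: F1 F2; rewrite /= !h1 => -> ->; rewrite eqx; field; rewrite gt_eqF.
  by move: G1 G2; rewrite /= !h1 => -> ->; rewrite eqx; field; rewrite gt_eqF.
rewrite ex -subr_eq0 opprK -mulr2n -scaler_nat scaler_eq0 pnatr_eq0 /= -enorm_eq0 enorm_e.
by rewrite oner_eq0.
Qed.
End Disc.

(** * Linking of two rings *)

Section Hit.
Context {R : realType}.
Local Notation ring := (ring_data R).
Implicit Types (x y : ring) (p q : 'rV[R]_3).

Definition pow x q := dot (q - center x) (q - center x) - radius x ^+ 2.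

Definition in_plane x q := dot (q - center x) (normal x) = 0.

Definition hit x y :=
  exists q, [/\ in_plane x q, in_plane y q, pow x q = pow y q & pow x q <= 0].

Lemma hit_sym x y : hit x y -> hit y x.
Proof. by move=> [q [px py e le0]]; exists q; rewrite -e. Qed.

Lemma circleP x q : 0 <= radius x -> circle x q <-> pow x q = 0 /\ in_plane x q.
Proof.
move=> r0; rewrite /circle /esphere /pow /=; split=> -[h ?]; split=> //.
  by rewrite ((enorm_eq _ r0).1 h) subrr.
by apply/(enorm_eq _ r0)/subr0_eq.
Qed.

Lemma powD x q d :
  pow x (q + d) = dot d d + 2 * dot d (q - center x) + pow x q.
Proof.
rewrite /pow addrAC; move: (q - center x) => v; rewrite !dotE (dotC v d); ring.
Qed.

Lemma in_planeD x q d : in_plane x q -> in_plane x (q + d) <-> dot d (normal x) = 0.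
Proof. by rewrite /in_plane => qx; rewrite addrAC dotDl qx add0r. Qed.

Lemma positive_root (a b c : R) : 0 < a -> c < 0 ->
  exists2 t, 0 < t & a * t ^+ 2 + 2 * (b * t) + c = 0.
Proof.
move=> a0 c0; pose s := Num.sqrt (b ^+ 2 - a * c).
have ac : 0 < - (a * c) by rewrite -mulrN mulr_gt0 ?oppr_gt0.
have s2 : s ^+ 2 = b ^+ 2 - a * c.
  by rewrite sqr_sqrtr //; have := sqr_ge0 b; lra.
exists ((s - b) / a).
  have s0 : 0 <= s by exact: sqrtr_ge0.
  by rewrite divr_gt0 // subr_gt0 ltNge; apply/negP => sb; nra.
have -> : a * ((s - b) / a) ^+ 2 + 2 * (b * ((s - b) / a)) + c =
  (s ^+ 2 - b ^+ 2 + a * c) / a by field; rewrite gt_eqF.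
by rewrite s2 [X in X / _](_ : _ = 0) ?mul0r //; ring.
Qed.

(* The pair (pow y, signed distance to the plane of y) vanishes exactly on the
   circle of y; seen from q, it is linear along the circle of x, which winds
   once around q. *)
Lemma unlinked_not_hit x y : 0 < radius x -> 0 < radius y ->
  circle x `&` circle y = set0 -> unlinked (circle x) (circle y) -> ~ hit x y.
Proof.
move=> rx ry xy0 [D [D' [[f [fc finj fD fC]] [f' [_ _ fD' fC']] DD0]]].
move=> [q [qx qy powq]].
have offy z : D z -> ~ circle y z.
  move=> Dz; rewrite -fC' => -[u su fu]; suff : (D `&` D') z by rewrite DD0.
  by split=> //; rewrite -fD' -fu; exists u => //; move: su; rewrite /esphere /eball /= => ->.
rewrite le_eqVlt => /orP[/eqP pq0|pq_lt0].
  suff : (circle x `&` circle y) q by rewrite xy0.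
  by split; apply/circleP; rewrite ?ltW // -?powq.
have onx u : esphere 0 1 u -> pow x (f u) = 0 /\ dot (f u - q) (normal x) = 0.
  move=> su; have /(circleP _ (ltW rx))[-> h] : circle x (f u) by rewrite -fC; exists u.
  by split=> //; apply/(in_planeD _ qx); rewrite addrC subrK.
pose F u := pow y (f u); pose G u := dot (f u - center y) (normal y).
have E u : f u = q + (f u - q) by rewrite addrC subrK.
have FE u : esphere 0 1 u -> F u = 2 * dot (f u - q) (center x - center y).
  move=> /onx[]; rewrite (congr1 (pow x) (E u)) powD => px _.
  rewrite /F (congr1 (pow y) (E u)) powD -powq.
  have -> : center x - center y = (q - center y) - (q - center x).
    by apply/rowP => i; rewrite !mxE; ring.
  rewrite (dotBr (q - center y)); lra.
have GE u : G u = dot (f u - q) (normal y).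
  move: qy; rewrite /G /in_plane !dotBl; lra.
have fc' (v : 'rV[R]_3) : {within eball 0 1, continuous (fun u => f u - v)}.
  by move=> u; apply: cvgB; [exact: fc|exact: cvg_cst].
apply: (@disc_winding R F G).
- by move=> u; apply: cvgB; [apply: cvg_dot; exact: fc'|exact: cvg_cst].
- by move=> u; apply: cvg_dot; [exact: fc'|exact: cvg_cst].
- move=> u bu; rewrite lt_def addr_ge0 ?sqr_ge0 // andbT.
  apply/negP; rewrite paddr_eq0 ?sqr_ge0 // !sqrf_eq0 => /andP[/eqP F0 /eqP G0].
  by apply: (offy (f u)); [rewrite -fD; exists u|apply/circleP; rewrite ?ltW].
- move=> u v l su sv l0 Fl Gl.
  have [[pu nu] [pv nv]] := (onx _ su, onx _ sv).
  move: Fl Gl; rewrite !GE !FE // => Fl Gl.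
  have duv : f u - q = l *: (f v - q).
    (* If [d] were nonzero, the line through [q] along [d] would stay in both planes and keep the
       two powers equal. As [q] is strictly inside the circle of x, the line would meet both circles
       in the same point. *)
    apply/eqP; rewrite -subr_eq0; set d := (X in X == 0).
    have dx : dot d (normal x) = 0 by rewrite dotBl dotZl nu nv mulr0 subr0.
    have dy : dot d (normal y) = 0 by rewrite dotBl dotZl Gl subrr.
    have dc : dot d (center x - center y) = 0 by rewrite dotBl dotZl; lra.
    apply/negPn/negP => d0.
    have dd : 0 < dot d d by rewrite lt_def dot_eq0 d0 dot_ge0.
    have [t t0 tE] := positive_root (dot d (q - center x)) dd pq_lt0.
    suff : (circle x `&` circle y) (q + t *: d) by rewrite xy0.
    have zx : pow x (q + t *: d) = 0 by rewrite powD !dotZl !dotZr; lra.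
    split; apply/circleP; rewrite ?ltW //; split=> //.
    + by apply/in_planeD => //; rewrite dotZl dx mulr0.
    + rewrite -zx !powD -powq; congr (_ + _ * _ + _).
      by rewrite !dotZl; move: dc; rewrite !dotBr => /subr0_eq ->.
    + by apply/in_planeD => //; rewrite dotZl dy mulr0.
  (* A ray from the interior point [q] meets the circle of x only once. *)
  have l1 : l = 1.
    move: pu pv; rewrite (congr1 (pow x) (E u)) (congr1 (pow x) (E v)) duv !powD !dotZl !dotZr.
    have := dot_ge0 (f v - q).
    move: (dot (f v - q) (f v - q)) (dot (f v - q) (q - center x)) => B C B0 e1 e2.
    have /eqP : (l - 1) * (l * B - pow x q) = 0.
      have -> : (l - 1) * (l * B - pow x q) =
        (l * (l * B) + 2 * (l * C) + pow x q) - l * (B + 2 * C + pow x q) by ring.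
      by rewrite e1 e2 mulr0 subr0.
    rewrite mulf_eq0 => /orP[|/eqP]; first by rewrite subr_eq0 => /eqP.
    by have := mulr_ge0 (ltW l0) B0; lra.
  apply: finj; rewrite ?inE.
  + by move: su; rewrite /esphere /eball /= => ->.
  + by move: sv; rewrite /esphere /eball /= => ->.
  + by rewrite E duv l1 scale1r -E.
Qed.
End Hit.

(** * Disjoint disks obtained by projecting hemispheres *)

Section Caps.
Context {R : realType}.
Local Notation ring := (ring_data R).
Implicit Types (x y : ring) (w : 'rV[R]_3).

Let v3 (a b c : R) : 'rV[R]_3 := \row_j nth 0 [:: a; b; c] j.

Let dot3 a b c a' b' c' : dot (v3 a b c) (v3 a' b' c') = a * a' + b * b' + c * c'.
Proof. by rewrite /dot !big_ord_recl big_ord0 !mxE /= addr0 addrA. Qed.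

Let v3E (u : 'rV[R]_3) : exists a b c, u = v3 a b c.
Proof.
exists (u 0 0), (u 0 1), (u 0 2); apply/rowP => j; rewrite !mxE.
by case: j => -[|[|[|//]]] hj /=; congr (u _ _); apply: val_inj.
Qed.

(** Off the third axis, the frame consists of the unit tangents to the parallel and to the meridian
    of the sphere at [nu]. *)
Lemma orthonormal_frame (nu : 'rV[R]_3) : dot nu nu = 1 -> exists e1 e2,
  [/\ dot e1 e1 = 1, dot e2 e2 = 1, dot e1 e2 = 0, dot e1 nu = 0 /\ dot e2 nu = 0 &
      forall v, dot v nu = 0 -> v = dot v e1 *: e1 + dot v e2 *: e2].
Proof.
have [a [b [c ->]]] := v3E nu; rewrite dot3 => n1.
have [s0|s_neq0] := eqVneq (a ^+ 2 + b ^+ 2) 0.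
  have [a0 b0] : a = 0 /\ b = 0.
    by move/eqP: s0; rewrite paddr_eq0 ?sqr_ge0 // !sqrf_eq0 => /andP[/eqP -> /eqP ->].
  exists (v3 1 0 0), (v3 0 1 0); rewrite !dot3 a0 b0; split; try ring; first by split; ring.
  move=> v; have [x [y [z ->]]] := v3E v; rewrite !dot3 => vn.
  have z0 : z = 0.
    have : z * (a * a + b * b + c * c) = c * (x * 0 + y * 0 + z * c) by rewrite a0 b0; ring.
    by rewrite vn n1 mulr1 mulr0.
  apply/rowP => j; rewrite !mxE z0.
  by case: j => -[|[|[|//]]] hj /=; ring.
pose s := Num.sqrt (a ^+ 2 + b ^+ 2).
have ab0 : 0 < a ^+ 2 + b ^+ 2 by rewrite lt_def s_neq0 addr_ge0 ?sqr_ge0.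
have s0 : s != 0 by rewrite gt_eqF // sqrtr_gt0.
have s2 : s ^+ 2 = a ^+ 2 + b ^+ 2 by rewrite sqr_sqrtr // ltW.
pose al := a / s; pose be := b / s.
have [aE bE] : a = s * al /\ b = s * be by rewrite /al /be ![s * _]mulrC !divfK.
have ab1 : al ^+ 2 + be ^+ 2 = 1.
  by rewrite /al /be !expr_div_n -mulrDl s2 divff.
have cs1 : c ^+ 2 + s ^+ 2 = 1 by lra.
move: al be aE bE ab1 => al be -> -> ab1 {n1 s_neq0 ab0 s2}.
exists (v3 (- be) al 0), (v3 (- (c * al)) (- (c * be)) s).
rewrite !dot3; split.
- by rewrite -ab1; ring.
- transitivity (c ^+ 2 * (al ^+ 2 + be ^+ 2) + s ^+ 2); first ring.
  by rewrite ab1 mulr1.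
- by ring.
- split; first by ring.
  transitivity (c * s * (1 - (al ^+ 2 + be ^+ 2))); first ring.
  by rewrite ab1 subrr mulr0.
- move=> v; have [x [y [z ->]]] := v3E v; rewrite !dot3 => vn.
  apply/rowP => j; rewrite !mxE; case: j => -[|[|[|//]]] hj /=.
  + transitivity (x * (al ^+ 2 + be ^+ 2) + (c ^+ 2 + s ^+ 2 - 1) * (x * al ^+ 2 + y * al * be)
      - s * al * (x * (s * al) + y * (s * be) + z * c)); last ring.
    by rewrite vn ab1 cs1; ring.
  + transitivity (y * (al ^+ 2 + be ^+ 2) + (c ^+ 2 + s ^+ 2 - 1) * (x * al * be + y * be ^+ 2)
      - s * be * (x * (s * al) + y * (s * be) + z * c)); last ring.
    by rewrite vn ab1 cs1; ring.
  + transitivity (z * (c ^+ 2 + s ^+ 2) - c * (x * (s * al) + y * (s * be) + z * c)); last ring.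
    by rewrite vn cs1; ring.
Qed.

Lemma dot_frame (e1 e2 : 'rV[R]_3) (a b : R) :
  dot e1 e1 = 1 -> dot e2 e2 = 1 -> dot e1 e2 = 0 ->
  dot (a *: e1 + b *: e2) (a *: e1 + b *: e2) = a ^+ 2 + b ^+ 2.
Proof. by move=> e11 e22 e12; rewrite !dotE (dotC e2) e11 e22 e12; ring. Qed.

Let dot2 (u : 'rV[R]_2) : dot u u = u 0 0 ^+ 2 + u 0 1 ^+ 2.
Proof.
rewrite /dot !big_ord_recl big_ord0 addr0 -!expr2.
by congr (u _ _ ^+ 2 + u _ _ ^+ 2); apply: val_inj.
Qed.

(** The hemisphere over the disk of x, projected to R^3 by (a, h) -> a + h w; the flat disk for w =
    0. *)
Definition cap x w : set 'rV[R]_3 :=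
  [set z | exists a h, [/\ in_plane x a, 0 <= h, h ^+ 2 = - pow x a & z = a + h *: w]].

(** Transversality makes the projection injective: the component of a point along the normal
    recovers its height h. *)
Lemma bounds_cap x w : 0 < radius x -> enorm (normal x) = 1 ->
  w = 0 \/ dot w (normal x) != 0 -> bounds_disk (circle x) (cap x w).
Proof.
set c := center x; set r := radius x; set nu := normal x => r0 nu1 w_trans.
have nu11 : dot nu nu = 1 by rewrite -enorm_sqr nu1 expr1n.
have [e1 [e2 [e11 e22 e12 [e1n e2n] frame]]] := orthonormal_frame nu11.
pose A (u : 'rV[R]_2) := c + r *: (u 0 0 *: e1 + u 0 1 *: e2).
pose h (u : 'rV[R]_2) := r * Num.sqrt (1 - dot u u).
have Ac u : A u - c = r *: (u 0 0 *: e1 + u 0 1 *: e2) by rewrite /A addrAC subrr add0r.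
have A_plane u : in_plane x (A u).
  by rewrite /in_plane -/c Ac !dotE e1n e2n !mulr0 addr0 mulr0.
have powA u : pow x (A u) = - (r ^+ 2 * (1 - dot u u)).
  rewrite /pow -/c -/r Ac dotZl dotZr dot_frame // -dot2; ring.
have hE u : dot u u <= 1 -> h u ^+ 2 = - pow x (A u).
  by move=> u1; rewrite powA opprK exprMn sqr_sqrtr // subr_ge0.
have A_surj a : in_plane x a -> exists u, a = A u.
  rewrite /in_plane -/c -/nu => /frame ac.
  exists (\row_j (r^-1 * dot (a - c) (if j == 0 then e1 else e2))).
  rewrite /A !mxE /= scalerDr !scalerA !mulrA mulfV ?gt_eqF // !mul1r.
  by rewrite -ac addrC subrK.
have A_inj : injective A.
  move=> u v /addrI /(scalerI (lt0r_neq0 r0)) uv.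
  have d1 : u 0 0 = v 0 0.
    by have := congr1 (dot e1) uv; rewrite !dotE e11 e12 !mulr1 !mulr0 !addr0.
  have d2 : u 0 1 = v 0 1.
    by have := congr1 (dot e2) uv; rewrite !dotE (dotC e2 e1) e22 e12 !mulr1 !mulr0 !add0r.
  apply/rowP => j; case: j => -[|[|//]] hj.
    by move: d1; congr (u _ _ = v _ _); apply: val_inj.
  by move: d2; congr (u _ _ = v _ _); apply: val_inj.
have ballE (u : 'rV[R]_2) : eball 0 1 u <-> dot u u <= 1.
  by rewrite /eball /= subr0 enorm_le // expr1n.
have sphE (u : 'rV[R]_2) : esphere 0 1 u <-> dot u u = 1.
  by rewrite /esphere /= subr0; have := enorm_eq u (@ler01 R); rewrite expr1n.
have capc (F : set_system 'rV[R]_2) (FF : Filter F) u : F --> u ->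
    (fun v => A v + h v *: w) @ F --> A u + h u *: w.
  move=> Fu.
  have dc : (fun v => 1 - dot v v) @ F --> 1 - dot u u.
    exact: cvgB (cvg_cst (1 : R)) (cvg_dot Fu Fu).
  have hc : h @ F --> h u.
    exact: cvgM (cvg_cst r) (cvg_comp _ _ dc (@sqrt_continuous R (1 - dot u u))).
  have coordc i : (fun v : 'rV[R]_2 => v 0 i) @ F --> u 0 i.
    exact: cvg_comp _ _ Fu (@continuous_coord R _ i u).
  apply: cvgD; last exact: cvgZr_tmp hc.
  apply: cvgD; first exact: cvg_cst.
  by apply: cvgZl_tmp; apply: cvgD; apply: cvgZr_tmp; exact: coordc.
exists (fun u => A u + h u *: w); split.
- apply: continuous_subspaceT => u.
  by apply: capc; [exact: nbhs_filter|exact: cvg_id].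
- move=> u v; rewrite !inE => /ballE u1 /ballE v1 /= e.
  apply: A_inj; case: w_trans => [w0|wn]; first by move: e; rewrite w0 !scaler0 !addr0.
  have pA t : dot (A t) nu = dot c nu by apply: subr0_eq; rewrite -dotBl; exact: A_plane.
  have := congr1 (dot nu) e; rewrite ![dot nu _]dotC !(dotDl _ (h _ *: w)) !dotZl !pA.
  move=> /addrI /(mulIf wn) huv.
  by move: e; rewrite huv => /addIr.
- apply/seteqP; split=> z.
    move=> [u /ballE u1 <-]; exists (A u), (h u); split=> //; last exact: hE.
    by rewrite mulr_ge0 ?sqrtr_ge0 // ltW.
  move=> [a [k [pa k0 k2 ->]]]; have [u ua] := A_surj _ pa.
  have u1 : dot u u <= 1.
    move: k2 (sqr_ge0 k) => ->; rewrite ua powA opprK pmulr_rge0 ?exprn_gt0 //; lra.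
  exists u; first exact/ballE.
  rewrite ua; congr (_ + _ *: _).
  have h0 : 0 <= h u by rewrite mulr_ge0 ?sqrtr_ge0 // ltW.
  apply/eqP; rewrite -(eqrXn2 (n := 2)) //.
  by rewrite hE // k2 ua.
- apply/seteqP; split=> z.
    move=> [u /sphE u1 <-]; apply/circleP; rewrite ?ltW //.
    have -> : h u = 0 by rewrite /h u1 subrr sqrtr0 mulr0.
    by rewrite scale0r addr0 powA u1 subrr mulr0 oppr0.
  move=> /(circleP _ (ltW r0))[pz /A_surj[u uz]].
  have u1 : dot u u = 1.
    move: pz; rewrite uz powA => /eqP; rewrite oppr_eq0 mulf_eq0 sqrf_eq0 gt_eqF //= => /eqP; lra.
  exists u; first exact/sphE.
  by rewrite /h u1 subrr sqrtr0 mulr0 scale0r addr0.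
Qed.
End Caps.

Section Unlink.
Context {R : realType}.
Local Notation ring := (ring_data R).
Implicit Types (x y : ring) (p q w : 'rV[R]_3).

(** If the planes are not parallel, [w] is, up to scale, the part of the normal of y that is tangent
    to the plane of x: moving along it neither enters nor leaves that plane, and
    [dot w (a - center x)] is constant on the common line. If they are parallel, [w] points from the
    plane of x towards that of y, so that the plane of x is reached only with h = 0. The sign of [w]
    is chosen accordingly. *)
Lemma transversal x y : enorm (normal x) = 1 -> enorm (normal y) = 1 ->
  exists w, [/\ dot w w = 1, dot w (normal y) != 0 &
    forall a h, in_plane y a -> 0 <= h -> in_plane x (a + h *: w) ->
      in_plane x a /\ 0 <= dot w (a - center x)].
Proof.
set mu := normal x; set nu := normal y => mu1 nu1.
have mu11 : dot mu mu = 1 by rewrite -enorm_sqr mu1 expr1n.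
have nu11 : dot nu nu = 1 by rewrite -enorm_sqr nu1 expr1n.
have sgn (k : R) : exists2 s, s ^+ 2 = 1 & 0 <= s * k.
  by case: (lerP 0 k) => k0; [exists 1|exists (-1)]; rewrite ?expr1n ?sqrrN ?expr1n //; lra.
pose m := nu - dot nu mu *: mu.
have m_mu : dot m mu = 0 by rewrite /m !dotE mu11 mulr1 subrr.
have m_nu : dot m nu = dot m m by rewrite {2 3}/m dotBr dotZr m_mu mulr0 subr0.
have [m0|m0] := eqVneq m 0.
  have numu : nu = dot nu mu *: mu by apply/eqP; rewrite -subr_eq0; apply/eqP.
  have [s s1 s_ge] := sgn (dot mu (center y - center x)).
  have k0 : dot nu mu != 0.
    by apply/eqP => k0; move: nu11; rewrite numu k0 scale0r dot0l => /eqP; rewrite eq_sym oner_eq0.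
  have s0 : s != 0 by apply/eqP => s0; move: s1; rewrite s0 expr0n /= => /eqP; rewrite eq_sym oner_eq0.
  exists (s *: mu); split.
  - by rewrite dotZl dotZr mulrA mu11 mulr1 -expr2 s1.
  - by rewrite dotZl mulf_neq0 // dotC.
  - move=> a h pa h0; rewrite /in_plane -/mu => pah.
    have ay : dot mu a = dot mu (center y).
      move: pa; rewrite /in_plane -/nu numu dotZr => /eqP; rewrite mulf_eq0 (negbTE k0) /= => /eqP.
      by rewrite dotC dotBr => /subr0_eq.
    have ah : dot mu (a - center x) + h * s = 0.
      by move: pah; rewrite !dotBl dotDl !dotZl mu11 dotBr !(dotC mu); lra.
    have e : s * dot mu (center y - center x) + h = 0.
      have : s * (dot mu (a - center x) + h * s) = 0 by rewrite ah mulr0.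
      by rewrite mulrDr mulrCA -expr2 s1 mulr1 !dotBr ay.
    have h00 : h = 0 by lra.
    have ax : dot mu (a - center x) = 0 by move: ah; rewrite h00 mul0r addr0.
    by rewrite dotC ax dotZl ax mulr0.
have [s s1 s_ge] := sgn (dot nu (center y - center x)).
have s0 : s != 0 by apply/eqP => s0; move: s1; rewrite s0 expr0n /= => /eqP; rewrite eq_sym oner_eq0.
have em : 0 < enorm m by rewrite lt_def enorm_eq0 m0 enorm_ge0.
exists ((s / enorm m) *: m); split.
- by rewrite dotZl dotZr -enorm_sqr -[RHS]s1; field; rewrite gt_eqF.
- by rewrite dotZl m_nu mulf_neq0 ?dot_eq0 // mulf_neq0 // invr_neq0 // gt_eqF.
- move=> a h pa h0 pah.
  have ax : in_plane x a.
    by move: pah; rewrite /in_plane -/mu !dotBl dotDl !dotZl m_mu !mulr0 addr0.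
  split=> //; rewrite dotZl.
  have -> : dot m (a - center x) = dot nu (center y - center x).
    move: pa ax; rewrite /in_plane -/nu -/mu /m !(dotC _ nu) (dotC _ mu) => pa ax.
    by rewrite dotBl dotZl ax mulr0 subr0; move: pa; rewrite !dotBr => /subr0_eq ->.
  by rewrite mulrAC mulr_ge0 // invr_ge0 ltW.
Qed.

(** Going from [a] to [a + h *: w] raises the power with respect to x by at least
    [h ^+ 2 = - pow y a]. A common point lies in the disk of x, where this power is nonpositive, so
    [pow x a <= pow y a], against the hypothesis. *)
Lemma caps_disjoint x y w : dot w w = 1 ->
  (forall a h, in_plane y a -> 0 <= h -> in_plane x (a + h *: w) ->
     in_plane x a /\ 0 <= dot w (a - center x)) ->
  (forall q, in_plane x q -> in_plane y q -> pow x q <= 0 -> pow y q <= 0 ->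
     pow y q < pow x q) ->
  cap x 0 `&` cap y w = set0.
Proof.
move=> w1 trans lt_pow; apply/seteqP; split=> // z [[b [k [xb k0 k2]]]].
rewrite scaler0 addr0 => -> [a [h [ya h0 h2 ba]]].
move: xb k2; rewrite ba => xb k2; have [xa wa] := trans _ _ ya h0 xb.
have : pow x a + h ^+ 2 <= - k ^+ 2.
  by rewrite k2 opprK powD !dotZl dotZr w1; have := mulr_ge0 h0 wa; lra.
by have := lt_pow a xa ya; have := sqr_ge0 h; have := sqr_ge0 k; move=> ? ? H ?; have := H _ _; lra.
Qed.

Lemma pow_segment x q d (t : R) :
  pow x (q + t *: d) = (1 - t) * pow x q + t * pow x (q + d) - t * (1 - t) * dot d d.
Proof. by rewrite !powD !dotZl dotZr; ring. Qed.

(** The difference of the powers is affine, and the points of both planes at which both powers are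
    nonpositive form a convex set: a change of sign would produce a hit. The sign tells which
    hemisphere is the higher one. *)
Lemma not_hit_sign x y : ~ hit x y ->
  (forall q, in_plane x q -> in_plane y q -> pow x q <= 0 -> pow y q <= 0 ->
     pow y q < pow x q) \/
  (forall q, in_plane x q -> in_plane y q -> pow x q <= 0 -> pow y q <= 0 ->
     pow x q < pow y q).
Proof.
move=> nh; have [?|] := pselect (forall q, in_plane x q -> in_plane y q ->
  pow x q <= 0 -> pow y q <= 0 -> pow y q < pow x q); [by left|].
move=> /existsNP[a /not_implyP[ax /not_implyP[ay /not_implyP[ax0 /not_implyP[ay0 /negP]]]]].
rewrite -leNgt le_eqVlt => /orP[/eqP e|lta]; first by case: nh; exists a.
right=> b bx bY bx0 by0; rewrite ltNge; apply/negP => leb; apply: nh.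
pose t := (pow y a - pow x a) / ((pow x b - pow y b) + (pow y a - pow x a)).
have D0 : 0 < (pow x b - pow y b) + (pow y a - pow x a) by lra.
have t01 : 0 <= t <= 1.
  by apply/andP; split; [rewrite divr_ge0 //; lra|rewrite ler_pdivrMr //; lra].
have E : b = a + (b - a) by rewrite addrC subrK.
have dx : dot (b - a) (normal x) = 0 by apply/(in_planeD _ ax); rewrite -E.
have dy : dot (b - a) (normal y) = 0 by apply/(in_planeD _ ay); rewrite -E.
exists (a + t *: (b - a)); split.
- by apply/in_planeD; rewrite // dotZl dx mulr0.
- by apply/in_planeD; rewrite // dotZl dy mulr0.
- rewrite !pow_segment -E; congr (_ - _).
  apply/eqP; rewrite -subr_eq0; apply/eqP.
  transitivity (t * ((pow x b - pow y b) + (pow y a - pow x a)) - (pow y a - pow x a)); first ring.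
  by rewrite /t divfK ?gt_eqF // subrr.
- rewrite pow_segment -E; case/andP: t01 => t0 t1.
  have := mulr_ge0 (mulr_ge0 t0 (_ : 0 <= 1 - t)) (dot_ge0 (b - a)).
  have := mulr_ge0_le0 t0 bx0; have := mulr_ge0_le0 (_ : 0 <= 1 - t) ax0.
  rewrite subr_ge0 => /(_ t1) ? ? /(_ t1); lra.
Qed.

Lemma unlinked_sym (C D : set 'rV[R]_3) : unlinked C D -> unlinked D C.
Proof. by move=> [A [B [? ? ?]]]; exists B, A; rewrite setIC. Qed.

(** The lower hemisphere is flattened to a disk and the higher one is tilted along [w]. *)
Lemma unlinked_lt_pow x y : 0 < radius x -> 0 < radius y ->
  enorm (normal x) = 1 -> enorm (normal y) = 1 ->
  (forall q, in_plane x q -> in_plane y q -> pow x q <= 0 -> pow y q <= 0 ->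
     pow y q < pow x q) ->
  unlinked (circle x) (circle y).
Proof.
move=> rx ry nx ny lt_pow; have [w [w1 wn wP]] := transversal nx ny.
exists (cap x 0), (cap y w); split; last exact: caps_disjoint.
- by apply: bounds_cap => //; left.
- by apply: bounds_cap => //; right.
Qed.

Lemma not_hitP x y : 0 < radius x -> 0 < radius y ->
  enorm (normal x) = 1 -> enorm (normal y) = 1 ->
  ~ hit x y <-> circle x `&` circle y = set0 /\ unlinked (circle x) (circle y).
Proof.
move=> rx ry nx ny; split=> [nh|[]]; last exact: unlinked_not_hit.
split; last first.
  have [h|h] := not_hit_sign nh; first exact: unlinked_lt_pow.
  by apply/unlinked_sym/unlinked_lt_pow => // q *; exact: h.
apply/seteqP; split=> // q [/(circleP _ (ltW rx))[p1 i1] /(circleP _ (ltW ry))[p2 i2]].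
by apply: nh; exists q; rewrite p1 p2 lexx.
Qed.
End Unlink.

(** * Rings that are small compared with their distance *)

Section CircleDistance.
Context {R : realType}.
Local Notation ring := (ring_data R).
Implicit Types (x y : ring) (p q : 'rV[R]_3) (M : R).

(* Comparable to the distance from q to the circle of y. *)
Definition cdist q y : R :=
  `|enorm (q - center y) - radius y| + `|dot (q - center y) (normal y)|.

Lemma cdist_ge0 q y : 0 <= cdist q y.
Proof. exact: addr_ge0. Qed.

Lemma cdist_lip q q' y y' : enorm (normal y) = 1 -> normal y' = normal y ->
  cdist q y <= cdist q' y' + 2 * enorm ((q - center y) - (q' - center y')) +
               `|radius y - radius y'|.
Proof.
move=> ny e; rewrite /cdist e.
move: (q - center y) (q' - center y') => u v.
have h1 : `|enorm u - radius y| <=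
    `|enorm v - radius y'| + enorm (u - v) + `|radius y - radius y'|.
  have -> : enorm u - radius y =
    (enorm v - radius y') + (enorm u - enorm v) + (radius y' - radius y) by ring.
  apply: le_trans (ler_normD _ _) _; rewrite (distrC (radius y)) lerD2r.
  by apply: le_trans (ler_normD _ _) _; rewrite lerD2l enorm_dist.
have h2 : `|dot u (normal y)| <= `|dot v (normal y)| + enorm (u - v).
  have -> : dot u (normal y) = dot v (normal y) + dot (u - v) (normal y).
    by rewrite dotBl; ring.
  apply: le_trans (ler_normD _ _) _; rewrite lerD2l.
  by apply: le_trans (dot_le_enorm _ _) _; rewrite ny mulr1.
lra.
Qed.

Lemma cdist_le q y : enorm (normal y) = 1 -> 0 <= radius y ->
  cdist q y <= 2 * enorm (q - center y) + radius y.
Proof.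
move=> ny ry; rewrite /cdist.
have := dot_le_enorm (q - center y) (normal y); rewrite ny mulr1.
have := ler_normB (enorm (q - center y)) (radius y).
rewrite (ger0_norm ry) (ger0_norm (enorm_ge0 _)); lra.
Qed.

Lemma dist_le_cdist q y : enorm (q - center y) <= cdist q y + radius y.
Proof.
rewrite /cdist; have := ler_norm (enorm (q - center y) - radius y).
have := normr_ge0 (dot (q - center y) (normal y)); lra.
Qed.

Lemma cdist0P q y : 0 <= radius y -> cdist q y = 0 -> pow y q = 0 /\ in_plane y q.
Proof.
move=> ry /eqP; rewrite paddr_eq0 // !normr_eq0 => /andP[/eqP e /eqP h]; split=> //.
by rewrite /pow (enorm_eq _ ry).1 ?subrr //; exact: subr0_eq.
Qed.

Definition remote M x y :=
  M * radius x < cdist (center x) y \/ M * radius y < cdist (center y) x.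

(** A common point [q] would be within [radius x] of the center of x, hence farther than [radius x]
    from the circle of y. Being inside that circle and in its plane, it has
    [pow y q < - radius x ^+ 2], which is lower than [pow x q] can be. *)
Lemma pointlike_not_hit M x y : 3 <= M -> 0 < radius x -> 0 < radius y ->
  enorm (normal y) = 1 -> M * radius x < cdist (center x) y -> ~ hit x y.
Proof.
move=> M3 rx ry ny sep [q [qx qy e pq]].
have qcx : enorm (q - center x) <= radius x.
  by rewrite (enorm_le _ (ltW rx)); move: pq; rewrite /pow subr_le0.
have pyx : - radius x ^+ 2 <= pow y q.
  by rewrite -e /pow -enorm_sqr; have := sqr_ge0 (enorm (q - center x)); lra.
have cq : (M - 2) * radius x < cdist q y.
  have := @cdist_lip (center x) q y y ny erefl.
  have -> : center x - center y - (q - center y) = - (q - center x).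
    by apply/rowP => i; rewrite !mxE; ring.
  rewrite enormN subrr normr0 addr0; lra.
move: cq; rewrite /cdist qy normr0 addr0.
have qcy : enorm (q - center y) <= radius y.
  by rewrite (enorm_le _ (ltW ry)); move: pq; rewrite e /pow subr_le0.
rewrite distrC ger0_norm ?subr_ge0 //.
move: pyx; rewrite /pow -enorm_sqr; have := enorm_ge0 (q - center y).
move: (enorm (q - center y)) qcy => t qcy t0 h1 h2.
have h3 : radius x < radius y - t.
  by apply: le_lt_trans h2; apply: ler_peMl; [exact: ltW|lra].
have : radius x * radius x < (radius y - t) * (radius y + t) by apply: ltr_pM; lra.
by rewrite -expr2; lra.
Qed.

Lemma remote_not_hit M x y : 3 <= M -> 0 < radius x -> 0 < radius y ->
  enorm (normal x) = 1 -> enorm (normal y) = 1 -> remote M x y -> ~ hit x y.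
Proof.
move=> M3 rx ry nx ny [|] sep h; first exact: pointlike_not_hit sep h.
exact: pointlike_not_hit sep (hit_sym h).
Qed.

Definition near_rings x y :=
  eball (center x) (2 * radius x) `&` eball (center y) (2 * radius y) !=set0.

Lemma near_dist x y : near_rings x y -> enorm (center x - center y) <= 2 * (radius x + radius y).
Proof.
move=> [z []]; rewrite /eball /= => zx zy; have := enorm_triangle (center x) z (center y).
rewrite (enormB (center x) z); lra.
Qed.

(** Nearness bounds [cdist (center x) y] by 4 [radius x] + 5 [radius y]; this is the origin of 4 + 5
    / c. *)
Lemma pointlike_ratio M c x y : 0 < radius x -> 0 < radius y ->
  enorm (normal y) = 1 -> 0 < c -> 4 + 5 / c <= M -> near_rings x y ->
  M * radius x < cdist (center x) y -> radius x / radius y < c.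
Proof.
move=> rx ry ny c0 cM /near_dist nxy sep; rewrite ltr_pdivrMr //.
have := cdist_le (center x) ny (ltW ry) => le1.
have h : (5 / c) * radius x < 5 * radius y.
  have : (4 + 5 / c) * radius x <= M * radius x by rewrite ler_pM2r.
  lra.
have := h; rewrite mulrAC ltr_pdivrMr //; lra.
Qed.

Lemma near_sym x y : near_rings x y -> near_rings y x.
Proof. by move=> [z [? ?]]; exists z. Qed.

Lemma remote_ratio M c x y : 0 < radius x -> 0 < radius y ->
  enorm (normal x) = 1 -> enorm (normal y) = 1 -> 0 < c -> 4 + 5 / c <= M ->
  near_rings x y -> radius x <= radius y ->
  remote M x y -> radius x / radius y < c.
Proof.
move=> rx ry nx ny c0 cM nxy lexy [|] sep; first exact: pointlike_ratio nxy sep.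
have := pointlike_ratio ry rx nx c0 cM (near_sym nxy) sep.
rewrite !ltr_pdivrMr // => h; nra.
Qed.

End CircleDistance.

(** * One step of the motion *)

Section BigMax.
Context {R : realType} {I : finType}.
Implicit Types (P : pred I) (F : I -> R).

Lemma bigmax_nonneg P F : 0 <= \big[Num.max/(0 : R)]_(i | P i) F i.
Proof. by elim/big_rec: _ => // i x _ x0; rewrite le_max x0 orbT. Qed.

Lemma le_bigmax_of P F i : P i -> F i <= \big[Num.max/(0 : R)]_(i | P i) F i.
Proof. by move=> Pi; rewrite (bigD1 i) //= le_max lexx. Qed.

Lemma bigmax_le_of P F (a : R) : 0 <= a -> (forall i, P i -> F i <= a) ->
  \big[Num.max/(0 : R)]_(i | P i) F i <= a.
Proof. by move=> a0 Fa; elim/big_rec: _ => // i x Pi xa; rewrite ge_max Fa. Qed.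

Lemma bigmax_lt_of P F (a : R) : 0 < a -> (forall i, P i -> F i < a) ->
  \big[Num.max/(0 : R)]_(i | P i) F i < a.
Proof. by move=> a0 Fa; elim/big_rec: _ => // i x Pi xa; rewrite gt_max Fa. Qed.

End BigMax.

Section Step.
Context {R : realType} {n : nat}.
Variable N : R.
Local Notation ring := (ring_data R).
Local Notation state := ('I_n -> ring_data R).
Implicit Types (x : state) (i j k : 'I_n) (d : R).

Definition valid x := forall i, 0 < radius (x i) /\ enorm (normal (x i)) = 1.

Definition unlinked_state x := valid x /\ forall i j, i != j -> ~ hit (x i) (x j).

Definition clearance (a b : ring) : R :=
  Num.max (cdist (center a) b / radius a) (cdist (center b) a / radius b).

(* Pairs in contact 1 follow the exact hemisphere flow; in all the other pairs, one ring
   is so small that it behaves like a point. *)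
Definition contact (a b : ring) : R := clamp (2 - clearance a b / N).

Definition activity x i : R := \big[Num.max/0]_(j | j != i) contact (x i) (x j).

(** The smallest squared radius keeps the new radii positive. The factor 16 (n + 1) makes the loss
    of any ring so small that a drift, at most twice a sum of losses, is at most an eighth of every
    radius. *)
Definition stride x : R :=
  (16 * n.+1%:R)^-1 * \big[Num.min/1]_i radius (x i) ^+ 2.

Definition new_radius d x i : R := Num.sqrt (radius (x i) ^+ 2 - activity x i * d).

Definition loss d x i : R := radius (x i) - new_radius d x i.

(** Positive only if ring j is larger than ring i and its circle is closer to the center of i than
    its radius. It grows without bound when ring i shrinks onto the circle of j, so that ring j then
    dominates the average. *)
Definition pull x i j : R :=
  Num.max 0 (radius (x j) / Num.max (cdist (center (x i)) (x j)) (radius (x i)) - 1).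

(* Image of the displacement under the similarity that carries ring j along. *)
Definition carry d x (v : 'I_n -> 'rV[R]_3) j (q : 'rV[R]_3) : 'rV[R]_3 :=
  v j - (loss d x j / radius (x j)) *: (q - center (x j)).

(** The summand 1 in the denominator is the weight of not moving; the factor [1 - activity] stops
    the rings in full contact. *)
Definition average d x (v : 'I_n -> 'rV[R]_3) i : 'rV[R]_3 :=
  ((1 - activity x i) / (1 + \sum_j pull x i j)) *:
    \sum_j pull x i j *: carry d x v j (center (x i)).

(* The fixed point of [average d x], see drift_fix: a ring is only pulled by larger ones,
   so that n iterations suffice. *)
Definition drift d x : 'I_n -> 'rV[R]_3 := iter n (average d x) (fun=> 0).

Definition evolve d x : state := fun i =>
  (center (x i) + drift d x i, new_radius d x i, normal (x i)).

Lemma contact_itv (a b : ring) : 0 <= contact a b <= 1.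
Proof. exact: clamp_itv. Qed.

Lemma contact_sym (a b : ring) : contact a b = contact b a.
Proof. by rewrite /contact /clearance [in LHS](maxC (cdist _ _ / _)). Qed.

Lemma activity_itv x i : 0 <= activity x i <= 1.
Proof.
rewrite /activity bigmax_nonneg /=; apply: bigmax_le_of => // j _.
by case/andP: (contact_itv (x i) (x j)).
Qed.

Lemma contact_le_activity x i j : j != i -> contact (x i) (x j) <= activity x i.
Proof. by move=> ji; rewrite /activity (bigD1 j) //= le_max lexx. Qed.

Lemma contact1_activity x i j : j != i -> contact (x i) (x j) = 1 ->
  activity x i = 1 /\ activity x j = 1.
Proof.
move=> ji c1; have := contact_le_activity x ji; rewrite eq_sym in ji.
have := contact_le_activity x ji; rewrite (contact_sym (x j)) c1 => h1 h2.
have := activity_itv x i; have := activity_itv x j.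
by move=> /andP[? ?] /andP[? ?]; split; apply/eqP; rewrite eq_le; apply/andP.
Qed.

Lemma contact_lt1 (a b : ring) : 0 < N -> 0 < radius a -> 0 < radius b ->
  contact a b < 1 -> remote N a b.
Proof.
move=> N0 ra rb; rewrite /contact /clamp gt_max gt_min ltxx ltr01 /=.
rewrite ltrBlDr -ltrBlDl (_ : 2 - 1 = 1 :> R); last by ring.
by rewrite ltr_pdivlMr // mul1r lt_max !ltr_pdivlMr // => /orP[|]; [left|right].
Qed.

Lemma contact1 (a b : ring) : 0 < N -> 0 < radius a -> 0 < radius b ->
  cdist (center a) b <= N * radius a -> cdist (center b) a <= N * radius b ->
  contact a b = 1.
Proof.
move=> N0 ra rb ab ba; apply/eqP; rewrite eq_le (andP (contact_itv a b)).2 /= leNgt.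
by apply/negP => /(contact_lt1 N0 ra rb)[]; rewrite ltNge ?ab ?ba.
Qed.

Lemma contact_gt0 (a b : ring) : 0 < N -> 0 < radius a -> 0 < radius b ->
  0 < contact a b ->
  cdist (center a) b < 2 * N * radius a /\ cdist (center b) a < 2 * N * radius b.
Proof.
move=> N0 ra rb; rewrite /contact /clamp lt_max ltxx /= lt_min ltr01 /= subr_gt0.
by rewrite ltr_pdivrMr // gt_max !ltr_pdivrMr // => /andP.
Qed.

Section Valid.
Variable x : state.
Hypothesis xv : valid x.
Let r0 i : 0 < radius (x i). Proof. by have [] := xv i. Qed.

Lemma stride_gt0 : 0 < stride x.
Proof.
rewrite mulr_gt0 ?invr_gt0 ?mulr_gt0 ?ltr0n //.
by elim/big_rec: _ => // i y _ y0; rewrite lt_min y0 exprn_gt0.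
Qed.

Lemma stride_le i : 16 * n.+1%:R * stride x <= radius (x i) ^+ 2.
Proof.
rewrite /stride mulrA mulfV ?mul1r; last by rewrite mulf_neq0 ?pnatr_eq0.
by rewrite (bigD1 i) //= ge_min lexx.
Qed.

Lemma stride_le_quarter i : stride x <= radius (x i) ^+ 2 / 4.
Proof.
have := stride_le i; have : stride x * 1 <= stride x * n.+1%:R.
  by rewrite ler_pM2l ?stride_gt0 // ler1n.
have := stride_gt0; lra.
Qed.

Variable d : R.
Hypothesis d_itv : 0 <= d <= stride x.

Lemma activity_d_itv i : 0 <= activity x i * d <= radius (x i) ^+ 2 / 4.
Proof.
have /andP[a0 a1] := activity_itv x i; have /andP[d0 d1] := d_itv.
rewrite mulr_ge0 //=; apply: le_trans _ (stride_le_quarter i).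
by apply: le_trans _ d1; rewrite ler_piMl.
Qed.

Lemma new_radius_sqr i : new_radius d x i ^+ 2 = radius (x i) ^+ 2 - activity x i * d.
Proof.
rewrite sqr_sqrtr //; have := activity_d_itv i; have := sqr_ge0 (radius (x i)); lra.
Qed.

Lemma new_radius_gt0 i : 0 < new_radius d x i.
Proof.
rewrite sqrtr_gt0; have := activity_d_itv i.
have := exprn_gt0 2 (r0 i); lra.
Qed.

Lemma new_radius_le i : new_radius d x i <= radius (x i).
Proof.
rewrite -ler_sqr ?nnegrE ?(ltW (new_radius_gt0 _)) ?(ltW (r0 _)) //.
by rewrite new_radius_sqr; have := activity_d_itv i; lra.
Qed.

Lemma loss_ge0 i : 0 <= loss d x i.
Proof. by rewrite subr_ge0 new_radius_le. Qed.

Lemma loss_le i : loss d x i * radius (x i) <= activity x i * d.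
Proof.
have e : activity x i * d = loss d x i * (radius (x i) + new_radius d x i).
  by rewrite -subr_sqr new_radius_sqr; ring.
by rewrite e ler_wpM2l ?loss_ge0 // lerDl ltW // new_radius_gt0.
Qed.

(** The loss of i is at most [stride x / radius (x i)]; the stride is then estimated by the smaller
    of the two radii. *)
Lemma loss_small i j : 16 * n.+1%:R * loss d x i <= radius (x j).
Proof.
have K0 : 0 < 16 * n.+1%:R :> R by rewrite mulr_gt0 ?ltr0n.
have h : loss d x i * radius (x i) <= stride x.
  apply: le_trans (loss_le i) _; have /andP[a0 a1] := activity_itv x i.
  by have /andP[d0 d1] := d_itv; apply: le_trans _ d1; rewrite ler_piMl.
have sl := stride_le; move: (16 * n.+1%:R) K0 sl => K K0 sl.
have [le_ij|lt_ji] := lerP (radius (x i)) (radius (x j)).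
  apply: le_trans le_ij; rewrite -(ler_pM2r (r0 i)) -mulrA -expr2.
  by apply: le_trans _ (sl i); rewrite ler_pM2l.
rewrite -(ler_pM2r (r0 j)) -expr2; apply: le_trans _ (sl j).
rewrite -mulrA ler_pM2l //; apply: le_trans _ h.
by rewrite ler_wpM2l ?loss_ge0 // ltW.
Qed.

Lemma pull_ge0 i j : 0 <= pull x i j.
Proof. by rewrite le_max lexx. Qed.

Lemma pull_gt0 i j : 0 < pull x i j ->
  radius (x i) < radius (x j) /\ cdist (center (x i)) (x j) < radius (x j).
Proof.
rewrite /pull lt_max ltxx /= subr_gt0; set m := Num.max _ _.
have m0 : 0 < m by rewrite lt_max r0 orbT.
by rewrite ltr_pdivlMr // mul1r gt_max => /andP[].
Qed.

Lemma pull_dist i j : 0 < pull x i j ->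
  enorm (center (x i) - center (x j)) < 2 * radius (x j).
Proof.
by move=> /pull_gt0[_ h]; have := dist_le_cdist (center (x i)) (x j); lra.
Qed.

Lemma sum_pull_gt0 i : 0 < 1 + \sum_j pull x i j.
Proof. by rewrite ltr_pwDl // sumr_ge0 // => j _; exact: pull_ge0. Qed.

Definition larger i : {set 'I_n} := [set k | radius (x i) < radius (x k)].

Lemma larger_sub i j : radius (x i) < radius (x j) -> larger j \proper larger i.
Proof.
move=> lt_ij; apply/properP; split.
  by apply/fintype.subsetP => k; rewrite !inE; exact: lt_trans.
by exists j; rewrite !inE ?ltxx.
Qed.

Lemma larger_card i : (#|larger i| < n)%N.
Proof.
rewrite -[X in (_ < X)%N]card_ord -cardsT proper_card //; apply/properP; split.
  exact: finset.subsetT.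
by exists i; rewrite !inE ?ltxx.
Qed.

Lemma larger_ind (P : 'I_n -> Prop) :
  (forall i, (forall k, radius (x i) < radius (x k) -> P k) -> P i) -> forall i, P i.
Proof.
move=> IH i; have [m] := ubnP #|larger i|; elim: m i => // m IHm i lem.
apply: IH => k lt_ik; apply: IHm.
exact: leq_trans (proper_card (larger_sub lt_ik)) lem.
Qed.

Lemma average_ext v v' i :
  (forall k, radius (x i) < radius (x k) -> v k = v' k) -> average d x v i = average d x v' i.
Proof.
move=> e; congr (_ *: _); apply: eq_bigr => j _.
have [p0|p0] := eqVneq (pull x i j) 0; first by rewrite p0 !scale0r.
have [lt_ij _] : radius (x i) < radius (x j) /\ cdist (center (x i)) (x j) < radius (x j).
  by apply: pull_gt0; rewrite lt_def p0 pull_ge0.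
by rewrite /carry (e j lt_ij).
Qed.

Lemma drift_fix i : drift d x i = average d x (drift d x) i.
Proof.
have st m : forall i, (#|larger i| <= m)%N ->
    iter m.+1 (average d x) (fun=> 0) i = iter m.+2 (average d x) (fun=> 0) i.
  elim: m => [|m IH] k km; apply: average_ext => l lt_kl.
    by have := leq_trans (proper_card (larger_sub lt_kl)) km.
  by apply: IH; rewrite -ltnS; exact: leq_trans (proper_card (larger_sub lt_kl)) km.
have n0 : (0 < n)%N by exact: leq_ltn_trans (larger_card i).
have := st n.-1 i; rewrite prednK // => /(_ _); apply.
by rewrite -ltnS prednK // larger_card.
Qed.
End Valid.
End Step.

(** * Unlinkedness and complexity along one step *)

Section Preservation.
Context {R : realType} {n : nat}.
Variable N : R.
Local Notation ring := (ring_data R).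
Local Notation state := ('I_n -> ring_data R).
Implicit Types (x : state) (i j k : 'I_n).
Local Notation stride := (@stride R n).
Local Notation evolve := (@evolve R n N).
Local Notation loss := (@loss R n N).
Local Notation drift := (@drift R n N).
Local Notation carry := (@carry R n N).
Local Notation activity := (@activity R n N).
Local Notation contact := (@contact R N).

Lemma enorm_weighted (p : 'I_n -> R) (u : 'I_n -> 'rV[R]_3) (B : R) :
  (forall j, 0 <= p j) -> (forall j, 0 < p j -> enorm (u j) <= B) ->
  enorm (\sum_j p j *: u j) <= (\sum_j p j) * B.
Proof.
move=> p0 uB; apply: le_trans (enorm_sum _ _ _) _; rewrite mulr_suml.
apply: ler_sum => j _; rewrite enormZ ger0_norm //.
have [->|pj0] := eqVneq (p j) 0; first by rewrite !mul0r.
by rewrite ler_wpM2l // uB // lt_def pj0 p0.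
Qed.

Section Fixed.
Variable x : state.
Hypothesis xv : valid x.
Variable d : R.
Hypothesis d_itv : 0 <= d <= stride x.
Let r0 i : 0 < radius (x i). Proof. by have [] := xv i. Qed.

(** Deviation from any vector [a]: the last [- a] is due to the weight of not moving, the first
    summand to the activity. *)
Lemma drift_sub i (a : 'rV[R]_3) : drift d x i - a = - activity x i *: a +
  ((1 - activity x i) / (1 + \sum_j pull x i j)) *:
    (\sum_j pull x i j *: (carry d x (drift d x) j (center (x i)) - a) - a).
Proof.
rewrite drift_fix // /average; set s := \sum_j pull x i j; set w := activity x i.
have s0 : 1 + s != 0 by rewrite gt_eqF // sum_pull_gt0.
under [in RHS]eq_bigr do rewrite scalerBr.
rewrite big_split /= sumrN -scaler_suml -/s.
move: (\sum_j _ *: carry _ _ _ _ _) => b.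
have -> : b - s *: a - a = b - (1 + s) *: a by rewrite scalerDl scale1r -addrA -opprD (addrC a).
rewrite scalerBr scalerA divfK //; move: (_ *: b) => {}b.
by apply/rowP => t; rewrite !mxE; ring.
Qed.

(** A ring inherits errors only from larger ones, and each ring occurs at most once in a chain of
    growing radii; so the errors add up to at most one contribution per larger ring. *)
Lemma chain_le (P : pred 'I_n) (e g h : 'I_n -> R) :
  (forall k, P k -> 0 <= g k + h k) ->
  (forall i (B : R), P i -> 0 <= B ->
     (forall k, P k -> radius (x i) < radius (x k) -> e k + h k <= B) -> e i <= g i + B) ->
  forall i, P i -> e i <= g i + \sum_(k | P k && (k \in larger x i)) (g k + h k).
Proof.
move=> gh0 step; apply: (larger_ind (x := x)) => i IH Pi.
apply: step => //; first by apply: sumr_ge0 => k /andP[Pk _]; exact: gh0.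
move=> k Pk lt_ik; have le_k := IH k lt_ik Pk.
rewrite (bigD1 k) /=; last by rewrite Pk inE.
suff : \sum_(l | P l && (l \in larger x k)) (g l + h l) <=
    \sum_(l | (P l && (l \in larger x i)) && (l != k)) (g l + h l) by lra.
rewrite [leRHS]big_mkcond [leLHS]big_mkcond /=; apply: ler_sum => l _.
case: ifP => [/andP[Pl kl]|_]; last by case: ifP => // /andP[/andP[Pl _] _]; exact: gh0.
rewrite Pl /= inE; move: kl; rewrite inE => kl; rewrite (lt_trans lt_ik kl) /=.
by case: eqVneq kl => [->|//]; rewrite ltxx.
Qed.

Lemma carry_le k (q : 'rV[R]_3) : enorm (q - center (x k)) <= 2 * radius (x k) ->
  enorm (carry d x (drift d x) k q) <= enorm (drift d x k) + 2 * loss d x k.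
Proof.
move=> qk; apply: le_trans (enormD _ _) _; rewrite lerD2l enormN enormZ.
have dr0 : 0 <= loss d x k / radius (x k).
  by rewrite divr_ge0 ?loss_ge0 // ltW.
rewrite ger0_norm //.
apply: le_trans (_ : loss d x k / radius (x k) * (2 * radius (x k)) <= _); first by rewrite ler_wpM2l.
by rewrite mulrCA divfK ?gt_eqF.
Qed.

(** A ring that pulls i has its center within twice its own radius, so that its similarity displaces
    the center of i by at most its drift plus twice its loss. *)
Lemma drift_le i : enorm (drift d x i) <= 2 * \sum_(k in larger x i) loss d x k.
Proof.
have := @chain_le predT (fun i => enorm (drift d x i)) (fun=> 0) (fun k => 2 * loss d x k).
move=> /(_ _ _ i isT); rewrite add0r mulr_sumr.
under eq_bigr do rewrite add0r; apply => [k _|{}i B _ B0 kB].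
  by rewrite add0r mulr_ge0 // loss_ge0.
rewrite (drift_fix N xv d i) /average.
have /andP[w0 w1] := activity_itv N x i.
have s0 := sum_pull_gt0 x i.
have a0 : 0 <= (1 - activity x i) / (1 + \sum_j pull x i j).
  by rewrite divr_ge0 ?subr_ge0 // ltW.
rewrite add0r enormZ ger0_norm //.
have h : enorm (\sum_j pull x i j *: carry d x (drift d x) j (center (x i))) <=
    (\sum_j pull x i j) * B.
  apply: enorm_weighted => [j|j pj]; first exact: pull_ge0.
  have [lt_ij _] := pull_gt0 xv pj.
  apply: le_trans (carry_le _) (kB j isT lt_ij).
  by rewrite ltW // pull_dist.
apply: le_trans (ler_wpM2l a0 h) _.
have S0 : 0 <= \sum_j pull x i j by apply: sumr_ge0 => j _; exact: pull_ge0.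
move: (\sum_j pull x i j) S0 s0 {a0 h} => S S0 s0.
rewrite mulrAC ler_pdivrMr //.
have SB : 0 <= S * B by rewrite mulr_ge0.
have : (1 - activity x i) * (S * B) <= S * B by rewrite ler_piMl //; lra.
lra.
Qed.

Lemma drift_small i j : enorm (drift d x i) <= radius (x j) / 8.
Proof.
apply: le_trans (drift_le i) _.
have K0 : 0 < n.+1%:R :> R by rewrite ltr0n.
have : \sum_(k in larger x i) loss d x k <= \sum_(k in larger x i) radius (x j) / (16 * n.+1%:R).
  apply: ler_sum => k _; rewrite ler_pdivlMr ?mulr_gt0 // mulrC.
  exact: loss_small.
rewrite sumr_const -[leRHS]mulr_natl => h.
have h2 : #|larger x i|%:R * (radius (x j) / (16 * n.+1%:R)) <= n.+1%:R * (radius (x j) / (16 * n.+1%:R)).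
  apply: ler_wpM2r; first by rewrite divr_ge0 ?(ltW (r0 j)) // mulr_ge0 // ltW.
  rewrite ler_nat.
  by apply: leq_trans (max_card _) _; rewrite card_ord.
have e (K r : R) : 0 < K -> K * (r / (16 * K)) = r / 16 by move=> ?; field; rewrite gt_eqF.
have := le_trans h h2; rewrite (e _ _ K0); lra.
Qed.

Lemma evolve_valid : valid (evolve d x).
Proof. by move=> i; split; [exact: new_radius_gt0|have [] := xv i]. Qed.

Lemma drift_active i : activity x i = 1 -> drift d x i = 0.
Proof. by move=> w1; rewrite drift_fix // /average w1 subrr mul0r scale0r. Qed.

Lemma evolve_pow_active i q : activity x i = 1 -> pow (evolve d x i) q = pow (x i) q + d.
Proof.
move=> w1; rewrite /pow /= /center /radius /= -/(center _) drift_active // addr0.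
by rewrite new_radius_sqr // w1; ring.
Qed.

Lemma evolve_plane_active i q : activity x i = 1 -> in_plane (evolve d x i) q <-> in_plane (x i) q.
Proof.
by move=> w1; rewrite /in_plane /center /normal /= -/(center _) drift_active // addr0.
Qed.

(** [cdist] decreases by at most 2 (1/8 + 1/8) + 1/16 < 1 times the radius of the far ring, and that
    radius does not grow. *)
Lemma evolve_remote i j : remote N (x i) (x j) -> remote (N - 1) (evolve d x i) (evolve d x j).
Proof.
suff H k l : N * radius (x k) < cdist (center (x k)) (x l) ->
    (N - 1) * radius (evolve d x k) < cdist (center (evolve d x k)) (evolve d x l).
  by move=> [/H|/H]; [left|right].
move=> far; have [_ nl] := xv l.
have := @cdist_lip R (center (x k)) (center (evolve d x k)) (x l) (evolve d x l) nl erefl.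
have -> : center (x k) - center (x l) - (center (evolve d x k) - center (evolve d x l)) =
    drift d x l - drift d x k by apply/rowP => t; rewrite !mxE; ring.
have -> : radius (x l) - radius (evolve d x l) = loss d x l by [].
rewrite ger0_norm ?loss_ge0 // => lip.
have := enormD (drift d x l) (- drift d x k); rewrite enormN => sl.
have := drift_small l k; have := drift_small k k.
have dl : loss d x l <= radius (x k) / 16.
  rewrite ler_pdivlMr //; have lk := loss_small N xv d_itv l k. apply: le_trans _ lk.
  have n1 : 1 <= n.+1%:R :> R by rewrite ler1n.
  have := ler_wpM2r (loss_ge0 N xv d_itv l) n1; lra.
have rk : radius (evolve d x k) <= radius (x k) by exact: new_radius_le.
have rk0 := r0 k; have rk' : 0 < radius (evolve d x k) by exact: new_radius_gt0.
move=> s1 s2; have le1 : (N - 1) * radius (x k) < cdist (center (evolve d x k)) (evolve d x l).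
  by rewrite mulrBl mul1r; lra.
have [N1|N1] := lerP 1 N.
  by apply: le_lt_trans le1; rewrite ler_wpM2l // subr_ge0.
apply: lt_le_trans (cdist_ge0 _ _); rewrite nmulr_rlt0 //; lra.
Qed.

(** The dichotomy behind all invariants: either both rings follow the hemisphere flow exactly, or
    the pair is still remote after the step. *)
Lemma contact_cases i j : 0 < N -> i != j ->
  (activity x i = 1 /\ activity x j = 1) \/ remote (N - 1) (evolve d x i) (evolve d x j).
Proof.
move=> N0 ij; have /andP[c0 c1] := contact_itv N (x i) (x j).
move: c1; rewrite le_eqVlt => /orP[/eqP c1|c1].
  by left; apply: (contact1_activity _ c1); rewrite eq_sym.
by right; apply/evolve_remote/contact_lt1.
Qed.

(** In an active pair both powers grow by [d], so that a hit after the step was a hit before it. The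
    other pairs are remote with [N - 1 >= 3]. *)
Lemma evolve_unlinked : 4 <= N -> unlinked_state x -> unlinked_state (evolve d x).
Proof.
move=> N4 [_ nh]; have mv := evolve_valid; split=> // i j ij.
have [|[wi wj]|far] := @contact_cases i j _ ij; first lra.
  move=> [q [pi pj e le0]]; apply: (nh i j ij); exists q.
  move: e le0; rewrite !evolve_pow_active // => /addIr e le0.
  split=> //; [exact/evolve_plane_active|exact/evolve_plane_active|].
  by case/andP: d_itv => d0 _; lra.
have [ri ni] := mv i; have [rj nj] := mv j.
by apply: remote_not_hit far => //; lra.
Qed.

(** In an active pair the squared radii lose the same amount, so that the ratio of the smaller to
    the larger does not grow, and balls that meet after the step met before. The other pairs are
    remote with [N - 1 >= 4 + 5 / c]. *)
Lemma evolve_complexity c : 0 < c -> 5 + 5 / c <= N ->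
  complexity_of x < c -> complexity_of (evolve d x) < c.
Proof.
move=> c0 cN; have N0 : 0 < N.
  by apply: lt_le_trans cN; rewrite ltr_pwDl // divr_ge0 // ltW.
have mv := evolve_valid; have d0 : 0 <= d by case/andP: d_itv.
move=> lt_c; apply: bigmax_lt_of => // i _; apply: bigmax_lt_of => // j.
move=> /and3P[ij le_ij /asboolP near].
have [[wi wj]|far] := @contact_cases i j N0 ij; last first.
  have [ri ni] := mv i; have [rj nj] := mv j.
  by apply: (remote_ratio (M := N - 1)) => //; lra.
have ci : center (evolve d x i) = center (x i) by rewrite /center /= drift_active ?addr0.
have cj : center (evolve d x j) = center (x j) by rewrite /center /= drift_active ?addr0.
have ri2 : radius (evolve d x i) ^+ 2 = radius (x i) ^+ 2 - d by rewrite new_radius_sqr // wi mul1r.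
have rj2 : radius (evolve d x j) ^+ 2 = radius (x j) ^+ 2 - d by rewrite new_radius_sqr // wj mul1r.
have [[mi _] [mj _]] := (mv i, mv j).
have le_ij' : radius (x i) <= radius (x j).
  have h : radius (evolve d x i) ^+ 2 <= radius (evolve d x j) ^+ 2.
    by rewrite ler_sqr ?nnegrE ?(ltW mi) ?(ltW mj).
  by rewrite -ler_sqr ?nnegrE ?(ltW (r0 _)) //; move: h; rewrite ri2 rj2; lra.
have ratio : radius (evolve d x i) / radius (evolve d x j) <= radius (x i) / radius (x j).
  rewrite ler_pdivrMr // mulrAC ler_pdivlMr //.
  rewrite -ler_sqr ?nnegrE ?mulr_ge0 ?(ltW (r0 _)) ?(ltW mi) ?(ltW mj) //.
  rewrite !exprMn ri2 rj2.
  have : radius (x i) ^+ 2 <= radius (x j) ^+ 2 by rewrite ler_sqr ?nnegrE ?(ltW (r0 _)).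
  by move: (radius (x i) ^+ 2) (radius (x j) ^+ 2) => a b; nra.
apply: le_lt_trans ratio _; apply: le_lt_trans lt_c.
apply: le_trans (le_bigmax_of _ (isT : xpredT i)).
apply: (le_bigmax_of (fun j => radius (x i) / radius (x j))).
rewrite ij le_ij' /=; apply/asboolP; move: near; rewrite ci cj => -[z [zi zj]]; exists z.
have li : radius (evolve d x i) <= radius (x i) by exact: new_radius_le.
have lj : radius (evolve d x j) <= radius (x j) by exact: new_radius_le.
by split; move: zi zj; rewrite /eball /= => zi zj; lra.
Qed.
End Fixed.
End Preservation.

(** * Clusters of small rings *)

Section Reference.
Context {R : realType} {n : nat}.
Variable N : R.
Local Notation state := ('I_n -> ring_data R).
Implicit Types (x : state) (i j k l : 'I_n).
Local Notation stride := (@stride R n).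
Local Notation evolve := (@evolve R n N).
Local Notation loss := (@loss R n N).
Local Notation drift := (@drift R n N).
Local Notation carry := (@carry R n N).
Local Notation activity := (@activity R n N).

Variable x : state.
Hypothesis xv : valid x.
Variable d : R.
Hypothesis d_itv : 0 <= d <= stride x.
Let r0 i : 0 < radius (x i). Proof. by have [] := xv i. Qed.
Local Notation p i := (center (x i)).
Local Notation U := (carry d x (drift d x)).

(* A cluster of small rings follows a reference field [F], up to the motion of the
   cluster itself: [big] are the rings outside of the cluster that drag it along. *)
Lemma drift_reference (cl big : pred 'I_n) (F : 'rV[R]_3 -> 'rV[R]_3) (u L : R)
    (eta : 'I_n -> R) :
  0 <= u -> 0 <= L -> (forall i, cl i -> 0 <= eta i) ->
  (forall k, cl k -> ~~ big k) ->
  (forall i k, cl i -> 0 < pull x i k -> cl k || big k) ->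
  (forall i, cl i -> enorm (F (p i)) <= u) ->
  (forall i k, cl i -> cl k -> enorm (F (p i) - F (p k)) <= L * enorm (p i - p k)) ->
  (forall i, cl i -> enorm (\sum_(k | big k) pull x i k *: (U k (p i) - F (p i)) - F (p i)) <=
     eta i * (1 + \sum_(k | big k) pull x i k)) ->
  forall i, cl i -> enorm (drift d x i - F (p i)) <=
    \sum_(k | cl k) (activity x k * u + eta k + 2 * loss d x k + 2 * L * radius (x k)).
Proof.
move=> u0 L0 eta0 cl_big cover F_le F_lip F_big.
(* [g] is the error made at a ring itself, by its activity and by the rings in [big]; [h] is the
   error of transporting [F] from a ring to the rings that it pulls. *)
pose g k := activity x k * u + eta k.
pose h k := 2 * loss d x k + 2 * L * radius (x k).
have w_ge0 k : 0 <= activity x k by case/andP: (activity_itv N x k).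
have w_le1 k : activity x k <= 1 by case/andP: (activity_itv N x k).
have g0 k : cl k -> 0 <= g k by move=> ck; rewrite addr_ge0 ?eta0 // mulr_ge0.
have h0 k : 0 <= h k.
  by rewrite addr_ge0 ?mulr_ge0 ?(loss_ge0 N xv d_itv) ?(ltW (r0 _)).
move=> i ci.
have -> : \sum_(k | cl k) (activity x k * u + eta k + 2 * loss d x k + 2 * L * radius (x k)) =
    \sum_(k | cl k) (g k + h k) by apply: eq_bigr => k _; rewrite /g /h; ring.
apply: (@le_trans _ _ (g i + \sum_(k | cl k && (k \in larger x i)) (g k + h k))); last first.
  rewrite [leRHS](bigD1 i) //= -[leRHS](addrA (g i)) lerD2l.
  apply: le_trans (_ : \sum_(k | cl k && (k != i)) (g k + h k) <= _); last by rewrite lerDr.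
  rewrite [leRHS]big_mkcond [leLHS]big_mkcond /=; apply: ler_sum => k _.
  case: ifP => [/andP[ck ki]|_]; last by case: ifP => // /andP[ck _]; rewrite addr_ge0 ?g0.
  by rewrite ck; case: eqVneq ki => // ->; rewrite inE ltxx.
apply: (@chain_le R n x cl (fun i => enorm (drift d x i - F (p i))) g h) ci => [k ck|{}i B ci B0 kB].
  by rewrite addr_ge0 ?g0.
rewrite (drift_sub N xv d) ; set s := \sum_j pull x i j.
have pull0 k : 0 <= pull x i k by exact: pull_ge0.
set sb := \sum_(k | big k) pull x i k; set sc := \sum_(k | cl k) pull x i k.
have sE (T : lmodType R) (G : 'I_n -> T) : \sum_j pull x i j *: G j =
    \sum_(j | cl j) pull x i j *: G j + \sum_(j | big j) pull x i j *: G j.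
  rewrite (bigID cl) /=; congr (_ + _).
  rewrite (bigID big) /= [X in _ + X]big1 ?addr0 => [|k /andP[nck nbk]].
    by apply: eq_bigl => k; rewrite andbC; case bk: (big k) => //=; apply/negP => /cl_big; rewrite bk.
  have [->|pk] := eqVneq (pull x i k) 0; first by rewrite scale0r.
  have pk0 : 0 < pull x i k by rewrite lt_def pk pull0.
  have /orP[] := cover i k ci pk0; first by move=> ck; rewrite ck in nck.
  by move=> bk; rewrite bk in nbk.
have ssbc : s = sc + sb.
  have := sE R^o (fun=> 1); rewrite /s /sb /sc /GRing.scale /=.
  by under eq_bigr do rewrite mulr1; under [X in X + _]eq_bigr do rewrite mulr1;
     under [X in _ + X]eq_bigr do rewrite mulr1.
have sc0 : 0 <= sc by exact: sumr_ge0.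
have sb0 : 0 <= sb by exact: sumr_ge0.
rewrite sE; set vc := \sum_(j | cl j) _; set vb := \sum_(j | big j) _.
have vb_le : enorm (vb - F (p i)) <= eta i * (1 + sb) by exact: F_big.
have vc_le : enorm vc <= sc * B.
  apply: le_trans (enorm_sum _ _ _) _; rewrite mulr_suml; apply: ler_sum => k ck.
  rewrite enormZ ger0_norm //.
  have [->|pk] := eqVneq (pull x i k) 0; first by rewrite !mul0r.
  rewrite ler_wpM2l //.
  have pk0 : 0 < pull x i k by rewrite lt_def pk pull0.
  have [lt_ik _] := pull_gt0 xv pk0; have dist_ik := pull_dist xv pk0.
  apply: le_trans (kB k ck lt_ik).
  have -> : U k (p i) - F (p i) = (drift d x k - F (p k)) +
      (- ((loss d x k / radius (x k)) *: (p i - p k)) + - (F (p i) - F (p k))).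
    by apply/rowP => t; rewrite !mxE; ring.
  apply: le_trans (enormD _ _) _; rewrite lerD2l.
  apply: le_trans (enormD _ _) _; rewrite !enormN enormZ.
  have q0 : 0 <= loss d x k / radius (x k) by rewrite divr_ge0 ?(loss_ge0 N xv d_itv) ?(ltW (r0 _)).
  rewrite ger0_norm // /h; apply: lerD.
    apply: le_trans (ler_wpM2l q0 (ltW dist_ik)) _.
    by rewrite mulrCA divfK // gt_eqF.
  by apply: le_trans (F_lip i k ci ck) _; rewrite -mulrA mulrCA ler_wpM2l // ltW.
have S0 : 0 < 1 + s by rewrite ssbc; lra.
apply: le_trans (enormD _ _) _; rewrite scaleNr enormN enormZ ger0_norm //.
rewrite /g -[leRHS]addrA; apply: lerD; first by rewrite ler_wpM2l // F_le.
have a0 : 0 <= (1 - activity x i) / (1 + s) by rewrite divr_ge0 ?subr_ge0 ?(ltW S0).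
rewrite enormZ ger0_norm //.
have v_le : enorm (vc + vb - F (p i)) <= sc * B + eta i * (1 + sb).
  by rewrite -addrA; apply: le_trans (enormD _ _) _; exact: lerD.
apply: le_trans (ler_wpM2l a0 v_le) _.
rewrite mulrAC ler_pdivrMr //.
have E0 := eta0 i ci.
have q1 : 0 <= sc * B by rewrite mulr_ge0.
have q2 : 0 <= eta i * sb by rewrite mulr_ge0.
have q3 : 0 <= eta i * sc by rewrite mulr_ge0.
have q4 : 0 <= sb * B by rewrite mulr_ge0.
have q5 : 0 <= activity x i * (sc * B + eta i * (1 + sb)).
  by rewrite mulr_ge0 // addr_ge0 // mulr_ge0 //; lra.
rewrite ssbc; lra.
Qed.

End Reference.

(** * Clusters dragged along by persisting rings *)

Section Following.
Context {R : realType} {n : nat}.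
Variable N : R.
Local Notation state := ('I_n -> ring_data R).
Implicit Types (x : state) (i j k l : 'I_n) (cl big : pred 'I_n).
Local Notation stride := (@stride R n).
Local Notation evolve := (@evolve R n N).
Local Notation loss := (@loss R n N).
Local Notation drift := (@drift R n N).
Local Notation carry := (@carry R n N).
Local Notation activity := (@activity R n N).

Variables a b c : R.
Hypotheses (a0 : 0 < a) (b0 : 0 < b) (c0 : 0 < c).

(** The situation at late times: [cl] is a cluster of vanishing rings, [big] are the rings of
    positive limit radius, and no other ring pulls the cluster. *)
Definition follows x cl big := [/\ forall k, cl k -> ~~ big k,
  forall i k, cl i -> 0 < pull x i k -> cl k || big k,
  forall k, big k -> a <= radius (x k),
  forall k, radius (x k) <= b &
  forall i k, enorm (center (x i) - center (x k)) <= b].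

(** Speed of the similarities of large rings at distance at most b: the first summand bounds their
    drift, the second their contraction. *)
Let C1 : R := 2 * n%:R / a + b / a ^+ 2.

Let C1_ge0 : 0 <= C1.
Proof. by rewrite addr_ge0 ?divr_ge0 ?mulr_ge0 ?exprn_ge0 ?ler0n ?(ltW a0) ?(ltW b0). Qed.

Section OneStep.
Variables (x : state) (d : R).
Hypotheses (xv : valid x) (d_itv : 0 <= d <= stride x).
Let r0 i : 0 < radius (x i). Proof. by have [] := xv i. Qed.
Let d0 : 0 <= d. Proof. by case/andP: d_itv. Qed.
Local Notation p i := (center (x i)).
Local Notation U := (carry d x (drift d x)).

Lemma loss_big k : a <= radius (x k) -> loss d x k <= d / a.
Proof.
move=> ak; rewrite ler_pdivlMr //.
apply: le_trans (_ : loss d x k * radius (x k) <= _); first by rewrite ler_wpM2l // (loss_ge0 N xv d_itv).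
apply: le_trans (loss_le N xv d_itv k) _; rewrite ler_piMl //.
by case/andP: (activity_itv N x k).
Qed.

Lemma loss_ratio_big k : a <= radius (x k) -> loss d x k / radius (x k) <= d / a ^+ 2.
Proof.
move=> ak; rewrite ler_pdivrMr //; apply: le_trans (loss_big ak) _.
rewrite expr2 invfM mulrA -[X in _ <= X]mulrA ler_peMr ?divr_ge0 ?(ltW a0) //.
by rewrite mulrC ler_pdivlMr // mul1r.
Qed.

Lemma carry_big k (q : 'rV[R]_3) : a <= radius (x k) -> enorm (q - p k) <= b -> enorm (U k q) <= C1 * d.
Proof.
move=> ak qk; apply: le_trans (enormD _ _) _; rewrite enormN enormZ.
have q0 : 0 <= loss d x k / radius (x k) by rewrite divr_ge0 ?(loss_ge0 N xv d_itv) ?(ltW (r0 _)).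
rewrite ger0_norm // /C1 [leRHS]mulrDl; apply: lerD.
  apply: le_trans (drift_le N xv d_itv k) _; rewrite -!mulrA ler_pM2l //.
  apply: le_trans (_ : \sum_(l in larger x k) d / a <= _).
    by apply: ler_sum => l; rewrite inE => kl; apply: loss_big; apply: le_trans ak (ltW kl).
  rewrite sumr_const -[leLHS]mulr_natl [a^-1 * d]mulrC ler_wpM2r ?divr_ge0 ?(ltW a0) // ler_nat.
  by apply: leq_trans (max_card _) _; rewrite card_ord.
apply: le_trans (ler_pM q0 (enorm_ge0 _) (loss_ratio_big ak) qk) _.
by have -> : d / a ^+ 2 * b = b / a ^+ 2 * d by ring.
Qed.

Lemma carry_lip k (q q' : 'rV[R]_3) : a <= radius (x k) ->
  enorm (U k q - U k q') <= d / a ^+ 2 * enorm (q - q').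
Proof.
move=> ak; have -> : U k q - U k q' = - ((loss d x k / radius (x k)) *: (q - q')).
  by apply/rowP => t; rewrite !mxE; ring.
have q0 : 0 <= loss d x k / radius (x k) by rewrite divr_ge0 ?(loss_ge0 N xv d_itv) ?(ltW (r0 _)).
by rewrite enormN enormZ ger0_norm // ler_wpM2r ?enorm_ge0 // loss_ratio_big.
Qed.

Lemma pull_le i k : c <= cdist (p i) (x k) -> radius (x k) <= b -> pull x i k <= b / c.
Proof.
move=> ck kb; rewrite /pull ge_max divr_ge0 ?(ltW b0) ?(ltW c0) //= lerBlDr.
apply: le_trans (_ : b / c <= _); last by rewrite lerDl.
have m0 : 0 < Num.max (cdist (p i) (x k)) (radius (x i)) by rewrite lt_max r0 orbT.
apply: ler_pM; rewrite ?(ltW (r0 _)) ?invr_ge0 ?(ltW m0) //.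
by rewrite lef_pV2 ?posrE // le_max ck.
Qed.

Lemma pull_lip i l k : c <= cdist (p i) (x k) -> c <= cdist (p l) (x k) ->
  radius (x i) <= c -> radius (x l) <= c -> radius (x k) <= b ->
  `|pull x i k - pull x l k| <= 2 * b / c ^+ 2 * enorm (p i - p l).
Proof.
move=> ci cm ri rl kb; rewrite /pull (max_l (le_trans ri ci)) (max_l (le_trans rl cm)).
have [_ nk] := xv k.
set s := cdist (p i) (x k) in ci *; set t := cdist (p l) (x k) in cm *.
have s0 : 0 < s by exact: lt_le_trans ci.
have t0 : 0 < t by exact: lt_le_trans cm.
have st : `|t - s| <= 2 * enorm (p i - p l).
  have h q q' : cdist q (x k) - cdist q' (x k) <= 2 * enorm (q - q').
    have := @cdist_lip R q q' (x k) (x k) nk erefl.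
    by rewrite opprB addrA subrK subrr normr0 addr0; lra.
  rewrite ler_norml; have := h (p i) (p l); have := h (p l) (p i).
  by rewrite (enormB (p l)) -/s -/t => h1 h2; apply/andP; split; lra.
have maxr_lip (u v : R) : `|Num.max 0 u - Num.max 0 v| <= `|u - v|.
  case: (lerP 0 u) (lerP 0 v) => [u0|u0] [v0|v0]; rewrite ?subrr ?normr0 ?subr0 ?sub0r ?normrN //.
  - by rewrite !ger0_norm //; lra.
  - by rewrite ger0_norm // distrC ger0_norm; lra.
apply: le_trans (maxr_lip _ _) _.
have -> : radius (x k) / s - 1 - (radius (x k) / t - 1) = radius (x k) / (s * t) * (t - s).
  by field; rewrite !gt_eqF.
rewrite normrM ger0_norm; last by rewrite divr_ge0 ?mulr_ge0 ?(ltW (r0 _)) ?(ltW s0) ?(ltW t0).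
have -> : 2 * b / c ^+ 2 * enorm (p i - p l) = (b / c ^+ 2) * (2 * enorm (p i - p l)) by ring.
apply: ler_pM => //; first by rewrite divr_ge0 ?mulr_ge0 ?(ltW (r0 _)) ?(ltW s0) ?(ltW t0).
apply: ler_pM; rewrite ?(ltW (r0 _)) ?invr_ge0 ?mulr_ge0 ?(ltW s0) ?(ltW t0) //.
rewrite lef_pV2 ?posrE ?mulr_gt0 ?exprn_gt0 // expr2.
by apply: ler_pM => //; rewrite ltW.
Qed.

End OneStep.
(** The similarity of ring j multiplies distances to its circle by [1 - rho]; the last term is the
    deviation of the drift from it. The old distance is bounded by the new one because the estimates
    will run backwards from the limit. *)
Lemma cdist_evolve x d i j : valid x -> 0 <= d <= stride x -> a <= radius (x j) ->
  cdist (center (x i)) (x j) <= cdist (center (evolve d x i)) (evolve d x j) +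
    a ^- 2 * d * cdist (center (x i)) (x j) +
    2 * enorm (drift d x i - carry d x (drift d x) j (center (x i))).
Proof.
move=> xv d_itv ja; have [rj nj] := xv j.
set rho := loss d x j / radius (x j).
have rho1 : rho <= 1.
  rewrite ler_pdivrMr // mul1r /loss lerBlDr lerDl ltW //; exact: new_radius_gt0.
pose q := center (x i) + carry d x (drift d x) j (center (x i)).
have qE : q - center (evolve d x j) = (1 - rho) *: (center (x i) - center (x j)).
  by apply/rowP => t; rewrite !mxE -/rho; ring.
have rE : radius (evolve d x j) = (1 - rho) * radius (x j).
  by rewrite mulrBl mul1r divfK ?gt_eqF // /loss opprB addrC subrK.
have cE : cdist q (evolve d x j) = (1 - rho) * cdist (center (x i)) (x j).
  have e : `|1 - rho| = 1 - rho by rewrite ger0_norm ?subr_ge0.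
  by rewrite /cdist qE rE enormZ dotZl e -[_ * enorm _ - _]mulrBr !normrM e mulrDr.
have := @cdist_lip R q (center (evolve d x i)) (evolve d x j) (evolve d x j) nj erefl.
rewrite subrr normr0 addr0 cE.
have -> : q - center (evolve d x j) - (center (evolve d x i) - center (evolve d x j)) =
    - (drift d x i - carry d x (drift d x) j (center (x i))).
  by apply/rowP => t; rewrite !mxE; ring.
rewrite enormN => h.
have rho_le : rho <= a ^- 2 * d by rewrite mulrC; exact: loss_ratio_big.
have := ler_wpM2r (cdist_ge0 (center (x i)) (x j)) rho_le; lra.
Qed.

Lemma sum_const_le (P : pred 'I_n) (F : 'I_n -> R) (m : R) : 0 <= m ->
  (forall k, P k -> F k <= m) -> \sum_(k | P k) F k <= n%:R * m.
Proof.
move=> m0 Fm; apply: le_trans (ler_sum _ Fm) _.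
rewrite sumr_const -[leLHS]mulr_natl ler_wpM2r // ler_nat.
by apply: leq_trans (max_card _) _; rewrite card_ord.
Qed.

(** [C1] serves the activity terms, the next two summands [drift_follow] and the last three
    [drift_together]. The repeated summand comes once from the numerator and once from the
    denominator of the average. *)
Definition follow_const : R :=
  C1 + C1 * (1 + 2 * (n%:R * (b / c))) / a + 2 / a ^+ 2 +
  n%:R * (2 * b / c ^+ 2) * C1 + n%:R * (b / c) / a ^+ 2 + n%:R * (2 * b / c ^+ 2) * C1.

Let nbc0 : 0 <= n%:R * (b / c).
Proof. by rewrite mulr_ge0 ?divr_ge0 ?(ltW b0) ?(ltW c0). Qed.
Let nb2 : 0 <= n%:R * (2 * b / c ^+ 2).
Proof. by rewrite mulr_ge0 ?divr_ge0 ?mulr_ge0 ?(ltW b0) ?exprn_ge0 ?(ltW c0). Qed.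
Let ia2 : 0 <= a ^+ 2. Proof. exact: sqr_ge0. Qed.

Let K0 : 0 <= 1 + 2 * (n%:R * (b / c)). Proof. by rewrite addr_ge0 // mulr_ge0. Qed.

Lemma follow_constP : [/\ 0 <= follow_const, C1 <= follow_const,
  C1 * (1 + 2 * (n%:R * (b / c))) / a + 2 / a ^+ 2 <= follow_const &
  n%:R * (2 * b / c ^+ 2) * C1 + n%:R * (b / c) / a ^+ 2 + n%:R * (2 * b / c ^+ 2) * C1
    <= follow_const].
Proof.
have h1 : 0 <= C1 * (1 + 2 * (n%:R * (b / c))) / a.
  by rewrite divr_ge0 ?(ltW a0) // mulr_ge0.
have h2 : 0 <= 2 / a ^+ 2 by rewrite divr_ge0.
have h3 : 0 <= n%:R * (2 * b / c ^+ 2) * C1 by rewrite mulr_ge0.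
have h4 : 0 <= n%:R * (b / c) / a ^+ 2 by rewrite divr_ge0.
have aux (A B D E F : R) : 0 <= F -> 0 <= A -> 0 <= B -> 0 <= D -> 0 <= E ->
    [/\ 0 <= F + A + B + D + E + D, F <= F + A + B + D + E + D,
        A + B <= F + A + B + D + E + D & D + E + D <= F + A + B + D + E + D].
  by move=> *; split; lra.
exact: aux.
Qed.

(** The reference field is the similarity of ring j. With t = [cdist] + [radius], ring j has weight
    at least a / t - 1, every other persisting ring at most b / c; so ring j dominates up to a
    relative error of order t. *)
Lemma drift_follow x d cl big j : valid x -> 0 <= d <= stride x -> follows x cl big ->
  big j -> (forall i k, cl i -> big k -> k != j -> c <= cdist (center (x i)) (x k)) ->
  forall i, cl i -> enorm (drift d x i - carry d x (drift d x) j (center (x i))) <=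
    \sum_(k | cl k) (follow_const * (activity x k * d) +
      follow_const * d * (cdist (center (x k)) (x j) + radius (x k)) + 2 * loss d x k).
Proof.
move=> xv d_itv [disj cover big_a le_b dist_b] bj far i ci.
have r0 k : 0 < radius (x k) by have [] := xv k.
have d0 : 0 <= d by case/andP: d_itv.
have w0 k : 0 <= activity x k by case/andP: (activity_itv N x k).
pose u := C1 * d; have u0 : 0 <= u by rewrite mulr_ge0.
pose t k := cdist (center (x k)) (x j) + radius (x k).
have t0 k : 0 < t k by rewrite ltr_wpDl ?cdist_ge0.
pose eta k := u * (1 + 2 * (n%:R * (b / c))) * (t k / a).
have eta0 k : 0 <= eta k.
  by rewrite mulr_ge0 ?(mulr_ge0 u0 K0) // divr_ge0 ?(ltW a0) ?(ltW (t0 k)).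
have cu k q : big k -> enorm (q - center (x k)) <= b -> enorm (carry d x (drift d x) k q) <= u.
  by move=> bk; exact: carry_big (big_a _ bk).
have ja := big_a _ bj.
apply: le_trans (@drift_reference R n N x xv d d_itv cl big (carry d x (drift d x) j) u
  (d / a ^+ 2) eta u0 _ _ disj cover _ _ _ i ci) _.
- by rewrite divr_ge0.
- by move=> k _; exact: eta0.
- by move=> k _; apply: cu.
- by move=> k l _ _; exact: carry_lip.
- move=> k ck; set s := \sum_(l | big l) pull x k l.
  have s_ge : a / t k <= 1 + s.
    apply: le_trans (_ : 1 + pull x k j <= _); last first.
      rewrite lerD2l /s (bigD1 j) //= lerDl; apply: sumr_ge0 => l _; exact: pull_ge0.
    rewrite -lerBlDl /pull le_max; apply/orP; right; rewrite lerD2r.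
    have m0 : 0 < Num.max (cdist (center (x k)) (x j)) (radius (x k)) by rewrite lt_max r0 orbT.
    apply: ler_pM; rewrite ?(ltW a0) ?invr_ge0 ?(ltW (t0 k)) //.
    by rewrite lef_pV2 ?posrE // ge_max /t lerDl lerDr cdist_ge0 (ltW (r0 k)).
  have e_le : u * (1 + 2 * (n%:R * (b / c))) <= eta k * (1 + s).
    rewrite /eta -mulrA ler_peMr ?(mulr_ge0 u0 K0) //.
    apply: le_trans (_ : t k / a * (a / t k) <= _); last first.
      by rewrite ler_wpM2l // divr_ge0 ?(ltW a0) ?(ltW (t0 k)).
    by rewrite mulrA divfK ?gt_eqF // divff // gt_eqF.
  apply: le_trans e_le; rewrite (bigD1 j) //= subrr scaler0 add0r.
  apply: le_trans (enormD _ _) _; rewrite enormN mulrDr mulr1 addrC.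
  apply: lerD; first exact: cu.
  apply: le_trans (enorm_sum _ _ _) _.
  have -> : u * (2 * (n%:R * (b / c))) = n%:R * ((b / c) * (2 * u)) by ring.
  have bc0 : 0 <= b / c by rewrite divr_ge0 ?(ltW b0) ?(ltW c0).
  apply: sum_const_le => [|l /andP[bl lj]]; first by rewrite mulr_ge0 // mulr_ge0.
  rewrite enormZ ger0_norm ?pull_ge0 //; apply: ler_pM; rewrite ?pull_ge0 ?enorm_ge0 //.
    by apply: pull_le => //; exact: far.
  apply: le_trans (enormD _ _) _; rewrite enormN mulr2n mulrDl mul1r.
  by apply: lerD; apply: cu.
apply: ler_sum => k ck; rewrite -/(t k).
have h1 : activity x k * u <= follow_const * (activity x k * d).
  by rewrite /u mulrCA ler_wpM2r ?mulr_ge0 //; case: follow_constP.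
have h2 : eta k + 2 * (d / a ^+ 2) * radius (x k) <= follow_const * d * t k.
  have -> : eta k = (C1 * (1 + 2 * (n%:R * (b / c))) / a) * (d * t k) by rewrite /eta /u; ring.
  have h3 : 2 * (d / a ^+ 2) * radius (x k) <= 2 / a ^+ 2 * (d * t k).
    have -> : 2 * (d / a ^+ 2) * radius (x k) = 2 / a ^+ 2 * (d * radius (x k)) by ring.
    by rewrite ler_wpM2l ?divr_ge0 // ler_wpM2l // lerDr cdist_ge0.
  apply: le_trans (lerD (lexx _) h3) _; rewrite -mulrDl -[leRHS]mulrA ler_wpM2r ?mulr_ge0 ?(ltW (t0 _)) //.
  by case: follow_constP.
lra.
Qed.

(** All persisting circles are at distance at least c, so that their pulls are Lipschitz in the
    center. The reference field is the constant vector by which the persisting rings alone would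
    move an inactive [i0]; errors are proportional to the distance from [i0]. *)
Lemma drift_together x d cl big i0 : valid x -> 0 <= d <= stride x -> follows x cl big ->
  cl i0 -> (forall i k, cl i -> big k -> c <= cdist (center (x i)) (x k)) ->
  (forall i, cl i -> radius (x i) <= c) ->
  forall i, cl i -> enorm (drift d x i - drift d x i0) <=
    2 * \sum_(k | cl k) (follow_const * (activity x k * d) +
      follow_const * d * enorm (center (x k) - center (x i0)) + 2 * loss d x k).
Proof.
move=> xv d_itv fol ci0 far small i ci; have [disj cover big_a le_b dist_b] := fol.
have r0 k : 0 < radius (x k) by have [] := xv k.
have d0 : 0 <= d by case/andP: d_itv.
have w0 k : 0 <= activity x k by case/andP: (activity_itv N x k).
pose u := C1 * d; have u0 : 0 <= u by rewrite mulr_ge0.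
pose U k q := carry d x (drift d x) k q.
have cu k q : big k -> enorm (q - center (x k)) <= b -> enorm (U k q) <= u.
  by move=> bk; exact: carry_big (big_a _ bk).
pose A i := \sum_(k | big k) pull x i k.
pose S i := \sum_(k | big k) pull x i k *: U k (center (x i)).
have A0 k : 0 < 1 + A k.
  by rewrite ltr_pwDl //; apply: sumr_ge0 => l _; exact: pull_ge0.
pose V := (1 + A i0)^-1 *: S i0.
have V_le : enorm V <= u.
  rewrite enormZ ger0_norm ?invr_ge0 ?(ltW (A0 _)) // mulrC ler_pdivrMr //.
  apply: le_trans (enorm_sum _ _ _) _.
  apply: le_trans (_ : \sum_(k | big k) pull x i0 k * u <= _).
    apply: ler_sum => k bk; rewrite enormZ ger0_norm ?pull_ge0 // ler_wpM2l ?pull_ge0 //.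
    exact: cu.
  by rewrite -mulr_suml mulrC ler_wpM2l // lerDr.
pose Q := n%:R * (2 * b / c ^+ 2) * C1 + n%:R * (b / c) / a ^+ 2 + n%:R * (2 * b / c ^+ 2) * C1.
have Q0 : 0 <= Q by rewrite addr_ge0 ?addr_ge0 ?divr_ge0 // mulr_ge0.
pose t k := enorm (center (x k) - center (x i0)).
have t0 k : 0 <= t k by exact: enorm_ge0.
have lip k l : cl k -> big l -> `|pull x k l - pull x i0 l| <= 2 * b / c ^+ 2 * t k.
  by move=> ck bl; apply: pull_lip; rewrite ?far ?small.
have b2c : 0 <= 2 * b / c ^+ 2 by rewrite divr_ge0 ?mulr_ge0 ?(ltW b0) ?exprn_ge0 ?(ltW c0).
have SE k : cl k -> enorm (S k - S i0) <= n%:R * (2 * b / c ^+ 2 * t k * u) +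
    n%:R * (b / c * (d / a ^+ 2 * t k)).
  move=> ck; have -> : S k - S i0 =
      \sum_(l | big l) ((pull x k l - pull x i0 l) *: U l (center (x k)) +
                       pull x i0 l *: (U l (center (x k)) - U l (center (x i0)))).
    rewrite /S -sumrB; apply: eq_bigr => l _.
    by apply/rowP => s; rewrite !mxE; ring.
  apply: le_trans (enorm_sum _ _ _) _; rewrite -mulrDr; apply: sum_const_le.
    have bc0 : 0 <= b / c by rewrite divr_ge0 ?(ltW b0) ?(ltW c0).
    by rewrite (addr_ge0 (mulr_ge0 (mulr_ge0 b2c (t0 k)) u0))
      ?(mulr_ge0 bc0 (mulr_ge0 (divr_ge0 d0 ia2) (t0 k))).
  move=> l bl; apply: le_trans (enormD _ _) _; rewrite !enormZ; apply: lerD.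
    by apply: ler_pM; rewrite ?normr_ge0 ?enorm_ge0 ?cu ?lip.
  rewrite ger0_norm ?pull_ge0 //; apply: ler_pM; rewrite ?pull_ge0 ?enorm_ge0 //.
    by apply: pull_le; rewrite ?far.
  by apply: carry_lip; rewrite ?big_a.
have AE k : cl k -> `|A k - A i0| <= n%:R * (2 * b / c ^+ 2 * t k).
  move=> ck; rewrite /A -sumrB; apply: le_trans (ler_norm_sum _ _ _) _.
  by apply: sum_const_le => [|l bl]; [exact: mulr_ge0|exact: lip].
have main k : cl k -> enorm (drift d x k - V) <=
    \sum_(k | cl k) (follow_const * (activity x k * d) +
      follow_const * d * t k + 2 * loss d x k).
  move=> ck.
  apply: le_trans (@drift_reference R n N x xv d d_itv cl big (fun=> V) u
    0 (fun k => Q * (d * t k)) u0 _ _ disj cover _ _ _ k ck) _ => //.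
  - by move=> l _; rewrite !mulr_ge0.
  - by move=> l m _ _; rewrite subrr enorm0 mul0r.
  - move=> {ck}k ck; set s := \sum_(l | big l) pull x k l.
    apply: le_trans (_ : Q * (d * t k) <= _); last first.
      by rewrite ler_peMr ?mulr_ge0 // lerDl; apply: sumr_ge0 => l _; exact: pull_ge0.
    have -> : \sum_(l | big l) pull x k l *: (U l (center (x k)) - V) - V =
        (S k - S i0) - (A k - A i0) *: V.
      under eq_bigr do rewrite scalerBr.
      rewrite big_split /= sumrN -scaler_suml -/(A k) -/(S k).
      have -> : S i0 = (1 + A i0) *: V by rewrite /V scalerA mulfV ?scale1r // gt_eqF.
      by apply/rowP => m; rewrite !mxE; ring.
    apply: le_trans (enormD _ _) _; rewrite enormN enormZ.
    apply: le_trans (lerD (SE k ck) (ler_pM (normr_ge0 _) (enorm_ge0 _) (AE k ck) V_le)) _.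
    by rewrite /Q /u le_eqVlt; apply/orP; left; apply/eqP; ring.
  - apply: ler_sum => l cl'.
    have h1 : activity x l * u <= follow_const * (activity x l * d).
      by rewrite /u mulrCA ler_wpM2r ?mulr_ge0 //; case: follow_constP.
    have h2 : Q * (d * t l) <= follow_const * d * t l.
      by rewrite -[leRHS]mulrA ler_wpM2r ?mulr_ge0 //; case: follow_constP.
    lra.
have -> : drift d x i - drift d x i0 = (drift d x i - V) + - (drift d x i0 - V).
  by apply/rowP => m; rewrite !mxE; ring.
apply: le_trans (enormD _ _) _; rewrite enormN mulr2n mulrDl mul1r.
by apply: lerD; apply: main.
Qed.

End Following.

(** * Estimates on real sequences *)

Section Sequences.
Context {R : realType}.
Implicit Types (a b sg : nat -> R) (C : R).

(** Gronwall from the limit backwards: [(1 - C * (sg k - sl)) * a k - b k] is nondecreasing and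
    bounded above by a sequence tending to 0, hence nonpositive; the factor of [a k] is at least 1 /
    2. *)
Lemma gronwall_tail a b sg C sl K : 0 <= C ->
  (forall k, (K <= k)%N -> [/\ 0 <= a k, 0 <= b k.+1 <= b k, sl <= sg k.+1 <= sg k &
     C * (sg k - sl) <= 1 / 2]) ->
  (forall k, (K <= k)%N -> a k <= a k.+1 + C * (sg k - sg k.+1) * a k + (b k - b k.+1)) ->
  a @ \oo --> (0 : R) -> forall k, (K <= k)%N -> a k <= 2 * b k.
Proof.
move=> C0 H le_a a0; pose f k := (1 - C * (sg k - sl)) * a k - b k.
have f_le k : (K <= k)%N -> f k <= f k.+1.
  move=> Kk; have [ak /andP[bk' dbk] /andP[slk dk] Ck] := H k Kk.
  have [ak' _ _ Ck'] := H k.+1 (leqW Kk).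
  pose e := C * (sg k - sg k.+1); pose phi := 1 - C * (sg k.+1 - sl).
  have e0 : 0 <= e by rewrite mulr_ge0 // subr_ge0.
  have phi1 : phi <= 1 by rewrite lerBlDr lerDl mulr_ge0 // subr_ge0.
  have phi0 : 0 <= phi by rewrite /phi; lra.
  have := ler_wpM2l phi0 (le_a k Kk); rewrite -/e => h.
  have h1 : phi * (e * a k) <= e * a k by rewrite ler_piMl // mulr_ge0.
  have h2 : phi * (b k - b k.+1) <= b k - b k.+1 by rewrite ler_piMl // subr_ge0.
  have -> : f k = (phi - e) * a k - b k by rewrite /f /phi /e; ring.
  have -> : f k.+1 = phi * a k.+1 - b k.+1 by [].
  lra.
move=> k Kk; have f_mono m : (k <= m)%N -> f k <= f m.
  elim: m => [|m IH]; first by rewrite leqn0 => /eqP ->.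
  rewrite leq_eqVlt => /orP[/eqP -> //|]; rewrite ltnS => km.
  by apply: le_trans (IH km) (f_le m (leq_trans Kk km)).
have fk_le m : (k <= m)%N -> f k <= a m.
  move=> km; apply: le_trans (f_mono m km) _; rewrite /f.
  have [am /andP[bm dbm] /andP[slm dm] Cm] := H m (leq_trans Kk km).
  have : (1 - C * (sg m - sl)) * a m <= a m.
    rewrite ler_piMl // lerBlDr lerDl mulr_ge0 // subr_ge0; exact: le_trans dm.
  lra.
have fk0 : f k <= 0.
  rewrite leNgt; apply/negP => fk0.
  have /cvgrPdist_lt /(_ _ fk0) [M _ HM] := a0.
  have := HM (maxn k M) (leq_maxr k M); rewrite /= sub0r normrN.
  have := fk_le (maxn k M) (leq_maxl k M).
  by move=> h1 h2; have := le_lt_trans h1 (le_lt_trans (ler_norm _) h2); rewrite ltxx.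
have [ak _ _ Ck] := H k Kk.
move: fk0; rewrite /f; have : 1 / 2 * a k <= (1 - C * (sg k - sl)) * a k.
  by rewrite ler_wpM2r //; lra.
lra.
Qed.

(* Along [s' = s - w d], the largest terms decrease at full speed, so that a maximal
   term stays maximal. *)
Lemma argmax_persists (I : Type) (s w : nat -> I -> R) (d : nat -> R) (S : I -> Prop) K i :
  (forall k l, (K <= k)%N -> S l -> [/\ s k.+1 l = s k l - w k l * d k,
     0 <= w k l, 0 <= d k & d k <= s k l / 4]) ->
  (forall k l, (K <= k)%N -> S l -> (forall m, S m -> s k m <= 2 * s k l) -> w k l = 1) ->
  S i -> (forall l, S l -> s K l <= s K i) ->
  forall k, (K <= k)%N -> (forall l, S l -> s k l <= s k i) /\ w k i = 1.
Proof.
move=> step act Si maxK k Kk.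
have active m : (K <= m)%N -> (forall l, S l -> s m l <= s m i) -> w m i = 1.
  move=> Km mx; apply: act => // l Sl; have := mx l Sl.
  by have [_ _ d0 dl] := step m i Km Si; have := mx i Si; lra.
suff mx : forall l, S l -> s k l <= s k i by split=> //; exact: active.
elim: k Kk => [|k IH]; first by rewrite leqn0 => /eqP K0; rewrite K0 in maxK.
rewrite leq_eqVlt => /orP[/eqP <- //|]; rewrite ltnS => Kk l Sl.
have mx := IH Kk; have wi := active k Kk mx.
have [si wi0 d0 di] := step k i Kk Si; have [sl wl0 _ dl] := step k l Kk Sl.
have si0 : 0 <= s k i by lra.
rewrite si sl wi mul1r; have [big|small] := lerP (s k i) (2 * s k l).
  have -> : w k l = 1 by apply: act => // m Sm; apply: le_trans (mx m Sm) big.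
  by have := mx l Sl; lra.
by have := mulr_ge0 wl0 d0; lra.
Qed.

Lemma near_finite_forall (I : finType) (P : I -> nat -> Prop) :
  (forall i, \forall k \near \oo, P i k) -> \forall k \near \oo, forall i, P i k.
Proof.
move=> H; have /choice[K HK] : forall i, exists K, forall k, (K <= k)%N -> P i k.
  by move=> i; have [K _ HK] := H i; exists K.
exists (\max_i K i)%N => // k /= Kk i; apply: HK; apply: leq_trans Kk.
exact: leq_bigmax.
Qed.

Lemma seq_lim_unique a (x y : R) : a @ \oo --> x -> a @ \oo --> y -> x = y.
Proof.
move=> ax ay; rewrite -(cvg_lim (@Rhausdorff R) ax); exact: cvg_lim ay.
Qed.

Lemma seq_lim_near_cst a (x y : R) K :
  (forall k, (K <= k)%N -> a k = x) -> a @ \oo --> y -> y = x.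
Proof.
move=> ax ay; apply: seq_lim_unique ay _; apply: cvg_near_cst.
by exists K => // k /= /ax.
Qed.

(** [c] is the sum of the monotone bounded sequences [c - b] and [b]. *)
Lemma cvg_bounded_variation (c b : nat -> R) :
  (forall k, `|c k.+1 - c k| <= b k - b k.+1) -> (forall k, 0 <= b k) ->
  cvg (c @ \oo).
Proof.
move=> var b0.
have b_dec k : b k.+1 <= b k by have := le_trans (normr_ge0 _) (var k); rewrite subr_ge0.
have b_cvg : cvg (b @ \oo).
  apply: nonincreasing_is_cvgn; first by apply/nonincreasing_seqP.
  by exists 0 => _ [k _ <-].
have mono : nondecreasing_seq (fun k => c k - b k).
  by apply/nondecreasing_seqP => k; have := var k; rewrite ler_norml => /andP[]; lra.
have dec k : c k + b k <= c 0 + b 0.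
  elim: k => // k; apply: le_trans.
  by have := var k; rewrite ler_norml => /andP[]; lra.
have cb : cvg ((fun k => c k - b k) @ \oo).
  apply: nondecreasing_is_cvgn => //; exists (c 0 + b 0) => _ [k _ <-].
  by have := dec k; have := b0 k; lra.
have -> : c = (fun k => (c k - b k) + b k) by apply/funext => k; rewrite subrK.
exact: is_cvgD.
Qed.
End Sequences.

(** * Orbits leave the region of contact *)

Section Orbit.
Context {R : realType} {n : nat}.
Variable N : R.
Local Notation state := ('I_n -> ring_data R).
Implicit Types (x : state) (i j l : 'I_n) (k m : nat).
Local Notation stride := (@stride R n).
Local Notation evolve := (@evolve R n N).
Local Notation loss := (@loss R n N).
Local Notation drift := (@drift R n N).
Local Notation carry := (@carry R n N).
Local Notation activity := (@activity R n N).

Variable X : nat -> state.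
Hypothesis X_unlinked : unlinked_state (X 0).
Hypothesis X_step : forall k, X k.+1 = evolve (stride (X k)) (X k).
Hypothesis N_large : (10 * n.+1%:R) ^+ 3 <= N.
Hypothesis X_contact : forall k, exists i j, i != j /\ 1 / 2 <= contact N (X k i) (X k j).

Local Notation r k i := (radius (X k i)).
Local Notation p k i := (center (X k i)).
Local Notation w k i := (activity (X k) i).
Local Notation d k := (stride (X k)).

Lemma N_ge10 : 10 <= N.
Proof.
have n1 : 1 <= n.+1%:R :> R by rewrite ler1n.
have t10 : 10 <= 10 * n.+1%:R :> R by rewrite ler_peMr.
apply: le_trans N_large; apply: le_trans t10 _.
have t1 : 1 <= 10 * n.+1%:R :> R by lra.
by rewrite exprS ler_peMr ?exprn_ege1 //; lra.
Qed.

Let N0 : 0 < N. Proof. by have := N_ge10; lra. Qed.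

Lemma orbit_unlinked k : unlinked_state (X k).
Proof.
elim: k => // k IH; rewrite X_step; apply: evolve_unlinked => //; first by case: IH.
  by rewrite lexx andbT ltW // stride_gt0 //; case: IH.
by have := N_ge10; lra.
Qed.

Let Xv k : valid (X k). Proof. by case: (orbit_unlinked k). Qed.
Let r0 k i : 0 < r k i. Proof. by have [] := Xv k i. Qed.
Let d0 k : 0 < d k. Proof. exact: stride_gt0. Qed.
Let d_itv k : 0 <= d k <= d k. Proof. by rewrite lexx andbT ltW. Qed.
Let w0 k i : 0 <= w k i. Proof. by case/andP: (activity_itv N (X k) i). Qed.
Let w1 k i : w k i <= 1. Proof. by case/andP: (activity_itv N (X k) i). Qed.

Lemma orbit_radius_sqr k i : r k.+1 i ^+ 2 = r k i ^+ 2 - w k i * d k.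
Proof. by rewrite X_step; exact: new_radius_sqr. Qed.

Lemma orbit_radius_le k i : r k.+1 i <= r k i.
Proof. by rewrite X_step; exact: new_radius_le. Qed.

Lemma orbit_radius_mono k m i : (k <= m)%N -> r m i <= r k i.
Proof.
elim: m => [|m IH]; first by rewrite leqn0 => /eqP ->.
rewrite leq_eqVlt => /orP[/eqP -> //|]; rewrite ltnS => km.
exact: le_trans (orbit_radius_le m i) (IH km).
Qed.

Lemma orbit_loss k i : loss (d k) (X k) i = r k i - r k.+1 i.
Proof. by rewrite X_step. Qed.

Lemma orbit_center k i : p k.+1 i = p k i + drift (d k) (X k) i.
Proof. by rewrite X_step. Qed.

Lemma orbit_normal k i : normal (X k i) = normal (X 0 i).
Proof. by elim: k => // k IH; rewrite X_step. Qed.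

Definition mass k : R := \sum_i r k i ^+ 2.

(** Two rings have activity at least 1 / 2. Hence the strides are summable although the orbit never
    stops. *)
Lemma mass_step k : d k <= mass k - mass k.+1.
Proof.
have -> : mass k - mass k.+1 = (\sum_i w k i) * d k.
  rewrite /mass -sumrB mulr_suml; apply: eq_bigr => i _.
  by rewrite orbit_radius_sqr; ring.
rewrite ler_peMl // ?(ltW (d0 k)) //.
have [i [j [ij c2]]] := X_contact k; rewrite (bigD1 i) //= (bigD1 j) 1?eq_sym //= addrA.
have := contact_le_activity N (X k) (_ : j != i); rewrite eq_sym => /(_ ij) hi.
have := contact_le_activity N (X k) ij; rewrite contact_sym => hj.
apply: le_trans (_ : w k i + w k j <= _); first lra.
by rewrite lerDl sumr_ge0.
Qed.

Lemma mass_ge0 k : 0 <= mass k.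
Proof. by apply: sumr_ge0 => i _; exact: sqr_ge0. Qed.

Definition lim_radius i : R := lim ((fun k => r k i) @ \oo).

Lemma radius_cvg i : (fun k => r k i) @ \oo --> lim_radius i.
Proof.
apply: nonincreasing_is_cvgn; first by apply/nonincreasing_seqP => k; exact: orbit_radius_le.
by exists 0 => _ [k _ <-]; exact: ltW.
Qed.

Lemma lim_radius_le k i : lim_radius i <= r k i.
Proof.
apply: limr_le; first exact: radius_cvg.
by exists k => // m /=; exact: orbit_radius_mono.
Qed.

Lemma lim_radius_ge0 i : 0 <= lim_radius i.
Proof. by apply: limr_ge; [exact: radius_cvg|near=> k; exact: ltW]. Unshelve. all: by end_near. Qed.

Lemma sum_loss k : \sum_i loss (d k) (X k) i = \sum_i r k i - \sum_i r k.+1 i.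
Proof. by rewrite -sumrB; apply: eq_bigr => i _; rewrite orbit_loss. Qed.

Lemma drift_le_total k i :
  enorm (drift (d k) (X k) i) <= 2 * (\sum_l r k l) - 2 * (\sum_l r k.+1 l).
Proof.
apply: le_trans (drift_le N (Xv k) (d_itv k) i) _; rewrite -mulrBr ler_pM2l // -sum_loss.
rewrite [leLHS]big_mkcond /=; apply: ler_sum => l _; case: ifP => // _.
exact: loss_ge0.
Qed.

Definition lim_center i : 'rV[R]_3 := \row_t lim ((fun k => p k i 0 t) @ \oo).

(** The path of a center has finite length, at most twice the sum of the initial radii. *)
Lemma center_cvg i : (fun k => enorm (p k i - lim_center i)) @ \oo --> (0 : R).
Proof.
have coord t : (fun k => p k i 0 t) @ \oo --> lim_center i 0 t.
  rewrite mxE; apply: (cvg_bounded_variation (b := fun k => 2 * (\sum_l r k l))) => k; last first.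
    by rewrite mulr_ge0 // sumr_ge0 // => l _; exact: ltW.
  apply: le_trans (drift_le_total k i); rewrite orbit_center mxE addrAC subrr add0r.
  exact: coord_le_enorm.
apply: (@squeeze_cvgr _ _ _ _ (fun=> 0) (fun k => \sum_t `|(p k i - lim_center i) 0 t|)).
- by near=> k; rewrite enorm_ge0 enorm_le_sum.
- exact: cvg_cst.
- have z : \sum_(t < 3) (`|lim_center i 0 t - lim_center i 0 t| : R) = 0.
    by rewrite big1 // => t _; rewrite subrr normr0.
  have c t : (fun k => `|(p k i - lim_center i) 0 t|) @ \oo -->
      (`|lim_center i 0 t - lim_center i 0 t| : R).
    have e k : (p k i - lim_center i) 0 t = p k i 0 t - lim_center i 0 t.
      by rewrite mxE [X in _ + X]mxE.
    under eq_fun do rewrite e.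
    by apply: cvg_norm; apply: cvgB; [exact: coord|exact: cvg_cst].
  have : (fun k => \sum_(t < 3) `|(p k i - lim_center i) 0 t|) @ \oo -->
      \sum_(t < 3) (`|lim_center i 0 t - lim_center i 0 t| : R).
    by apply: cvg_big => [|t _]; [exact: add_continuous|exact: c].
  by rewrite z.
Unshelve. all: by end_near. Qed.

Definition lim_ring i : ring_data R := (lim_center i, lim_radius i, normal (X 0 i)).

Lemma lim_ring_normal i : enorm (normal (lim_ring i)) = 1.
Proof. by have [] := Xv 0 i. Qed.

Lemma cdist_cvg (c : nat -> 'rV[R]_3) (q : 'rV[R]_3) j :
  (fun k => enorm (c k - q)) @ \oo --> (0 : R) ->
  (fun k => cdist (c k) (X k j)) @ \oo --> cdist q (lim_ring j).
Proof.
move=> cq.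
pose e k : R := 2 * (enorm (c k - q) + enorm (p k j - lim_center j)) + `|r k j - lim_radius j|.
have e0 : e @ \oo --> (0 : R).
  have -> : (0 : R) = 2 * (0 + 0) + `|lim_radius j - lim_radius j| :> R by rewrite subrr normr0; ring.
  apply: cvgD; first by apply: cvgM; [exact: cvg_cst|apply: cvgD => //; exact: center_cvg].
  by apply: cvg_norm; apply: cvgB; [exact: radius_cvg|exact: cvg_cst].
have dist k : `|cdist q (lim_ring j) - cdist (c k) (X k j)| <= e k.
  have nj : normal (X k j) = normal (lim_ring j) by exact: orbit_normal.
  have nj1 : enorm (normal (X k j)) = 1 by have [] := Xv k j.
  have h1 := @cdist_lip R (c k) q (X k j) (lim_ring j) nj1 (esym nj).
  have h2 := @cdist_lip R q (c k) (lim_ring j) (X k j) (lim_ring_normal j) nj.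
  have v1 : enorm (c k - p k j - (q - center (lim_ring j))) <=
      enorm (c k - q) + enorm (p k j - lim_center j).
    have -> : c k - p k j - (q - center (lim_ring j)) = (c k - q) + - (p k j - lim_center j).
      by apply/rowP => t; rewrite !mxE; ring.
    by apply: le_trans (enormD _ _) _; rewrite enormN.
  rewrite enormB distrC in h2; rewrite ler_norml /e; move: h1 h2.
  rewrite [radius (lim_ring j)]/radius /=.
  by move=> h1 h2; apply/andP; split; lra.
apply/cvgrPdist_lt => eps eps0; near=> k.
apply: le_lt_trans (dist k) _; apply: le_lt_trans (ler_norm _) _.
near: k; have /cvgrPdist_lt /(_ _ eps0) := e0.
by apply: filterS => k; rewrite sub0r normrN.
Unshelve. all: by end_near. Qed.

(* Both squared radii lose the same amount, so that [pow (X k i) q - pow (X k j) q] does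
   not change in the limit. *)
Lemma active_limit i j K : i != j ->
  (forall k, (K <= k)%N -> w k i = 1 /\ w k j = 1) ->
  forall q, ~ [/\ in_plane (lim_ring i) q, in_plane (lim_ring j) q,
     pow (lim_ring i) q = pow (lim_ring j) q & pow (lim_ring i) q <= 0].
Proof.
move=> ij act q [qi qj pq q0].
have [m still rads] : exists2 m : R,
    forall l, l = i \/ l = j -> lim_center l = p K l &
    forall l, l = i \/ l = j -> r K l ^+ 2 - lim_radius l ^+ 2 = m.
  have wl l k : (K <= k)%N -> l = i \/ l = j -> w k l = 1.
    by move=> Kk [|] ->; have [] := act k Kk.
  have still k l : (K <= k)%N -> l = i \/ l = j -> p k l = p K l.
    move=> Kk lij; elim: k Kk => [|k IH]; first by rewrite leqn0 => /eqP ->.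
    rewrite leq_eqVlt => /orP[/eqP <- //|]; rewrite ltnS => Kk.
    by rewrite orbit_center drift_active ?addr0 ?IH // wl.
  have rads k : (K <= k)%N -> r k i ^+ 2 - r k j ^+ 2 = r K i ^+ 2 - r K j ^+ 2.
    elim: k => [|k IH]; first by rewrite leqn0 => /eqP ->.
    rewrite leq_eqVlt => /orP[/eqP <- //|]; rewrite ltnS => Kk.
    rewrite !orbit_radius_sqr (wl i k) ?(wl j k) -?(IH Kk) //; [ring|by right|by left].
  exists (r K i ^+ 2 - lim_radius i ^+ 2).
    move=> l lij; apply/eqP; rewrite eq_sym -subr_eq0 -enorm_eq0; apply/eqP.
    apply/esym/(seq_lim_near_cst (K := K) _ (center_cvg l)) => k Kk.
    by rewrite (still k l Kk lij).
  have lim_sq l : (fun k => r k l ^+ 2) @ \oo --> lim_radius l ^+ 2.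
    by under eq_fun do rewrite expr2; rewrite expr2; apply: cvgM; exact: radius_cvg.
  move=> l [->//|->].
  have : lim_radius i ^+ 2 - lim_radius j ^+ 2 = r K i ^+ 2 - r K j ^+ 2; last lra.
  have lim_d : (fun k => r k i ^+ 2 - r k j ^+ 2) @ \oo --> lim_radius i ^+ 2 - lim_radius j ^+ 2.
    exact: cvgB (lim_sq i) (lim_sq j).
  by apply: (seq_lim_near_cst _ lim_d); exact: rads.
have [_ nh] := orbit_unlinked K; apply: (nh i j ij); exists q.
have powE l : l = i \/ l = j -> pow (X K l) q = pow (lim_ring l) q - m.
  by move=> lij; rewrite -(rads l lij) /pow [center (lim_ring l)]still // /lim_ring /radius /=; ring.
have planeE l : l = i \/ l = j -> in_plane (lim_ring l) q -> in_plane (X K l) q.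
  by move=> lij; rewrite /in_plane [center (lim_ring l)]still // orbit_normal.
have m0 : 0 <= m.
  rewrite -(rads i) ?subr_ge0; last by left.
  by rewrite ler_sqr ?nnegrE ?lim_radius_ge0 ?(ltW (r0 _ _)) // lim_radius_le.
rewrite !powE; [|by right|by left].
by split; [apply: planeE => //; left|apply: planeE => //; right|rewrite pq|lra].
Qed.
(** Otherwise the strides would be bounded below, while each of them is at most the mass that it
    removes. *)
Lemma radius_vanishes : exists i, lim_radius i = 0.
Proof.
apply: contrapT => /forallNP pos.
have rl i : 0 < lim_radius i by rewrite lt_def lim_radius_ge0 andbT; apply/eqP.
pose e : R := (16 * n.+1%:R)^-1 * \big[Num.min/1]_i lim_radius i ^+ 2.
have e0 : 0 < e.
  rewrite mulr_gt0 ?invr_gt0 ?mulr_gt0 ?ltr0n //.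
  by elim/big_rec: _ => // i y _ y0; rewrite lt_min y0 exprn_gt0.
have ed k : e <= d k.
  apply: ler_wpM2l; first by rewrite invr_ge0 mulr_ge0 ?ler0n.
  elim/big_rec2: _ => // i y z _ yz; rewrite le_min !ge_min yz orbT andbT.
  by rewrite ler_sqr ?nnegrE ?lim_radius_ge0 ?(ltW (r0 _ _)) // lim_radius_le.
have drain k : mass k + k%:R * e <= mass 0.
  elim: k => [|k IH]; first by rewrite mul0r addr0.
  by have := mass_step k; have := ed k; rewrite -natr1 mulrDl mul1r; lra.
have [M Mm] : exists M : nat, mass 0 / e < M%:R.
  exists (Num.bound (mass 0 / e)); apply: archi_boundP.
  by rewrite divr_ge0 ?mass_ge0 // ltW.
have := drain M; have := mass_ge0 M; move: Mm; rewrite ltr_pdivrMr //; lra.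
Qed.

Lemma contact_eventually i j : i != j ->
  cdist (lim_center i) (lim_ring j) < N * lim_radius i ->
  cdist (lim_center j) (lim_ring i) < N * lim_radius j ->
  \forall k \near \oo, contact N (X k i) (X k j) = 1.
Proof.
move=> ij ci cj; near=> k.
apply: contact1 => //.
  apply: le_trans (_ : N * lim_radius i <= _); last by rewrite ler_pM2l // lim_radius_le.
  by near: k; apply: cvgr_le ci; apply: cdist_cvg; exact: center_cvg.
apply: le_trans (_ : N * lim_radius j <= _); last by rewrite ler_pM2l // lim_radius_le.
by near: k; apply: cvgr_le cj; apply: cdist_cvg; exact: center_cvg.
Unshelve. all: by end_near. Qed.

(** With a common point, each center would be at [cdist] at most twice its radius from the other
    circle, so that the pair would finally be in contact 1, and the common point would contradict
    [active_limit]. *)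
Lemma limit_circles_disjoint i j q : i != j -> 0 < lim_radius i -> 0 < lim_radius j ->
  cdist q (lim_ring i) = 0 -> cdist q (lim_ring j) = 0 -> False.
Proof.
move=> ij ri rj qi qj.
have close (k l : 'I_n) : cdist q (lim_ring k) = 0 -> cdist q (lim_ring l) = 0 -> 0 < lim_radius k ->
    cdist (lim_center k) (lim_ring l) < N * lim_radius k.
  move=> qk ql rk; have := N_ge10.
  have := @cdist_lip R (lim_center k) q (lim_ring l) (lim_ring l) (lim_ring_normal l) erefl.
  rewrite ql subrr normr0 addr0 add0r.
  have -> : lim_center k - center (lim_ring l) - (q - center (lim_ring l)) = - (q - lim_center k).
    by apply/rowP => t; rewrite !mxE; ring.
  have := dist_le_cdist q (lim_ring k); rewrite qk add0r enormN.
  rewrite [radius _]/radius [center _]/center /= => h1 h2 N10.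
  have : 10 * lim_radius k <= N * lim_radius k by rewrite ler_pM2r.
  lra.
have [K _ HK] := contact_eventually ij (close _ _ qi qj ri) (close _ _ qj qi rj).
apply: (@active_limit i j K ij _ q) => [k Kk|].
  by apply: contact1_activity (HK k Kk); rewrite eq_sym.
have [pi ai] := cdist0P (ltW ri : 0 <= radius (lim_ring i)) qi.
have [pj aj] := cdist0P (ltW rj : 0 <= radius (lim_ring j)) qj.
by split=> //; rewrite ?pi ?pj.
Qed.

Lemma mass_cvg : exists2 ml, mass @ \oo --> ml & forall k, ml <= mass k.
Proof.
have dec k : mass k.+1 <= mass k by have := mass_step k; have := d0 k; lra.
have mc : cvg (mass @ \oo).
  apply: nonincreasing_is_cvgn; first exact/nonincreasing_seqP.
  by exists 0 => _ [k _ <-]; exact: mass_ge0.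
exists (lim (mass @ \oo)) => // k; apply: limr_le => //.
exists k => // m /= km; elim: m km => [|m IH]; first by rewrite leqn0 => /eqP ->.
rewrite leq_eqVlt => /orP[/eqP -> //|]; rewrite ltnS => /IH; exact: le_trans (dec m).
Qed.

(** * Rings that vanish at a common point *)

Section Cluster.
Variable i0 : 'I_n.
Hypothesis i0_vanishes : lim_radius i0 = 0.

Definition in_cluster i := (lim_radius i == 0) && (lim_center i == lim_center i0).
Definition persists i := lim_radius i != 0.

Lemma cluster_radius i : in_cluster i -> (fun k => r k i) @ \oo --> (0 : R).
Proof. by move=> /andP[/eqP <- _]; exact: radius_cvg. Qed.

(** [t] measures how far the cluster is from having closed up. The activity terms telescope to
    squared radii, the losses to radii, and the terms [d k * r k l] are bounded by the decrease of
    [(mass k - ml) * r k l]; so [gronwall_tail] applies with the mass as clock. At late times the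
    three terms of [b] are at most (1/2 + 1/2 + 2) [r k l], whence the constant 2 * 2 n * 3 = 12
    n. *)
Lemma tail_estimate (t : nat -> 'I_n -> R) (f C : R) : 0 <= f -> 0 <= C ->
  (forall k i, 0 <= t k i) -> (forall i, in_cluster i -> t ^~ i @ \oo --> (0 : R)) ->
  (\forall k \near \oo, forall i, in_cluster i -> t k i <= t k.+1 i + C * d k * t k i +
     2 * \sum_(l | in_cluster l) (f * (w k l * d k) + f * d k * (t k l + r k l) +
                                  2 * loss (d k) (X k) l)) ->
  \forall k \near \oo, forall i, in_cluster i ->
     t k i <= 12 * n%:R * \sum_(l | in_cluster l) r k l.
Proof.
move=> f0 C0 t0 t_lim step; have [ml m_lim ml_le] := mass_cvg.
pose a k : R := \sum_(i | in_cluster i) t k i.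
pose b k : R := 2 * n%:R *
  \sum_(l | in_cluster l) (f * r k l ^+ 2 + f * ((mass k - ml) * r k l) + 2 * r k l).
pose c := C + 2 * n%:R * f.
have c0 : 0 <= c by rewrite addr_ge0 // !mulr_ge0.
have a0 k : 0 <= a k by exact: sumr_ge0.
have a_lim : a @ \oo --> (0 : R).
  rewrite (_ : 0 = \sum_(i | in_cluster i) (0 : R)); last by rewrite big1.
  by apply: cvg_big => //; exact: add_continuous.
have dm k : d k <= mass k - mass k.+1 by exact: mass_step.
have dec k : mass k.+1 <= mass k by have := dm k; have := d0 k; lra.
have small : \forall k \near \oo, c * (mass k - ml) <= 1 / 2 /\ f * (mass k - ml) <= 1 / 2.
  have lim0 (e : R) : (fun k => e * (mass k - ml)) @ \oo --> (0 : R).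
    rewrite -(mulr0 e) -(subrr ml).
    by apply: cvgM; [exact: cvg_cst|apply: cvgB; [exact: m_lim|exact: cvg_cst]].
  have h2 : (0 : R) < 1 / 2 by lra.
  near=> k; split; near: k; exact: cvgr_le (lim0 _) _ h2.
have small_r : \forall k \near \oo, forall l, in_cluster l -> f * r k l <= 1 / 2.
  apply: near_finite_forall => l; case cl: (in_cluster l); last by near=> k.
  have lim0 : (fun k => f * r k l) @ \oo --> (0 : R).
    rewrite -(mulr0 f); apply: cvgM; [exact: cvg_cst|exact: cluster_radius].
  have h2 : (0 : R) < 1 / 2 by lra.
  by near=> k => _; near: k; exact: cvgr_le lim0 _ h2.
have [K1 _ HK1] := step; have [K2 _ HK2] := small; have [K3 _ HK3] := small_r.
pose K := maxn K1 (maxn K2 K3).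
have b_step k : [/\ 0 <= b k.+1, b k.+1 <= b k &
    2 * n%:R * (\sum_(l | in_cluster l) (f * (w k l * d k) + f * d k * r k l +
       2 * loss (d k) (X k) l)) <= b k - b k.+1].
  have n2 : 0 <= 2 * n%:R :> R by rewrite mulr_ge0.
  have term l : [/\ 0 <= f * r k.+1 l ^+ 2 + f * ((mass k.+1 - ml) * r k.+1 l) + 2 * r k.+1 l,
      0 <= f * (w k l * d k) + f * d k * r k l + 2 * loss (d k) (X k) l &
      f * (w k l * d k) + f * d k * r k l + 2 * loss (d k) (X k) l <=
      (f * r k l ^+ 2 + f * ((mass k - ml) * r k l) + 2 * r k l) -
      (f * r k.+1 l ^+ 2 + f * ((mass k.+1 - ml) * r k.+1 l) + 2 * r k.+1 l)].
    have r1 := ltW (r0 k.+1 l); have rr := orbit_radius_le k l; have rk := ltW (r0 k l).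
    have m1 : 0 <= mass k.+1 - ml by rewrite subr_ge0.
    have h1 : 0 <= f * (w k l * d k) by rewrite mulr_ge0 // mulr_ge0 ?w0 ?(ltW (d0 k)).
    have h2 : 0 <= f * d k * r k l by rewrite mulr_ge0 // mulr_ge0 ?(ltW (d0 k)).
    have h3 : 0 <= f * r k.+1 l ^+ 2 by rewrite mulr_ge0 ?sqr_ge0.
    have h4 : 0 <= f * ((mass k.+1 - ml) * r k.+1 l) by rewrite mulr_ge0 // mulr_ge0.
    rewrite orbit_loss; split; [lra|lra|].
    rewrite orbit_radius_sqr.
    have h5 : f * d k * r k l <= f * ((mass k - ml) * r k l) - f * ((mass k.+1 - ml) * r k.+1 l).
      rewrite -mulrBr -mulrA ler_wpM2l //.
      have h6 : d k * r k l <= (mass k - mass k.+1) * r k l by rewrite ler_wpM2r.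
      have h7 : (mass k.+1 - ml) * r k.+1 l <= (mass k.+1 - ml) * r k l by rewrite ler_wpM2l.
      lra.
    lra.
  split.
  - by rewrite mulr_ge0 // sumr_ge0 // => l _; have [] := term l.
  - rewrite ler_wpM2l // ler_sum // => l _; have [h1 h2 h3] := term l; lra.
  - rewrite /b -mulrBr -sumrB ler_wpM2l // ler_sum // => l _; by have [] := term l.
have tail : forall k, (K <= k)%N -> a k <= 2 * b k.
  apply: (@gronwall_tail R a b mass c ml K) => // k; rewrite !geq_max => /and3P[k1 k2 k3].
    have [b1 b2 _] := b_step k; have [h _] := HK2 k k2.
    by split=> //; rewrite ?b1 ?b2 ?ml_le ?dec.
  have [_ _ b3] := b_step k.
  have sum_step := HK1 k k1.
  pose G : R := \sum_(l | in_cluster l) (f * (w k l * d k) + f * d k * (t k l + r k l) +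
                                  2 * loss (d k) (X k) l).
  have G0 : 0 <= G.
    apply: sumr_ge0 => l _; have dk := ltW (d0 k).
    have g1 : 0 <= f * (w k l * d k) by rewrite mulr_ge0 // mulr_ge0 ?w0.
    have g2 : 0 <= f * d k * (t k l + r k l).
      by rewrite mulr_ge0 ?(mulr_ge0 f0) // addr_ge0 ?t0 // ltW.
    have := loss_ge0 N (Xv k) (d_itv k) l; lra.
  have h1 : a k <= a k.+1 + C * d k * a k + n%:R * (2 * G).
    apply: le_trans (_ : \sum_(i | in_cluster i) (t k.+1 i + C * d k * t k i + 2 * G) <= _).
      exact: ler_sum.
    rewrite !big_split /= -mulr_sumr -/(a k) -/(a k.+1) lerD2l.
    by apply: sum_const_le => //; rewrite mulr_ge0.
  have GE : G = f * d k * a k + \sum_(l | in_cluster l) (f * (w k l * d k) + f * d k * r k l +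
       2 * loss (d k) (X k) l).
    by rewrite /a mulr_sumr -big_split /=; apply: eq_bigr => l _; ring.
  have h2 : c * d k * a k <= c * (mass k - mass k.+1) * a k.
    by rewrite ler_wpM2r // ler_wpM2l.
  move: h1 h2 b3; rewrite GE /c; move: (\sum_(l | in_cluster l) _) (b k) (b k.+1) => s x y.
  lra.
exists K => // k /= Kk i ci; have kk := Kk; move: kk; rewrite !geq_max => /and3P[k1 k2 k3].
apply: le_trans (_ : a k <= _).
  by rewrite /a (bigD1 i) //= lerDl; apply: sumr_ge0.
apply: le_trans (tail k Kk) _; rewrite /b.
have [_ h2] := HK2 k k2.
have h : \sum_(l | in_cluster l) (f * r k l ^+ 2 + f * ((mass k - ml) * r k l) + 2 * r k l) <=
    \sum_(l | in_cluster l) 3 * r k l.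
  apply: ler_sum => l cl; have rl := ltW (r0 k l).
  have h3 := ler_wpM2r rl (HK3 k k3 l cl); have h4 := ler_wpM2r rl h2.
  lra.
rewrite -mulr_sumr in h.
have n4 : 0 <= 4 * n%:R :> R by rewrite mulr_ge0.
have := ler_wpM2l n4 h; lra.
Unshelve. all: by end_near. Qed.

Lemma cluster_center i : in_cluster i ->
  (fun k => enorm (p k i - lim_center i0)) @ \oo --> (0 : R).
Proof. by move=> /andP[_ /eqP <-]; exact: center_cvg. Qed.

Lemma cluster_not_persists i : in_cluster i -> ~~ persists i.
Proof. by move=> /andP[z _]; rewrite /persists z. Qed.

Lemma i0_in_cluster : in_cluster i0.
Proof. by rewrite /in_cluster i0_vanishes !eqxx. Qed.

Lemma outside_far (Q : pred 'I_n) :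
  (forall l, Q l -> 0 < cdist (lim_center i0) (lim_ring l)) ->
  exists2 c, 0 < c & \forall k \near \oo, forall i l, in_cluster i -> Q l ->
    c <= cdist (p k i) (X k l).
Proof.
move=> pos; pose c : R := \big[Num.min/1]_(l | Q l) (cdist (lim_center i0) (lim_ring l) / 2).
have c0 : 0 < c.
  rewrite /c; elim/big_rec: _ => // l y Ql y0; rewrite lt_min y0 andbT divr_gt0 //.
  exact: pos.
exists c => //; apply: near_finite_forall => i; apply: near_finite_forall => l.
case ci: (in_cluster i); last by near=> k.
case Ql: (Q l); last by near=> k.
have lt : c < cdist (lim_center i0) (lim_ring l).
  apply: le_lt_trans (_ : cdist (lim_center i0) (lim_ring l) / 2 < _).
    by rewrite /c (bigD1 l) //= ge_min lexx.
  by have := pos l Ql; lra.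
near=> k => _ _; near: k; apply: cvgr_ge lt.
by apply: cdist_cvg; exact: cluster_center.
Unshelve. all: by end_near. Qed.

(** A vanishing ring outside the cluster has another limit center, and finally a radius too small
    for reaching the cluster with its pull. *)
Lemma follows_late : exists a b, [/\ 0 < a, 0 < b &
  \forall k \near \oo, follows a b (X k) in_cluster persists].
Proof.
pose a : R := \big[Num.min/1]_(j | persists j) lim_radius j.
have a0 : 0 < a.
  rewrite /a; elim/big_rec: _ => // j y pj y0; rewrite lt_min y0 andbT lt_def lim_radius_ge0.
  by rewrite andbT.
pose b : R := 3 + \sum_i \sum_l enorm (lim_center i - lim_center l) + \sum_i r 0 i.
have S1 : 0 <= \sum_i r 0 i by apply: sumr_ge0 => i _; exact: ltW.
have S2 : 0 <= \sum_i \sum_l enorm (lim_center i - lim_center l).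
  by apply: sumr_ge0 => i _; apply: sumr_ge0 => l _; exact: enorm_ge0.
exists a, b; split=> //; first by rewrite /b; lra.
have near1 : \forall k \near \oo, forall i, enorm (p k i - lim_center i) <= 1.
  by apply: near_finite_forall => i; exact: cvgr_le (center_cvg i) _ ltr01.
have near2 : \forall k \near \oo, forall i l, in_cluster i -> ~~ in_cluster l -> ~~ persists l ->
    ~~ (0 < pull (X k) i l).
  apply: near_finite_forall => i; apply: near_finite_forall => l.
  case ci: (in_cluster i); last by near=> k.
  case cl: (in_cluster l); first by near=> k.
  case pl: (persists l); first by near=> k.
  move: pl => /negbFE/eqP rl0.
  have D0 : 0 < enorm (lim_center i0 - lim_center l).
    rewrite lt_def enorm_ge0 andbT enorm_eq0 subr_eq0 eq_sym.
    by move: cl; rewrite /in_cluster rl0 eqxx /= => ->.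
  have D4 : 0 < enorm (lim_center i0 - lim_center l) / 8 by lra.
  have rl : (fun k => r k l) @ \oo --> (0 : R) by rewrite -rl0; exact: radius_cvg.
  near=> k => _ _ _; apply/negP => /(pull_dist (Xv k)) h.
  have h1 : r k l <= enorm (lim_center i0 - lim_center l) / 8.
    by near: k; exact: cvgr_le rl _ D4.
  have h2 : enorm (p k i - lim_center i0) <= enorm (lim_center i0 - lim_center l) / 8.
    by near: k; exact: cvgr_le (cluster_center ci) _ D4.
  have h3 : enorm (p k l - lim_center l) <= enorm (lim_center i0 - lim_center l) / 8.
    by near: k; exact: cvgr_le (center_cvg l) _ D4.
  have h4 := enorm_triangle (lim_center i0) (p k i) (lim_center l).
  have h5 := enorm_triangle (p k i) (p k l) (lim_center l).
  rewrite (enormB _ (p k i)) in h4; lra.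
near=> k.
have n1 : forall i, enorm (p k i - lim_center i) <= 1 by near: k.
have n2 : forall i l, in_cluster i -> ~~ in_cluster l -> ~~ persists l ->
    ~~ (0 < pull (X k) i l) by near: k.
split.
- exact: cluster_not_persists.
- move=> i l ci pil; case cl: (in_cluster l) => //=; case pl: (persists l) => //.
  by have := n2 i l ci; rewrite cl pl => /(_ isT isT)/negP.
- move=> j pj; apply: le_trans (lim_radius_le k j).
  by rewrite /a (bigD1 j) //= ge_min lexx.
- move=> j; apply: le_trans (orbit_radius_mono j (leq0n k)) _.
  rewrite /b [X in _ + X](bigD1 j) //=; have : 0 <= \sum_(i | i != j) r 0 i.
    by apply: sumr_ge0 => i _; exact: ltW.
  by have := S2; lra.
- move=> i l; have h1 := enorm_triangle (p k i) (lim_center i) (p k l).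
  have h2 := enorm_triangle (lim_center i) (lim_center l) (p k l).
  have h3 := n1 i; have h4 := n1 l; rewrite (enormB (lim_center l) (p k l)) in h2.
  have h5 : enorm (lim_center i - lim_center l) <=
      \sum_i \sum_l enorm (lim_center i - lim_center l).
    rewrite (bigD1 i) //= (bigD1 l) //= -addrA lerDl addr_ge0 //.
      by apply: sumr_ge0 => m _; exact: enorm_ge0.
    by apply: sumr_ge0 => m _; apply: sumr_ge0 => m' _; exact: enorm_ge0.
  by rewrite /b; lra.
Unshelve. all: by end_near. Qed.

(* The largest ring of the cluster ends up in contact 1 with ring j. *)
Lemma attached_absurd j : persists j -> cdist (lim_center i0) (lim_ring j) = 0 -> False.
Proof.
move=> pj Pj; have rj : 0 < lim_radius j by rewrite lt_def lim_radius_ge0 andbT.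
have [c c0 far] : exists2 c, 0 < c & \forall k \near \oo, forall i l, in_cluster i ->
    persists l && (l != j) -> c <= cdist (p k i) (X k l).
  apply: outside_far => l /andP[pl lj]; rewrite lt_def cdist_ge0 andbT.
  apply/eqP => Pl; apply: (limit_circles_disjoint lj _ rj Pl Pj).
  by rewrite lt_def lim_radius_ge0 andbT.
have [a [b [a0 b0 fol]]] := follows_late.
pose f := @follow_const R n a b c.
have f0 : 0 <= f by case: (@follow_constP R n a b c a0 b0 c0).
have tail : \forall k \near \oo, forall i, in_cluster i ->
    cdist (p k i) (X k j) <= 12 * n%:R * \sum_(l | in_cluster l) r k l.
  apply: (@tail_estimate (fun k i => cdist (p k i) (X k j)) f (a ^- 2)) => //.
  - by rewrite invr_ge0 exprn_ge0 // ltW.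
  - by move=> k i; exact: cdist_ge0.
  - by move=> i ci; rewrite -Pj; apply: cdist_cvg; exact: cluster_center.
  near=> k => i ci; have fk : follows a b (X k) in_cluster persists by near: k.
  have [_ _ /(_ j pj) ja _ _] := fk.
  have fark : forall i l, in_cluster i -> persists l && (l != j) -> c <= cdist (p k i) (X k l).
    by near: k.
  have h := @cdist_evolve R n N a a0 (X k) (d k) i j (Xv k) (d_itv k) ja.
  rewrite -X_step in h.
  have h2 := @drift_follow R n N a b c a0 b0 c0 (X k) (d k) in_cluster persists j (Xv k)
    (d_itv k) fk pj (fun i l ci pl lj => fark i l ci (introT andP (conj pl lj))) i ci.
  by apply: le_trans h _; rewrite lerD2l ler_pM2l.
have small : \forall k \near \oo, forall l, in_cluster l ->
    r k l <= lim_radius j /\ cdist (p k l) (X k j) <= lim_radius j.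
  apply: near_finite_forall => l; case cl: (in_cluster l); last by near=> k.
  near=> k => _; split; near: k.
    exact: cvgr_le (cluster_radius cl) _ rj.
  apply: cvgr_le rj; rewrite -Pj; apply: cdist_cvg; exact: cluster_center.
have [K1 _ HK1] := tail; have [K2 _ HK2] := small; pose K := maxn K1 K2.
have n1 : 1 <= n.+1%:R :> R by rewrite ler1n.
have nn : n%:R <= n.+1%:R :> R by rewrite ler_nat.
(* A ring of nearly maximal size is at distance at most 24 n^2 times its radius from the circle of
   j, and 24 n^2 is at most [N]. In the other direction j is the larger ring. *)
have touch k l : (K <= k)%N -> in_cluster l ->
    (forall m : 'I_n, in_cluster m -> r k m ^+ 2 <= 2 * r k l ^+ 2) ->
    contact N (X k l) (X k j) = 1.
  rewrite geq_max => /andP[k1 k2] cl big_l.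
  have [rl cdl] := HK2 k k2 l cl; have rl0 := r0 k l; have rjk := lim_radius_le k j.
  have nl : enorm (normal (X k l)) = 1 by have [] := Xv k l.
  apply: contact1 => //.
    have le2 (m : 'I_n) : in_cluster m -> r k m <= 2 * r k l.
      move=> cm; have := big_l m cm; have rm := r0 k m => h.
      by rewrite leNgt; apply/negP => lt; nra.
    have hs : \sum_(m : 'I_n | in_cluster m) r k m <= n%:R * (2 * r k l).
      by apply: sum_const_le => //; rewrite mulr_ge0 // ltW.
    apply: le_trans (HK1 k k1 l cl) _.
    have h12 : 12 * n%:R * \sum_(m : 'I_n | in_cluster m) r k m <= 12 * n%:R * (n%:R * (2 * r k l)).
      by rewrite ler_wpM2l // mulr_ge0.
    apply: le_trans h12 _; rewrite !mulrA ler_pM2r //.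
    apply: le_trans N_large; move: (n%:R : R) (n.+1%:R : R) nn n1 (ler0n R n) => s t st t1 s0.
    have : s * s <= t * t by apply: ler_pM.
    have tt0 : 0 <= t * t by apply: mulr_ge0; lra.
    have : t * t <= t * t * t by rewrite ler_peMr.
    by rewrite !exprS expr0; lra.
  have h1 := cdist_le (p k j) nl (ltW rl0).
  have h2 := dist_le_cdist (p k l) (X k j); rewrite enormB in h1.
  have h3 : 10 * r k j <= N * r k j by rewrite ler_pM2r // N_ge10.
  lra.
have lj l : in_cluster l -> j != l.
  by move=> /cluster_not_persists; apply: contraNneq => <-.
have [i ci imax] : exists2 i, in_cluster i & forall l, in_cluster l -> r K l ^+ 2 <= r K i ^+ 2.
  by case: (arg_maxP (fun l => r K l ^+ 2) i0_in_cluster) => i ci imax; exists i.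
have persist := @argmax_persists R 'I_n (fun k l => r k l ^+ 2) (fun k l => w k l)
  (fun k => d k) in_cluster K i.
have {}persist : forall k, (K <= k)%N ->
    (forall l, in_cluster l -> r k l ^+ 2 <= r k i ^+ 2) /\ w k i = 1.
  apply: persist => // [k l Kk cl|k l Kk cl big_l].
    by split; [exact: orbit_radius_sqr|exact: w0|exact: ltW|exact: stride_le_quarter].
  have h := touch k l Kk cl big_l.
  by have [] := contact1_activity (lj l cl) h.
(* The limit of ring i is a point of the limit circle of j, where both powers vanish. *)
apply: (@active_limit i j K _ _ (lim_center i0)) => [|k Kk|].
- by rewrite eq_sym lj.
- have [imax' _] := persist k Kk.
  apply: contact1_activity (lj i ci) _; apply: touch => // m cm.
  by have := imax' m cm; have := sqr_ge0 (r k i); lra.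
- have [pj0 aj] := cdist0P (ltW rj : 0 <= radius (lim_ring j)) Pj.
  case/andP: ci => /eqP ri0 /eqP ci0.
  have pi0 : pow (lim_ring i) (lim_center i0) = 0.
    by rewrite /pow /lim_ring /center /radius /= ci0 ri0 subrr dot0l expr0n subrr.
  split=> //; rewrite ?pi0 ?pj0 //.
  by rewrite /in_plane /lim_ring /center /= ci0 subrr dot0l.
Unshelve. all: by end_near. Qed.

(* The rings of the cluster are only in contact with each other, so that no squared radius
   exceeds the sum of the others: the two largest rings, being of comparable sizes, end up
   in contact 1. *)
Lemma detached_absurd :
  (forall j, persists j -> 0 < cdist (lim_center i0) (lim_ring j)) -> False.
Proof.
move=> away.
have [c c0 far] : exists2 c : R, 0 < c & \forall k \near \oo, forall i l, in_cluster i ->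
    ~~ in_cluster l -> c <= cdist (p k i) (X k l).
  apply: (outside_far (Q := fun l => ~~ in_cluster l)) => l ncl.
  case pl: (persists l); first exact: away.
  move: pl => /negbFE rl0; rewrite ltr_wpDr // normr_gt0 [radius _]/radius /= (eqP rl0) subr0.
  rewrite enorm_eq0 subr_eq0 eq_sym; move: ncl; rewrite /in_cluster rl0 //=.
have [a [b [a0 b0 fol]]] := follows_late.
pose f := @follow_const R n a b c.
have f0 : 0 <= f by case: (@follow_constP R n a b c a0 b0 c0).
have small : \forall k \near \oo, forall l, in_cluster l -> 2 * N * r k l <= c.
  apply: near_finite_forall => l; case cl: (in_cluster l); last by near=> k.
  have h : (fun k => 2 * N * r k l) @ \oo --> (0 : R).
    by rewrite -(mulr0 (2 * N)); apply: cvgM; [exact: cvg_cst|exact: cluster_radius].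
  by near=> k => _; near: k; exact: cvgr_le h _ c0.
have N10 := N_ge10.
have tail : \forall k \near \oo, forall i, in_cluster i ->
    enorm (p k i - p k i0) <= 12 * n%:R * \sum_(l | in_cluster l) r k l.
  apply: (@tail_estimate (fun k i => enorm (p k i - p k i0)) f 0) => //.
  - by move=> k i; exact: enorm_ge0.
  - move=> i ci; apply: (@squeeze_cvgr _ \oo _ _ (fun=> 0)
      (fun k => enorm (p k i - lim_center i0) + enorm (p k i0 - lim_center i0))).
    + apply: nearW => k /=; rewrite enorm_ge0 /=.
      have := enorm_triangle (p k i) (lim_center i0) (p k i0).
      by rewrite (enormB (lim_center i0) (p k i0)).
    + exact: cvg_cst.
    + rewrite -(addr0 (0 : R)); apply: cvgD; apply: cluster_center => //; exact: i0_in_cluster.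
  near=> k => i ci; have fk : follows a b (X k) in_cluster persists by near: k.
  have fark : forall i l, in_cluster i -> ~~ in_cluster l -> c <= cdist (p k i) (X k l).
    by near: k.
  have smallk : forall l, in_cluster l -> r k l <= c.
    have h : forall l, in_cluster l -> 2 * N * r k l <= c by near: k.
    move=> l cl; apply: le_trans (h l cl); rewrite ler_peMl ?(ltW (r0 _ _)) //; lra.
  have far_persist i' l : in_cluster i' -> persists l -> c <= cdist (p k i') (X k l).
    by move=> ci' pl; apply: fark => //; apply: contraL pl; exact: cluster_not_persists.
  have h := @drift_together R n N a b c a0 b0 c0 (X k) (d k) in_cluster persists i0 (Xv k)
    (d_itv k) fk i0_in_cluster far_persist smallk i ci.
  have e : p k i - p k i0 = (p k.+1 i - p k.+1 i0) +
      - (drift (d k) (X k) i - drift (d k) (X k) i0).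
    by rewrite !orbit_center; apply/rowP => t; rewrite !mxE; ring.
  rewrite e; apply: le_trans (enormD _ _) _; rewrite enormN -e mul0r mul0r addr0 lerD2l.
  apply: le_trans h _; rewrite ler_pM2l // ler_sum // => l cl.
  rewrite lerD2r lerD2l; apply: ler_wpM2l; first by rewrite mulr_ge0 // ltW.
  by rewrite lerDl ltW.
have [K1 _ HK1] := tail; have [K2 _ HK2] := small; have [K3 _ HK3] := far.
pose K := maxn K1 (maxn K2 K3).
have n1 : 1 <= n.+1%:R :> R by rewrite ler1n.
have nn : n%:R <= n.+1%:R :> R by rewrite ler_nat.
have no_contact k i l : (K <= k)%N -> in_cluster i -> ~~ in_cluster l ->
    contact N (X k i) (X k l) = 0.
  rewrite !geq_max => /and3P[_ k2 k3] ci cl; apply/eqP; rewrite eq_le.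
  have /andP[-> _] := contact_itv N (X k i) (X k l); rewrite andbT leNgt; apply/negP.
  move=> /(contact_gt0 N0 (r0 k i) (r0 k l))[h _].
  by have := le_lt_trans (HK3 k k3 i l ci cl) h; rewrite ltNge HK2.
(* Two rings comparable to the largest one are in contact 1. The bound 96 n^2 (n + 1) + 2 (n + 1)
   needed here is the reason for the cube in [N_large]. *)
have touch k i l : (K <= k)%N -> i != l -> in_cluster i -> in_cluster l ->
    (forall m : 'I_n, in_cluster m -> r k m <= 2 * n.+1%:R * r k i) ->
    (forall m : 'I_n, in_cluster m -> r k m <= 2 * n.+1%:R * r k l) ->
    contact N (X k i) (X k l) = 1.
  rewrite !geq_max => /and3P[k1 k2 k3].
  suff H i' l' : in_cluster i' -> in_cluster l' ->
      (forall m : 'I_n, in_cluster m -> r k m <= 2 * n.+1%:R * r k i') ->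
      cdist (p k i') (X k l') <= N * r k i'.
    by move=> il ci cl bi bl; apply: contact1 => //; exact: H.
  move=> ci cl big_i; have nl : enorm (normal (X k l')) = 1 by have [] := Xv k l'.
  apply: le_trans (cdist_le (p k i') nl (ltW (r0 k l'))) _.
  have h1 := HK1 k k1 i' ci; have h2 := HK1 k k1 l' cl.
  have h3 := enorm_triangle (p k i') (p k i0) (p k l'); rewrite (enormB (p k i0) (p k l')) in h3.
  have hs : \sum_(m : 'I_n | in_cluster m) r k m <= n%:R * (2 * n.+1%:R * r k i').
    by apply: sum_const_le => //; rewrite !mulr_ge0 // ltW.
  have h12 : 12 * n%:R * \sum_(m : 'I_n | in_cluster m) r k m <=
      12 * n%:R * (n%:R * (2 * n.+1%:R * r k i')).
    by rewrite ler_wpM2l // mulr_ge0.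
  have h4 := big_i l' cl.
  apply: (@le_trans _ _ ((2 * (2 * (12 * n%:R * (n%:R * (2 * n.+1%:R)))) + 2 * n.+1%:R) * r k i')).
    lra.
  rewrite ler_pM2r //; apply: le_trans N_large.
  move: (n%:R : R) (n.+1%:R : R) nn n1 (ler0n R n) => s t st t1 s0.
  have tt0 : 0 <= t * t by apply: mulr_ge0; lra.
  have e1 : t * t <= t * t * t by rewrite ler_peMr.
  have e2 : t <= t * t by rewrite ler_peMr //; lra.
  have e3 : s * s <= t * t by apply: ler_pM.
  have e4 : s * s * t <= t * t * t by rewrite ler_wpM2r //; lra.
  by rewrite !exprS expr0; lra.
(* Contacts are symmetric and stay inside the cluster, so that the activity of i is at most the sum
   of the other activities. The difference [g] of the two sides is therefore nondecreasing, and it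
   tends to 0. *)
have rivals k i : (K <= k)%N -> in_cluster i ->
    r k i ^+ 2 <= \sum_(l | in_cluster l && (l != i)) r k l ^+ 2.
  move=> Kk ci.
  pose g m : R := r m i ^+ 2 - \sum_(l | in_cluster l && (l != i)) r m l ^+ 2.
  have g_le m : (k <= m)%N -> g k <= g m.
    elim: m => [|m IH]; first by rewrite leqn0 => /eqP ->.
    rewrite leq_eqVlt => /orP[/eqP -> //|]; rewrite ltnS => km; apply: le_trans (IH km) _.
    rewrite /g orbit_radius_sqr.
    have -> : \sum_(l | in_cluster l && (l != i)) r m.+1 l ^+ 2 =
        \sum_(l | in_cluster l && (l != i)) r m l ^+ 2 -
        (\sum_(l | in_cluster l && (l != i)) w m l) * d m.
      by rewrite mulr_suml -sumrB; apply: eq_bigr => l _; rewrite orbit_radius_sqr.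
    have w_le : w m i <= \sum_(l | in_cluster l && (l != i)) w m l.
      apply: bigmax_le_of => [|l li]; first exact: sumr_ge0.
      have Km := leq_trans Kk km.
      case cl: (in_cluster l); last by rewrite no_contact ?cl // sumr_ge0.
      rewrite (bigD1 l) /= ?cl // contact_sym.
      apply: le_trans (contact_le_activity N (X m) _) _; first by rewrite eq_sym.
      by rewrite lerDl sumr_ge0.
    by have := ler_wpM2r (ltW (d0 m)) w_le; lra.
  have sq_lim l : in_cluster l -> (fun m => r m l ^+ 2) @ \oo --> (0 : R).
    move=> cl; under eq_fun do rewrite expr2; rewrite -(mulr0 (0 : R)).
    by apply: cvgM; exact: cluster_radius.
  have g_lim : g @ \oo --> (0 : R).
    have sum_lim : (fun m => \sum_(l | in_cluster l && (l != i)) r m l ^+ 2) @ \oo -->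
        \sum_(l | in_cluster l && (l != i)) (0 : R).
      by apply: cvg_big => [|l /andP[cl _]]; [exact: add_continuous|exact: sq_lim].
    rewrite big1 // in sum_lim; rewrite -(subr0 (0 : R)).
    by apply: cvgB; [exact: sq_lim|exact: sum_lim].
  rewrite -subr_le0 -/(g k) -(cvg_lim (@Rhausdorff R) g_lim).
  by apply: limr_ge; [exact: cvgP g_lim|exists k => // m /=; exact: g_le].
have ler_scale k l (m : 'I_n) : r k m ^+ 2 <= (2 * n.+1%:R) ^+ 2 * r k l ^+ 2 ->
    r k m <= 2 * n.+1%:R * r k l.
  by rewrite -exprMn ler_sqr // nnegrE ?mulr_ge0 // ltW.
have t2 : 2 <= (2 * n.+1%:R) ^+ 2 :> R.
  by apply: le_trans (_ : 2 * 1 <= _); [lra|rewrite exprS expr1; nra].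
have tt : 2 * n.+1%:R <= (2 * n.+1%:R) ^+ 2 :> R by rewrite exprS expr1; nra.
have scale2 k l (m : 'I_n) : r k m ^+ 2 <= 2 * r k l ^+ 2 -> r k m <= 2 * n.+1%:R * r k l.
  move=> h; apply: ler_scale; apply: le_trans h _; rewrite ler_wpM2r ?sqr_ge0 //.
have scale_n k l (m : 'I_n) : r k m ^+ 2 <= 2 * n.+1%:R * r k l ^+ 2 -> r k m <= 2 * n.+1%:R * r k l.
  move=> h; apply: ler_scale; apply: le_trans h _; rewrite ler_wpM2r ?sqr_ge0 //.
(* Otherwise the squares of the others would sum to at most n / (n + 1) of that of l, against
   [rivals]. *)
have partner k l : (K <= k)%N -> in_cluster l ->
    exists2 l' : 'I_n, in_cluster l' && (l' != l) & r k l ^+ 2 <= n.+1%:R * r k l' ^+ 2.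
  move=> Kk cl; apply: contrapT => no.
  have le1 : \sum_(l' | in_cluster l' && (l' != l)) r k l' ^+ 2 <= n%:R * (r k l ^+ 2 / n.+1%:R).
    apply: sum_const_le => [|l' cl']; first by rewrite divr_ge0 ?sqr_ge0.
    rewrite ler_pdivlMr ?ltr0n // leNgt; apply/negP => /ltW lt; apply: no.
    by exists l' => //; rewrite mulrC.
  have := le_trans (rivals k l Kk cl) le1; rewrite leNgt => /negP; apply.
  by rewrite mulrCA gtr_pMr ?exprn_gt0 // ltr_pdivrMr ?ltr0n // mul1r ltr_nat.
have [i ci imax] : exists2 i, in_cluster i & forall l, in_cluster l -> r K l ^+ 2 <= r K i ^+ 2.
  by case: (arg_maxP (fun l => r K l ^+ 2) i0_in_cluster) => i ci imax; exists i.
have {}imax : forall k, (K <= k)%N ->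
    (forall l, in_cluster l -> r k l ^+ 2 <= r k i ^+ 2) /\ w k i = 1.
  apply: (@argmax_persists R 'I_n (fun k l => r k l ^+ 2) (fun k l => w k l)
    (fun k => d k) in_cluster K i) => // [k l Kk cl|k l Kk cl big_l].
    by split; [exact: orbit_radius_sqr|exact: w0|exact: ltW|exact: stride_le_quarter].
  have [l' /andP[cl' ll'] h] := partner k l Kk cl.
  have c1 : contact N (X k l) (X k l') = 1.
    apply: touch => // [|m cm|m cm]; [by rewrite eq_sym|exact: scale2 (big_l m cm)|].
    by apply: scale_n; have := big_l m cm; lra.
  by have [] := contact1_activity ll' c1.
have [j0 cj0 _] := partner K i (leqnn K) ci.
have [j cj jmax] : exists2 j, in_cluster j && (j != i) &
    forall l, in_cluster l && (l != i) -> r K l ^+ 2 <= r K j ^+ 2.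
  by case: (arg_maxP (P := fun l => in_cluster l && (l != i)) (fun l => r K l ^+ 2) cj0) => j cj jmax; exists j.
(* By [rivals], a ring close to the second largest is comparable to the largest ring i, hence in
   contact 1 with it. *)
have {}jmax : forall k, (K <= k)%N ->
    (forall l, in_cluster l && (l != i) -> r k l ^+ 2 <= r k j ^+ 2) /\ w k j = 1.
  apply: (@argmax_persists R 'I_n (fun k l => r k l ^+ 2) (fun k l => w k l)
    (fun k => d k) (fun l => in_cluster l && (l != i)) K j) => // [k l Kk /andP[cl _]|k l Kk].
    by split; [exact: orbit_radius_sqr|exact: w0|exact: ltW|exact: stride_le_quarter].
  move=> /andP[cl li] big_l; have [max_i _] := imax k Kk.
  have h : r k i ^+ 2 <= 2 * n.+1%:R * r k l ^+ 2.
    apply: le_trans (rivals k i Kk ci) _; apply: le_trans (sum_const_le _ big_l) _.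
      by rewrite mulr_ge0 // sqr_ge0.
    by rewrite mulrA ler_wpM2r ?sqr_ge0 // mulrC ler_wpM2l // ler_nat.
  have c1 : contact N (X k i) (X k l) = 1.
    apply: touch => // [|m cm|m cm]; first by rewrite eq_sym.
      by apply: scale2; have := max_i m cm; have := sqr_ge0 (r k i); lra.
    by apply: scale_n; exact: le_trans (max_i m cm) h.
  by have [] := contact1_activity li c1.
case/andP: cj => cj ji.
apply: (@active_limit i j K _ _ (lim_center i0)) => [|k Kk|]; first by rewrite eq_sym.
  by split; [case: (imax k Kk)|case: (jmax k Kk)].
have pow0 l : in_cluster l -> pow (lim_ring l) (lim_center i0) = 0.
  case/andP=> /eqP rl0 /eqP cl0.
  by rewrite /pow /lim_ring /center /radius /= cl0 rl0 subrr dot0l expr0n subrr.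
have in0 l : in_cluster l -> in_plane (lim_ring l) (lim_center i0).
  by case/andP=> _ /eqP cl0; rewrite /in_plane /lim_ring /center /= cl0 subrr dot0l.
by split; rewrite ?pow0 //; exact: in0.
Unshelve. all: by end_near. Qed.

End Cluster.

Lemma orbit_absurd : False.
Proof.
have [i0 ri0] := radius_vanishes.
have [[j [pj Pj]]|no] := pselect (exists j, persists j /\ cdist (lim_center i0) (lim_ring j) = 0).
  exact: (attached_absurd ri0 pj Pj).
apply: (detached_absurd ri0) => j pj; rewrite lt_def cdist_ge0 andbT.
by apply/eqP => Pj; apply: no; exists j.
Qed.

End Orbit.

(** * The homotopy *)

Section Limits.
Context {R : realType} {T : Type} {F : set_system T} {FF : Filter F}.

Lemma cvg_divr (f g : T -> R) (a b : R) : b != 0 -> f @ F --> a -> g @ F --> b ->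
  (fun t => f t / g t) @ F --> a / b.
Proof.
move=> b0 fa gb; have gV : (fun t => (g t)^-1) @ F --> b^-1 by exact: cvgV.
exact: cvgM.
Qed.

Lemma cvg_sumr (I : finType) (P : pred I) (f : I -> T -> R) (a : I -> R) :
  (forall i, P i -> f i @ F --> a i) ->
  (fun t => \sum_(i | P i) f i t) @ F --> \sum_(i | P i) a i.
Proof. by move=> fa; apply: cvg_big => //; exact: add_continuous. Qed.

Lemma cvg_sumv (I : finType) m (f : I -> T -> 'rV[R]_m) (a : I -> 'rV[R]_m) :
  (forall i, f i @ F --> a i) -> (fun t => \sum_i f i t) @ F --> \sum_i a i.
Proof. by move=> fa; apply: cvg_big => //; exact: add_continuous. Qed.

Lemma cvg_bigmaxr (I : finType) (P : pred I) (f : I -> T -> R) (a : I -> R) (c : R) :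
  (forall i, P i -> f i @ F --> a i) ->
  (fun t => \big[Num.max/c]_(i | P i) f i t) @ F --> \big[Num.max/c]_(i | P i) a i.
Proof.
move=> fa; apply: cvg_big => // z; apply: cvg_maxr; [exact: cvg_fst|exact: cvg_snd].
Qed.

Lemma cvg_bigminr (I : finType) (f : I -> T -> R) (a : I -> R) (c : R) :
  (forall i, f i @ F --> a i) ->
  (fun t => \big[Num.min/c]_i f i t) @ F --> \big[Num.min/c]_i a i.
Proof.
move=> fa; apply: cvg_big => // z; apply: cvg_minr; [exact: cvg_fst|exact: cvg_snd].
Qed.

Definition cvg_ring (y : T -> ring_data R) (b : ring_data R) :=
  [/\ (fun t => center (y t)) @ F --> center b, (fun t => radius (y t)) @ F --> radius b &
      (fun t => normal (y t)) @ F --> normal b].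

Lemma cvg_cdist (q : T -> 'rV[R]_3) q0 y b : q @ F --> q0 -> cvg_ring y b ->
  (fun t => cdist (q t) (y t)) @ F --> cdist q0 b.
Proof.
move=> qq [cy ry ny].
have h : (fun t => q t - center (y t)) @ F --> q0 - center b by exact: cvgB.
have h1 : (fun t => enorm (q t - center (y t)) - radius (y t)) @ F -->
    enorm (q0 - center b) - radius b by apply: cvgB => //; exact: cvg_enorm.
have h2 : (fun t => dot (q t - center (y t)) (normal (y t))) @ F -->
    dot (q0 - center b) (normal b) by exact: cvg_dot h ny.
by apply: cvgD; apply: cvg_norm.
Qed.

Context {n : nat}.
Variable N : R.
Variables (x : T -> 'I_n -> ring_data R) (a : 'I_n -> ring_data R).
Hypothesis xa : forall i, cvg_ring (fun t => x t i) (a i).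
Hypothesis av : valid a.
Let r0 i : 0 < radius (a i). Proof. by have [] := av i. Qed.
Let xc i : (fun t => center (x t i)) @ F --> center (a i). Proof. by have [] := xa i. Qed.
Let xr i : (fun t => radius (x t i)) @ F --> radius (a i). Proof. by have [] := xa i. Qed.

Lemma cvg_contact i j : (fun t => contact N (x t i) (x t j)) @ F --> contact N (a i) (a j).
Proof.
have h : (fun t => 2 - clearance (x t i) (x t j) / N) @ F --> 2 - clearance (a i) (a j) / N.
  apply: cvgB; first exact: cvg_cst.
  apply: cvgMl; apply: cvg_maxr; apply: cvg_divr => //; rewrite ?gt_eqF //; exact: cvg_cdist.
exact: (cvg_comp _ _ h (@clamp_continuous R _)).
Qed.

Lemma cvg_activity i : (fun t => activity N (x t) i) @ F --> activity N a i.
Proof. by apply: cvg_bigmaxr => j _; exact: cvg_contact. Qed.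

Lemma cvg_stride : (fun t => stride (x t)) @ F --> stride a.
Proof.
apply: cvgM; first exact: cvg_cst.
apply: cvg_bigminr => i; under eq_fun do rewrite expr2; rewrite expr2; exact: cvgM.
Qed.

Lemma cvg_pull i j : (fun t => pull (x t) i j) @ F --> pull a i j.
Proof.
apply: cvg_maxr; first exact: cvg_cst.
apply: cvgB; last exact: cvg_cst.
apply: cvg_divr => //; first by rewrite gt_eqF // lt_max r0 orbT.
by apply: cvg_maxr => //; exact: cvg_cdist.
Qed.

Variables (d : T -> R) (e : R).
Hypothesis de : d @ F --> e.

Lemma cvg_new_radius i : (fun t => new_radius N (d t) (x t) i) @ F --> new_radius N e a i.
Proof.
have h : (fun t => radius (x t i) ^+ 2 - activity N (x t) i * d t) @ F -->
    radius (a i) ^+ 2 - activity N a i * e.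
  apply: cvgB; last by apply: cvgM => //; exact: cvg_activity.
  by under eq_fun do rewrite expr2; rewrite expr2; exact: cvgM.
exact: (cvg_comp _ _ h (@sqrt_continuous R _)).
Qed.

Lemma cvg_average (v : T -> 'I_n -> 'rV[R]_3) u i :
  (forall j, (fun t => v t j) @ F --> u j) ->
  (fun t => average N (d t) (x t) (v t) i) @ F --> average N e a u i.
Proof.
move=> vu; have s_cvg : (fun t => 1 + \sum_j pull (x t) i j) @ F --> 1 + \sum_j pull a i j.
  by apply: cvgD; [exact: cvg_cst|apply: cvg_sumr => j _; exact: cvg_pull].
rewrite /average; apply: cvgZ.
  apply: cvg_divr => //; first by rewrite gt_eqF // sum_pull_gt0.
  by apply: cvgB; [exact: cvg_cst|exact: cvg_activity].
apply: cvg_sumv => j; apply: cvgZ; first exact: cvg_pull.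
apply: cvgB => //; apply: cvgZ; last exact: cvgB.
apply: cvg_divr => //; first by rewrite gt_eqF.
by apply: cvgB => //; exact: cvg_new_radius.
Qed.

Lemma cvg_drift i : (fun t => drift N (d t) (x t) i) @ F --> drift N e a i.
Proof.
suff H m j : (fun t => iter m (average N (d t) (x t)) (fun=> 0) j) @ F -->
  iter m (average N e a) (fun=> 0) j by exact: H.
elim: m j => [|m IH] j /=; first exact: cvg_cst.
exact: cvg_average.
Qed.

Lemma cvg_evolve i : cvg_ring (fun t => evolve N (d t) (x t) i) (evolve N e a i).
Proof.
split; [apply: cvgD => //; exact: cvg_drift|exact: cvg_new_radius|by have [] := xa i].
Qed.
End Limits.

(** * Damped orbits and their stopping time *)

Section Homotopy.
Context {R : realType} {n : nat}.
Variable N : R.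
Local Notation state := ('I_n -> ring_data R).
Implicit Types (x y : state) (s d : R) (i j : 'I_n).

Definition intensity x : R := \big[Num.max/0]_i activity N x i.

Definition damp x : R := clamp (2 * intensity x - 1).

Definition flow x : state := evolve N (stride x) x.

Definition weight x k : R := \prod_(0 <= i < k.+1) damp (iter i flow x).

(* The weight of a step depends on the undamped orbit of x only, so that the time at
   which the damped orbit stops is the same for all s. *)
Fixpoint damped s x k : state :=
  if k is k'.+1 then
    let y := damped s x k' in evolve N (s * weight x k' * stride y) y
  else x.

(** Which index is chosen does not matter, by [homotopy_damped]. It depends only on the set of
    indices of weight 0, hence not on the labelling. *)
Definition settling x : nat := get [set k | weight x k = 0].

Definition homotopy s x : state := damped s x (settling x).

Lemma damp_itv x : 0 <= damp x <= 1.
Proof. exact: clamp_itv. Qed.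

Lemma damp_eq0 x : intensity x < 1 / 2 -> damp x = 0.
Proof. by move=> h; apply: clamp_le0; lra. Qed.

Lemma damp_eq1 x : 1 <= intensity x -> damp x = 1.
Proof. by move=> h; apply: clamp_ge1; lra. Qed.

Lemma weightS x k : weight x k.+1 = weight x k * damp (iter k.+1 flow x).
Proof. by rewrite /weight big_nat_recr. Qed.

Lemma weight_itv x k : 0 <= weight x k <= 1.
Proof.
elim: k => [|k /andP[w0 w1]]; first by rewrite /weight big_nat1 damp_itv.
rewrite weightS; have /andP[d0 d1] := damp_itv (iter k.+1 flow x).
by rewrite mulr_ge0 //= mulr_ile1.
Qed.

Lemma weight_mono x k m : (k <= m)%N -> weight x k = 0 -> weight x m = 0.
Proof.
move=> + w0; elim: m => [|m IH]; first by rewrite leqn0 => /eqP k0; rewrite -k0.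
rewrite leq_eqVlt => /orP[/eqP <- //|]; rewrite ltnS => /IH wm.
by rewrite weightS wm mul0r.
Qed.

Lemma evolve0 x : valid x -> evolve N 0 x = x.
Proof.
move=> xv; have nr i : new_radius N 0 x i = radius (x i).
  by rewrite /new_radius mulr0 subr0 sqrtr_sqr ger0_norm // ltW //; have [] := xv i.
have dr m i : iter m (average N 0 x) (fun=> 0) i = 0.
  elim: m i => //= m IH i; rewrite /average [X in _ *: X]big1 ?scaler0 // => j _.
  by rewrite /carry IH /loss nr subrr mul0r scale0r subr0 scaler0.
by apply/funext => i; rewrite /evolve nr /drift dr addr0 /center /radius /normal -!surjective_pairing.
Qed.

Section Unlinked.
Hypothesis N4 : 4 <= N.
Variables (s : R) (x : state).
Hypothesis s_itv : 0 <= s <= 1.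
Hypothesis x_unlinked : unlinked_state x.

Lemma damped_step_itv y k : valid y -> 0 <= s * weight x k * stride y <= stride y.
Proof.
move=> yv; have /andP[s0 s1] := s_itv; have /andP[w0 w1] := weight_itv x k.
have p0 := ltW (stride_gt0 yv).
have sw0 : 0 <= s * weight x k by exact: mulr_ge0.
by rewrite mulr_ge0 //= ler_piMl // mulr_ile1.
Qed.

Lemma damped_ind (P : state -> Prop) :
  (forall d y, unlinked_state y -> 0 <= d <= stride y -> P y -> P (evolve N d y)) ->
  P x -> forall k, unlinked_state (damped s x k) /\ P (damped s x k).
Proof.
move=> step Px; elim=> [|k [u Pk]] //=; have [v _] := u.
have d_itv := damped_step_itv k v.
by split; [exact: evolve_unlinked|exact: step].
Qed.

Lemma damped_unlinked k : unlinked_state (damped s x k).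
Proof. by have [] := @damped_ind (fun=> True) (fun _ _ _ _ _ => I) I k. Qed.

Lemma damped_const k m : (k <= m)%N -> weight x k = 0 -> damped s x m = damped s x k.
Proof.
move=> + w0; elim: m => [|m IH]; first by rewrite leqn0 => /eqP ->.
rewrite leq_eqVlt => /orP[/eqP <- //|]; rewrite ltnS => km; rewrite -(IH km) /=.
rewrite (weight_mono km w0) mulr0 mul0r evolve0 //.
by have [] := damped_unlinked m.
Qed.

Lemma homotopy_damped k : weight x k = 0 -> homotopy s x = damped s x k.
Proof.
move=> wk; have ws : weight x (settling x) = 0.
  by have := @getPex _ [set k | weight x k = 0]; apply; exists k.
rewrite /homotopy; have [le|/ltnW le] := leqP k (settling x).
  exact: damped_const.
by rewrite -(damped_const le ws).
Qed.

Lemma homotopy_unlinked : unlinked_state (homotopy s x).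
Proof. exact: damped_unlinked. Qed.

Lemma homotopy_inv (P : state -> Prop) :
  (forall d y, unlinked_state y -> 0 <= d <= stride y -> P y -> P (evolve N d y)) ->
  P x -> P (homotopy s x).
Proof. by move=> step Px; have [] := damped_ind step Px (settling x). Qed.

Lemma homotopy_normal i : normal (homotopy s x i) = normal (x i).
Proof. exact: (@homotopy_inv (fun y => normal (y i) = normal (x i))). Qed.

(** The similarities have their centers in the coordinate plane and so preserve it, whatever the
    step [d]. *)
Lemma drift_level d y (t : 'I_3) : (forall i, center (y i) 0 t = 0) ->
  forall i, drift N d y i 0 t = 0.
Proof.
move=> y0; rewrite /drift; elim: {3}n => [|m IH] i; first by rewrite mxE.
rewrite mxE summxE [X in _ * X]big1 ?mulr0 // => j _.
by rewrite !mxE IH !y0 subrr mulr0 subr0 mulr0.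
Qed.

Lemma homotopy_level (t : 'I_3) :
  (forall i, center (x i) 0 t = 0) -> forall i, center (homotopy s x i) 0 t = 0.
Proof.
apply: (@homotopy_inv (fun y => forall i, center (y i) 0 t = 0)) => d y _ _ y0 i.
by rewrite mxE y0 drift_level // addr0.
Qed.

Lemma homotopy_complexity c : 0 < c -> 5 + 5 / c <= N ->
  complexity_of x < c -> complexity_of (homotopy s x) < c.
Proof.
move=> c0 cN; apply: (@homotopy_inv (fun y => complexity_of y < c)) => d y [yv _] d_itv.
exact: evolve_complexity.
Qed.
End Unlinked.

Lemma homotopy0 x : 4 <= N -> unlinked_state x -> homotopy 0 x = x.
Proof.
move=> N4 xu; rewrite /homotopy; elim: (settling x) => //= k ->.
by rewrite !mul0r evolve0 //; case: xu.
Qed.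

(** Below intensity 1 no pair is in contact 1, so that all pairs are remote. *)
Lemma intensity_complexity c x : 0 < c -> 4 + 5 / c <= N -> valid x ->
  intensity x < 1 -> complexity_of x < c.
Proof.
move=> c0 cN xv lt1; have N0 : 0 < N.
  by apply: lt_le_trans cN; rewrite ltr_pwDl // divr_ge0 // ltW.
apply: bigmax_lt_of => // i _; apply: bigmax_lt_of => // j /and3P[ij rij /asboolP nij].
have [ri ni] := xv i; have [rj nj] := xv j.
apply: (@remote_ratio R N) => //; apply: contact_lt1 => //.
apply: le_lt_trans lt1; apply: le_trans (contact_le_activity N x _) _; first by rewrite eq_sym.
exact: le_bigmax_of.
Qed.

Hypothesis N_large : (10 * n.+1%:R) ^+ 3 <= N.
Let N4 : 4 <= N. Proof. by have := N_ge10 N_large; lra. Qed.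

Lemma flow_unlinked x k : unlinked_state x -> unlinked_state (iter k flow x).
Proof.
move=> xu; elim: k => //= k [v u]; apply: evolve_unlinked => //.
by rewrite lexx andbT ltW // stride_gt0.
Qed.

Lemma orbit_calms x : unlinked_state x -> exists k, intensity (iter k flow x) < 1 / 2.
Proof.
move=> xu; apply: contrapT => /forallNP no.
apply: (@orbit_absurd R n N (fun k => iter k flow x)) => // k.
apply: contrapT => calm; apply: (no k); apply: bigmax_lt_of => [|i _]; first lra.
apply: bigmax_lt_of => [|j ji]; first lra.
by rewrite ltNge; apply/negP => h; apply: calm; exists i, j; rewrite eq_sym.
Qed.

Lemma weight_vanishes x k : intensity (iter k flow x) < 1 / 2 -> weight x k = 0.
Proof.
move=> h; case: k h => [|k] h; first by rewrite /weight big_nat1 damp_eq0.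
by rewrite weightS damp_eq0 // mulr0.
Qed.

(** Up to the first damping factor below 1 the orbit is the undamped one. At that time the intensity
    is below 1, so that the complexity is below c, and later steps keep it there. *)
Lemma homotopy1_complexity c x : 0 < c -> 5 + 5 / c <= N -> unlinked_state x ->
  complexity_of (homotopy 1 x) < c.
Proof.
move=> c0 cN xu; have [K calm] := orbit_calms xu; have wK := weight_vanishes calm.
have i1 : 0 <= (1 : R) <= 1 by rewrite lexx ler01.
(* The extra step makes the first alternative at [K.+1] contradict [weight N x K = 0], a product of
   [K.+1] factors. *)
rewrite (homotopy_damped N4 i1 xu wK) -(damped_const N4 i1 xu (leqnSn K) wK).
have damped_prefix k : (damped 1 x k = iter k flow x /\
    \prod_(0 <= i < k) damp (iter i flow x) = 1) \/ complexity_of (damped 1 x k) < c.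
  elim: k => [|k [[e p1]|lt]]; first by left; rewrite big_nil.
    have [v u] := flow_unlinked k xu.
    have [/damp_eq1 d1|lt1] := lerP 1 (intensity (iter k flow x)).
      have w1 : weight x k = 1 by rewrite /weight big_nat_recr //= p1 mul1r d1.
      by left; split=> //=; rewrite e w1 !mul1r.
    right; rewrite /=; have [dv _] := damped_unlinked N4 i1 xu k.
    apply: evolve_complexity => //; first exact: damped_step_itv.
    by rewrite e; apply: intensity_complexity => //; lra.
  right; have [dv _] := damped_unlinked N4 i1 xu k.
  by apply: evolve_complexity => //; exact: damped_step_itv.
have [[_ p1]|//] := damped_prefix K.+1.
by move: wK; rewrite /weight p1 => /eqP; rewrite oner_eq0.
Qed.

Section Continuity.
Context {T : Type} {F : set_system T} {FF : Filter F}.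
Variables (x : T -> state) (a : state) (s : T -> R) (b : R).
Hypothesis xu : forall t, unlinked_state (x t).
Hypothesis au : unlinked_state a.
Hypothesis s_itv : forall t, 0 <= s t <= 1.
Hypothesis b_itv : 0 <= b <= 1.
Hypothesis xa : forall i, cvg_ring (F := F) (fun t => x t i) (a i).
Hypothesis sb : s @ F --> b.

Lemma cvg_flow k i : cvg_ring (F := F) (fun t => iter k flow (x t) i) (iter k flow a i).
Proof.
elim: k i => [|k IH] i //=; have [v _] := flow_unlinked k au.
by apply: cvg_evolve => //; exact: cvg_stride.
Qed.

Lemma cvg_intensity k : (fun t => intensity (iter k flow (x t))) @ F --> intensity (iter k flow a).
Proof.
apply: cvg_bigmaxr => i _; have [v _] := flow_unlinked k au.
by apply: cvg_activity => //; exact: cvg_flow.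
Qed.

Lemma cvg_damp k : (fun t => damp (iter k flow (x t))) @ F --> damp (iter k flow a).
Proof.
have h : (fun t => 2 * intensity (iter k flow (x t)) - 1) @ F -->
    2 * intensity (iter k flow a) - 1.
  apply: cvgB; last exact: cvg_cst.
  by apply: cvgM; [exact: cvg_cst|exact: cvg_intensity].
exact: (cvg_comp _ _ h (@clamp_continuous R _)).
Qed.

Lemma cvg_weight k : (fun t => weight (x t) k) @ F --> weight a k.
Proof.
elim: k => [|k IH]; last first.
  by under eq_fun do rewrite weightS; rewrite weightS; apply: cvgM => //; exact: cvg_damp.
rewrite /weight big_nat1; under eq_fun do rewrite big_nat1; exact: (@cvg_damp 0).
Qed.

Lemma cvg_damped k i : cvg_ring (F := F) (fun t => damped (s t) (x t) k i) (damped b a k i).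
Proof.
elim: k i => [|k IH] i //=; have [v _] := damped_unlinked N4 b_itv au k.
apply: cvg_evolve => //; apply: cvgM; last exact: cvg_stride.
by apply: cvgM => //; exact: cvg_weight.
Qed.

(** Intensity below 1 / 2 is an open condition, so that all configurations near [a] may be stopped
    at the same [K], where the homotopy is a finite composition of steps. *)
Lemma cvg_homotopy i : cvg_ring (F := F) (fun t => homotopy (s t) (x t) i) (homotopy b a i).
Proof.
have [K calm] := orbit_calms au.
have e : \forall t \near F, damped (s t) (x t) K i = homotopy (s t) (x t) i.
  near=> t; rewrite (homotopy_damped N4 (s_itv t) (xu t) (k := K)) //.
  apply: weight_vanishes; near: t; apply: cvgr_lt calm; exact: cvg_intensity.
have [c r nm] := cvg_damped K i.
rewrite (homotopy_damped N4 b_itv au (weight_vanishes calm)).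
split; [apply: cvg_trans c|apply: cvg_trans r|apply: cvg_trans nm];
  by apply: near_eq_cvg; near=> t; congr (_ _); near: t.
Unshelve. all: by end_near. Qed.
End Continuity.
End Homotopy.

(** * Equivariance under relabelling and change of orientations *)

Section Relabelling.
Context {R : realType} {n : nat}.
Variable N : R.
Local Notation state := ('I_n -> ring_data R).
Implicit Types (x y : state) (d : R) (i j : 'I_n).

Lemma same_ring_cdist (a b : ring_data R) (q : 'rV[R]_3) : same_ring a b -> cdist q a = cdist q b.
Proof.
move=> [ec er en]; rewrite /cdist ec er; case: en => -> //.
by rewrite dotuN normrN.
Qed.

Lemma same_ring_contact (a b a' b' : ring_data R) : same_ring a a' -> same_ring b b' ->
  contact N a b = contact N a' b'.
Proof.
move=> aa' bb'; rewrite /contact /clearance (same_ring_cdist _ aa') (same_ring_cdist _ bb').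
by have [-> -> _] := aa'; have [-> -> _] := bb'.
Qed.

Variables (p : 'S_n).
Definition relabels x y := forall i, same_ring (x i) (y (p i)).

Lemma relabels_activity x y i : relabels x y -> activity N x i = activity N y (p i).
Proof.
move=> xy; rewrite /activity [RHS](reindex_inj (@perm_inj _ p)).
by apply: eq_big => [j|j _]; [rewrite (inj_eq perm_inj)|exact: same_ring_contact].
Qed.

Lemma relabels_intensity x y : relabels x y -> intensity N x = intensity N y.
Proof.
move=> xy; rewrite /intensity [RHS](reindex_inj (@perm_inj _ p)).
by apply: eq_bigr => i _; exact: relabels_activity.
Qed.

Lemma relabels_stride x y : relabels x y -> stride x = stride y.
Proof.
move=> xy; rewrite /stride [in RHS](reindex_inj (@perm_inj _ p)); congr (_ * _).
by apply: eq_bigr => i _; have [_ -> _] := xy i.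
Qed.

Lemma relabels_new_radius d x y i : relabels x y -> new_radius N d x i = new_radius N d y (p i).
Proof.
by move=> xy; rewrite /new_radius (relabels_activity i xy); have [_ -> _] := xy i.
Qed.

Lemma relabels_pull x y i j : relabels x y -> pull x i j = pull y (p i) (p j).
Proof.
move=> xy; rewrite /pull (same_ring_cdist _ (xy j)).
by have [-> -> _] := xy i; have [_ -> _] := xy j.
Qed.

Lemma relabels_drift d x y i : relabels x y -> drift N d x i = drift N d y (p i).
Proof.
move=> xy; rewrite /drift.
suff H m k : iter m (average N d x) (fun=> 0) k = iter m (average N d y) (fun=> 0) (p k).
  exact: H.
elim: m k => //= m IH k; rewrite /average (relabels_activity k xy).
congr (_ / (1 + _) *: _); rewrite [RHS](reindex_inj (@perm_inj _ p)); apply: eq_bigr => j _.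
  exact: relabels_pull.
rewrite (relabels_pull k j xy) /carry IH /loss (relabels_new_radius d j xy).
by have [-> _ _] := xy k; have [-> -> _] := xy j.
Qed.

Lemma relabels_evolve d x y : relabels x y -> relabels (evolve N d x) (evolve N d y).
Proof.
move=> xy i; split; rewrite /evolve /center /radius /normal /=.
- by rewrite -/(center _) -/(center _) (relabels_drift d i xy); have [-> _ _] := xy i.
- exact: relabels_new_radius.
- by have [_ _] := xy i.
Qed.

Lemma relabels_flow x y k : relabels x y -> relabels (iter k (flow N) x) (iter k (flow N) y).
Proof.
move=> xy; elim: k => //= k IH; rewrite {1}/flow (relabels_stride IH).
exact: relabels_evolve.
Qed.

Lemma relabels_weight x y k : relabels x y -> weight N x k = weight N y k.
Proof.
move=> xy; apply: eq_bigr => i _.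
by rewrite /damp (relabels_intensity (relabels_flow i xy)).
Qed.

Lemma relabels_homotopy s x y : relabels x y -> relabels (homotopy N s x) (homotopy N s y).
Proof.
move=> xy; rewrite /homotopy.
have -> : settling N x = settling N y.
  by congr get; apply/funext => k /=; rewrite (relabels_weight k xy).
elim: (settling N y) => //= k IH.
by rewrite (relabels_weight k xy) (relabels_stride IH); exact: relabels_evolve.
Qed.
End Relabelling.

Local Open Scope quotient_scope.
Local Open Scope ring_scope.

(** * Unlabelled configurations *)

Section Labelled.
Context {R : realType} {n : nat}.
Local Notation L := (labelled_conf R n).

Lemma ring_at_unlinked (l : L) : unlinked_state (ring_at l).
Proof.
have [v u] := set_valP l; split=> // i j ij.
have [ri ni] := v i; have [rj nj] := v j.
by apply/(not_hitP ri rj ni nj); exact: u.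
Qed.

Lemma unlinked_labelled (x : 'I_n -> ring_data R) : unlinked_state x -> is_labelled_conf x.
Proof.
move=> [v u]; split=> // i j ij; have [ri ni] := v i; have [rj nj] := v j.
by apply/(not_hitP ri rj ni nj); exact: u.
Qed.

Lemma cvg_labelled (T : Type) (F : set_system T) {FF : Filter F} (g : T -> L) (l : L) :
  (forall i, cvg_ring (F := F) (fun t => ring_at (g t) i) (ring_at l i)) -> g @ F --> l.
Proof.
move=> gl; have vals : (fun t => set_val (g t)) @ F --> set_val l.
  apply/cvg_sup => i A [_ [[B Bop <-] Bl sBA]].
  have [c r m] := gl i.
  have h : (fun t => ring_at (g t) i) @ F --> ring_at l i.
    have e (b : ring_data R) : b = (center b, radius b, normal b) by case: b => -[].
    rewrite (e (ring_at l i)); under eq_fun do rewrite (e (ring_at _ _)).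
    exact: (cvg_pairP (cvg_pairP c r) m).
  have FB : F [set t | B (ring_at (g t) i)] by apply: h; exact: open_nbhs_nbhs.
  have sub : [set t | B (ring_at (g t) i)] `<=` [set t | A (set_val (g t))].
    by move=> t Bt; exact: sBA.
  exact: filterS sub FB.
move=> A [_ [[B Bop <-] Bl sBA]].
have FB : F [set t | B (set_val (g t))] by apply: vals; exact: open_nbhs_nbhs.
have sub : [set t | B (set_val (g t))] `<=` [set t | A (g t)] by move=> t Bt; exact: sBA.
exact: filterS sub FB.
Qed.

Lemma ring_at_cvg (l : L) i : cvg_ring (F := nbhs l) (fun m => ring_at m i) (ring_at l i).
Proof.
have h : (fun m : L => ring_at m i) @ l --> ring_at l i.
  have c1 : continuous (set_val : L -> _) by exact: initial_continuous.
  exact: (cvg_comp _ _ (c1 l) (@proj_continuous _ _ i _)).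
split.
- exact: (cvg_comp _ _ h (cvg_comp _ _ cvg_fst cvg_fst)).
- exact: (cvg_comp _ _ h (cvg_comp _ _ cvg_fst cvg_snd)).
- exact: (cvg_comp _ _ h cvg_snd).
Qed.
End Labelled.

Section Quotient.
Context {R : realType} {n : nat}.
Local Notation L := (labelled_conf R n).
Local Notation Q := (ring_conf R n).
Local Notation class := (\pi_Q : L -> Q).

Lemma pi_eqP (l m : L) : \pi_Q l = \pi_Q m <-> same_conf l m.
Proof.
by rewrite -[X in is_true X]/(same_conf_equiv _ _ _); split=> /eqmodP.
Qed.

Definition orient (e : bool) (y : ring_data R) : ring_data R :=
  (center y, radius y, if e then normal y else - normal y).

Lemma orient_same e y : same_ring (orient e y) y.
Proof. by split=> //; case: e; [left|right]. Qed.

Lemma relabelled_conf (p : 'S_n) (e : 'I_n -> bool) (l : L) :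
  is_labelled_conf (fun i => orient (e i) (ring_at l (p i))).
Proof.
have [v u] := set_valP l; split=> [i|i j ij].
  have [r m] := v (p i); split=> //; rewrite /orient; case: (e i) => //.
  by rewrite /normal /= enormN.
rewrite (same_ring_circle (orient_same (e i) _)) (same_ring_circle (orient_same (e j) _)).
by apply: u; rewrite (inj_eq perm_inj).
Qed.

Definition relabel (p : 'S_n) (e : 'I_n -> bool) (l : L) : L :=
  exist (fun y => y \in @is_labelled_conf R n) _ (mem_set (relabelled_conf p e l)).

Lemma relabel_continuous p e : continuous (relabel p e).
Proof.
move=> l; apply: (cvg_labelled (FF := nbhs_filter l)) => i; have [c r m] := ring_at_cvg l (p i).
split=> //; rewrite /ring_at /= /orient; case: (e i) => //; exact: cvgN.
Qed.

(** Permutation and signs are read off once from [l] and [m] and then kept fixed, so that one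
    continuous map of the whole space takes [l] to [m] within the classes. *)
Lemma same_conf_relabel (l m : L) : same_conf l m -> exists p e,
  relabel p e l = m /\ forall k, same_conf (relabel p e k) k.
Proof.
move=> /asboolP[s lm]; exists s^-1%g.
exists (fun i => normal (ring_at l (s^-1%g i)) == normal (ring_at m i)); split; last first.
  by move=> k; apply/asboolP; exists s^-1%g => i; exact: orient_same.
apply: val_inj; apply/funext => i /=; have := lm (s^-1%g i); rewrite permKV => -[c r nn].
rewrite /orient -/(ring_at m i) c r.
have -> : (if normal (ring_at l (s^-1%g i)) == normal (ring_at m i)
    then normal (ring_at l (s^-1%g i)) else - normal (ring_at l (s^-1%g i))) = normal (ring_at m i).
  case: eqP => // ne; case: nn => // ->; exact: opprK.
by rewrite /center /radius /normal -!surjective_pairing.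
Qed.

(* Equivalent labellings are exchanged by homeomorphisms of the space of labellings. *)
Lemma pi_open (l : L) (B : set L) : nbhs l B -> nbhs (\pi_Q l) (class @` B).
Proof.
rewrite nbhsE => -[V [Vo Vl] VB]; rewrite nbhsE; exists (class @` V); last exact: image_subset.
split; last by exists l.
rewrite -[open _]/(open (class @^-1` (class @` V))) openE => m [k Vk /esym /pi_eqP].
move=> /same_conf_relabel[p [e [mk same]]].
have nV : nbhs (relabel p e m) V by rewrite mk; exact: open_nbhs_nbhs.
have mV : nbhs m [set k' | V (relabel p e k')] by exact: relabel_continuous nV.
have sub : [set k' | V (relabel p e k')] `<=` class @^-1` (class @` V).
  by move=> k' Vk'; exists (relabel p e k') => //; apply/pi_eqP; exact: same.
exact: filterS sub mV.
Qed.
End Quotient.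

(** * Homotopy equivalences from ambient deformations *)

Section Equivalence.
Context {R : realType}.

(** The last clause is the universal property of the subspace topology; in this form the whole space
    and its subspaces are treated alike. *)
Definition embedding (X T : topologicalType) (e : X -> T) :=
  [/\ continuous e, injective e &
      forall (Z : topologicalType) (g : Z -> X), continuous (e \o g) -> continuous g].

Lemma embedding_id (T : topologicalType) : embedding (@idfun T).
Proof. by split=> // x. Qed.

Lemma embedding_set_val (T : topologicalType) (A : set T) : embedding (set_val : set_type A -> T).
Proof.
split; [exact: initial_continuous|exact: val_inj|].
by move=> Z g cg; exact: continuous_comp_initial.
Qed.

(** The ambient deformation only has to map points to the right subspaces: the maps into X and Y
    come from choice, and injectivity and the universal property give their equations and
    continuity. *)
Lemma deformation_equivalence (X Y T : topologicalType) (eX : X -> T) (eY : Y -> T)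
    (f : X -> Y) (h : R * T -> T) :
  embedding eX -> embedding eY -> (forall x, eY (f x) = eX x) ->
  continuous h -> (forall t, h (0, t) = t) ->
  (forall y, exists x, eX x = h (1, eY y)) ->
  (forall s x, exists x', eX x' = h (s, eX x)) ->
  (forall s y, exists y', eY y' = h (s, eY y)) ->
  homotopy_equivalence R f.
Proof.
move=> [cX iX lX] [cY iY lY] fE ch h0 into hX hY.
(* Time is reversed because the required homotopies start at the composite and end at the
   identity. *)
have rev (Z : topologicalType) (e : Z -> T) : continuous e ->
    continuous (fun z : R * Z => h (1 - z.1, e z.2)).
  move=> ce z; apply: (@continuous_comp _ _ _ (fun z : R * Z => (1 - z.1, e z.2)) h); last exact: ch.
  apply: cvg_pairP; first by apply: cvgB; [exact: cvg_cst|exact: cvg_fst].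
  by apply: (@continuous_comp _ _ _ snd e); [exact: cvg_snd|exact: ce].
have /choice[g gE] := into.
have /choice[HX HXE] : forall z : R * X, exists x', eX x' = h (1 - z.1, eX z.2) by move=> z.
have /choice[HY HYE] : forall z : R * Y, exists y', eY y' = h (1 - z.1, eY z.2) by move=> z.
split; first by apply: lY; rewrite (_ : eY \o f = eX) //; apply/funext.
exists g; split.
- apply: lX; rewrite (_ : eX \o g = fun y => h (1, eY y)); last exact/funext.
  move=> y; apply: (@continuous_comp _ _ _ (fun y => (1 : R, eY y)) h); last exact: ch.
  by apply: cvg_pairP; [exact: cvg_cst|exact: cY].
- exists HX; split=> [|x|x].
  + apply: continuous_subspaceT; apply: lX.
    by rewrite (_ : eX \o HX = fun z => h (1 - z.1, eX z.2)); [exact: rev|exact/funext].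
  + by apply: iX; rewrite HXE /= gE fE subr0.
  + by apply: iX; rewrite HXE /= subrr h0.
- exists HY; split=> [|y|y].
  + apply: continuous_subspaceT; apply: lY.
    by rewrite (_ : eY \o HY = fun z => h (1 - z.1, eY z.2)); [exact: rev|exact/funext].
  + by apply: iY; rewrite HYE /= fE gE subr0.
  + by apply: iY; rewrite HYE /= subrr h0.
Qed.

Lemma set_val_onto (T : Type) (A : set T) (t : T) : A t -> exists x : set_type A, set_val x = t.
Proof. by move=> At; exists (exist (fun t => t \in A) t (mem_set At)). Qed.

Lemma inclusion_equivalence (T : topologicalType) (A P : set T) (h : R * T -> T) :
  continuous h -> (forall t, h (0, t) = t) -> (forall t, A (h (1, t))) ->
  (forall s t, A t -> A (h (s, t))) -> (forall s t, P t -> P (h (s, t))) ->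
  homotopy_equivalence R (inclusion (@subIsetr _ A P)).
Proof.
move=> ch h0 h1 hA hP.
apply: (deformation_equivalence (embedding_set_val (A `&` P)) (embedding_set_val P) _ ch h0) => //.
- by move=> y; apply: set_val_onto; split; [exact: h1|exact: hP (set_valP y)].
- move=> s x; apply: set_val_onto; have [Ax Px] := set_valP x.
  by split; [exact: hA|exact: hP].
- by move=> s y; apply: set_val_onto; exact: hP (set_valP y).
Qed.

Lemma subspace_equivalence (T : topologicalType) (A : set T) (h : R * T -> T) :
  continuous h -> (forall t, h (0, t) = t) -> (forall t, A (h (1, t))) ->
  (forall s t, A t -> A (h (s, t))) ->
  homotopy_equivalence R (set_val : set_type A -> T).
Proof.
move=> ch h0 h1 hA.
apply: (deformation_equivalence (embedding_set_val A) (embedding_id T) _ ch h0) => //.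
- by move=> y; exact: set_val_onto.
- by move=> s x; apply: set_val_onto; exact: hA (set_valP x).
- by move=> s y; exists (h (s, y)).
Qed.
End Equivalence.

(** * Descent of the homotopy to unordered configurations *)

Section Deformation.
Context {R : realType} {n : nat}.
Variable N : R.
Hypothesis N_large : (10 * n.+1%:R) ^+ 3 <= N.
Local Notation L := (labelled_conf R n).
Local Notation Q := (ring_conf R n).
Let N4 : 4 <= N. Proof. by have := N_ge10 N_large; lra. Qed.

Lemma deform_subproof (z : R * L) : is_labelled_conf (homotopy N (clamp z.1) (ring_at z.2)).
Proof.
apply: unlinked_labelled; apply: homotopy_unlinked => //; first exact: clamp_itv.
exact: ring_at_unlinked.
Qed.

(** Clamping the time gives a map on all of R x L, so that plain continuity can be used instead of
    continuity within the unit interval. *)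
Definition deform (z : R * L) : L :=
  exist (fun y => y \in @is_labelled_conf R n) _ (mem_set (deform_subproof z)).

Lemma deform_continuous : continuous deform.
Proof.
move=> z; apply: (cvg_labelled (FF := nbhs_filter z)) => i.
apply: (cvg_homotopy N_large (x := fun z : R * L => ring_at z.2) (s := fun z => clamp z.1)).
- by move=> t; exact: ring_at_unlinked.
- exact: ring_at_unlinked.
- by move=> t; exact: clamp_itv.
- exact: clamp_itv.
- move=> j; have [c r m] := ring_at_cvg z.2 j.
  have s2 : (fun z : R * L => z.2) @ z --> z.2 by exact: cvg_snd.
  by split; [exact: (cvg_comp _ _ s2 c)|exact: (cvg_comp _ _ s2 r)|exact: (cvg_comp _ _ s2 m)].
- have s1 : (fun z : R * L => z.1) @ z --> z.1 by exact: cvg_fst.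
  exact: (cvg_comp _ _ s1 (@clamp_continuous R z.1)).
Qed.

Definition deform_conf (z : R * Q) : Q := \pi_Q (deform (z.1, repr z.2)).

(** By equivariance the chosen representative may be replaced by any labelling. *)
Lemma deform_confE s l : deform_conf (s, \pi_Q l) = \pi_Q (deform (s, l)).
Proof.
apply/pi_eqP; have /pi_eqP/asboolP[p lp] : \pi_Q (repr (\pi_Q l)) = \pi_Q l by exact: reprK.
by apply/asboolP; exists p; exact: relabels_homotopy.
Qed.

(** The product of a quotient map with an identity need not be a quotient map; openness of the
    projection makes continuity descend. *)
Lemma deform_conf_continuous : continuous deform_conf.
Proof.
move=> [s C]; rewrite -(reprK C); move: (repr C) => l U nU.
have nV : nbhs (s, l) [set z | U (\pi_Q (deform z))].
  rewrite deform_confE in nU.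
  by have := @deform_continuous (s, l) _ (@pi_continuous _ _ _ _ nU).
case: nV => -[A B] [nA nB] AB.
exists (A, (\pi_Q : L -> Q) @` B); first by split=> //; exact: pi_open.
by move=> [s' _] [/= As' [l' Bl' <-]]; rewrite /= deform_confE; apply: (AB (s', l')).
Qed.

Lemma deform_conf0 C : deform_conf (0, C) = C.
Proof.
rewrite -[C]reprK deform_confE; congr (\pi_Q _); apply: val_inj => /=.
by rewrite clamp_le0 // homotopy0 //; exact: ring_at_unlinked.
Qed.

Lemma deform_conf_complexity c s C : 0 < c -> 5 + 5 / c <= N ->
  conf_lt R n c C -> conf_lt R n c (deform_conf (s, C)).
Proof.
move=> c0 cN; rewrite -[C]reprK deform_confE /conf_lt /= !complexity_pi.
apply: homotopy_complexity => //; [exact: clamp_itv|exact: ring_at_unlinked].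
Qed.

Lemma deform_conf1 c C : 0 < c -> 5 + 5 / c <= N -> conf_lt R n c (deform_conf (1, C)).
Proof.
move=> c0 cN; rewrite -[C]reprK deform_confE /conf_lt /= complexity_pi.
rewrite [ring_at _]/(homotopy N (clamp 1) (ring_at (repr C))) clamp_ge1 //.
by apply: homotopy1_complexity => //; exact: ring_at_unlinked.
Qed.

Lemma deform_conf_rings_in (P : ring_data R -> Prop) s C :
  (forall y z, same_ring y z -> P y -> P z) ->
  (forall x, unlinked_state x -> (forall i, P (x i)) ->
    forall i : 'I_n, P (homotopy N (clamp s) x i)) ->
  rings_in P C -> rings_in P (deform_conf (s, C)).
Proof.
move=> PP Ph; rewrite -[C]reprK deform_confE => /(rings_in_pi _ PP) PC.
by apply/(rings_in_pi _ PP) => i; apply: Ph => //; exact: ring_at_unlinked.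
Qed.

Lemma deform_UR s C : UR R n C -> UR R n (deform_conf (s, C)).
Proof.
apply: deform_conf_rings_in => [y z yz [h1 h2]|x xu Px i].
  by split; exact: same_ring_parallel yz _.
by have [h1 h2] := Px i; rewrite /parallel homotopy_normal //; exact: clamp_itv.
Qed.

Lemma deform_VR s C : VR R n C -> VR R n (deform_conf (s, C)).
Proof.
apply: deform_conf_rings_in => [y z|x xu Px i]; first exact: same_ring_parallel.
by rewrite /parallel homotopy_normal //; [exact: Px|exact: clamp_itv].
Qed.

Lemma deform_W s C : W R n C -> W R n (deform_conf (s, C)).
Proof.
apply: deform_conf_rings_in => [y z yz [h1 h2]|x xu Px i].
  by split; [exact: same_ring_parallel yz h1|have [<- _ _] := yz].
have [h1 _] := Px i; split.
  by rewrite /parallel homotopy_normal //; exact: clamp_itv.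
by apply: homotopy_level => //; [exact: clamp_itv|move=> j; have [] := Px j].
Qed.

Lemma deform_UW s C : UW R n C -> UW R n (deform_conf (s, C)).
Proof. by move=> [w u]; split; [exact: deform_W|exact: deform_UR]. Qed.
End Deformation.

Theorem theorem2p1 (R : realType) (n : nat) (hn : (1 <= n)%N)
    (c : R) (hc : 0 < c) :
  homotopy_equivalence R (set_val : set_type (conf_lt R n c) -> ring_conf R n) /\
  homotopy_equivalence R (inclusion (@subIsetr _ (conf_lt R n c) (UR R n))) /\
  homotopy_equivalence R (inclusion (@subIsetr _ (conf_lt R n c) (VR R n))) /\
  homotopy_equivalence R (inclusion (@subIsetr _ (conf_lt R n c) (W R n))) /\
  homotopy_equivalence R (inclusion (@subIsetr _ (conf_lt R n c) (UW R n))).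
Proof.
(* The first summand makes every orbit calm down, the second ties the absence of contact to
   complexity below c. *)
pose N : R := (10 * n.+1%:R) ^+ 3 + (5 + 5 / c).
have N1 : (10 * n.+1%:R) ^+ 3 <= N by rewrite lerDl addr_ge0 // divr_ge0 // ltW.
have N2 : 5 + 5 / c <= N by rewrite lerDr exprn_ge0 // mulr_ge0.
have cont := @deform_conf_continuous R n N N1; have h0 := deform_conf0 N1.
have h1 C := deform_conf1 N1 C hc N2.
have hA s C := @deform_conf_complexity R n N N1 c s C hc N2.
split; first exact: subspace_equivalence cont h0 h1 hA.
split; first exact: inclusion_equivalence cont h0 h1 hA (deform_UR N1).
split; first exact: inclusion_equivalence cont h0 h1 hA (deform_VR N1).
split; first exact: inclusion_equivalence cont h0 h1 hA (deform_W N1).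
exact: inclusion_equivalence cont h0 h1 hA (deform_UW N1).
Qed.
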